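(* Let $\mathcal{F}$ be a family of meromorphic functions on a domain $D\subseteq\mathbb{C}$ and let $\epsilon, M$ be two positive real numbers. Suppose that for each $f\in\mathcal{F}$ there exist three holomorphic functions $a_1^f,a_2^f,a_3^f$ defined on $D$ such that the following conditions are satisfied: (i) $|a_j^f(z)|\le M$ and $|a_j^f(z)-a_k^f(z)|\ge\epsilon$ for all $z\in D$ and all $j,k\in\{1,2,3\}$ with $j\ne k$. (ii) For any $z\in D$, if $f'(z)=a_j^f(z)$ then $f(z)=a_j^f(z)$, for $j\in\{1,2,3\}$. (iii) For any $z\in D$, if $f(z)=a_j^f(z)$ then $|f'(z)|\le M$, for $j\in\{1,2,3\}$. Then $\mathcal{F}$ is normal in $D$.
   Context: A family $\mathcal{F}$ of meromorphic functions on $D$ is normal in $D$ if every sequence in $\mathcal{F}$ has a subsequence converging locally uniformly in $D$ with respect to the spherical metric of the Riemann sphere (the limit being meromorphic or identically $\infty$). *)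

(* Defs.v *)
From Stdlib Require Import Reals.
From Coquelicot Require Import Coquelicot.
Open Scope R_scope.

Definition connected_set (D : C -> Prop) : Prop :=
  forall U V : C -> Prop,
    open U -> open V ->
    (forall z, D z -> U z \/ V z) ->
    (forall z, D z -> ~ (U z /\ V z)) ->
    (forall z, D z -> U z) \/ (forall z, D z -> V z).

Definition is_domain (D : C -> Prop) : Prop :=
  (exists z, D z) /\ open D /\ connected_set D.

Definition holomorphic_on (D : C -> Prop) (a : C -> C) : Prop :=
  forall z : C, D z -> ex_derive a z.

Inductive sphere : Type :=
  | Fin : C -> sphere
  | Inf : sphere.

(** Chordal distance: Euclidean distance in R^3 between the stereographic
    images on the unit sphere. *)
Definition chordal_dist (p q : sphere) : R :=
  match p, q with
  | Fin z, Fin w =>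
      2 * Cmod (z - w)%C / (sqrt (1 + Cmod z ^ 2) * sqrt (1 + Cmod w ^ 2))
  | Fin z, Inf | Inf, Fin z => 2 / sqrt (1 + Cmod z ^ 2)
  | Inf, Inf => 0
  end.

(** Great-circle distance on the unit sphere: an arc of angle t has a chord of
    length 2 sin (t / 2). *)
Definition spherical_dist (p q : sphere) : R :=
  2 * asin (chordal_dist p q / 2).

(** Functions on [D] are total functions of which only the values on [D]
    matter (all domains are open). *)
Definition holomorphic_at (f : C -> sphere) (z : C) : Prop :=
  exists g : C -> C,
    locally z (fun w : C => f w = Fin (g w) /\ ex_derive g w).

Definition pole_at (f : C -> sphere) (z : C) : Prop :=
  f z = Inf /\
  exists g : C -> C,
    locally' z (fun w : C => f w = Fin (g w) /\ ex_derive g w) /\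
    filterlim (fun w : C => Cmod (g w)) (locally' z) (Rbar_locally p_infty).

Definition meromorphic_on (D : C -> Prop) (f : C -> sphere) : Prop :=
  forall z : C, D z -> holomorphic_at f z \/ pole_at f z.

(** [f'(z) = l] with [l] finite; this fails for every [l] when [f z = Inf]. *)
Definition has_derivative (f : C -> sphere) (z l : C) : Prop :=
  exists g : C -> C,
    locally z (fun w : C => f w = Fin (g w)) /\ is_derive g z l.

Definition cvg_locally_uniformly
    (D : C -> Prop) (f : nat -> C -> sphere) (g : C -> sphere) : Prop :=
  forall z : C, D z ->
    exists U : C -> Prop, locally z U /\
      forall eps : R, 0 < eps ->
        exists N : nat, forall n : nat, (N <= n)%nat ->
          forall w : C, U w -> D w -> spherical_dist (f n w) (g w) < eps.

Definition normal_family (D : C -> Prop) (F : (C -> sphere) -> Prop) : Prop :=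
  forall f : nat -> C -> sphere,
    (forall n : nat, F (f n)) ->
    exists (phi : nat -> nat) (g : C -> sphere),
      (forall n : nat, (phi n < phi (S n))%nat) /\
      (meromorphic_on D g \/ (forall z : C, D z -> g z = Inf)) /\
      cvg_locally_uniformly D (fun n => f (phi n)) g.

(* Main.v *)
Require Import Defs.
From Stdlib Require Import Reals.
From Coquelicot Require Import Coquelicot.
From Stdlib Require Import Lra Lia Psatz ZArith ClassicalEpsilon Cantor.
Open Scope R_scope.

(** If the family is not normal at a point, Zalcman's rescaling gives functions
    [g_n z = f_n (x_n + r_n z)], [r_n -> 0], converging to a nonconstant meromorphic
    [g] on the plane, while [a_j (x_n + r_n z)] converges to distinct constants [A_j].
    If [g'] vanishes at [z], Hurwitz's theorem for [g_n' - r_n a_j] produces points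
    tending to [z] where [f_n' = a_j], hence [f_n = a_j], so that [g z = A_j] for every
    [j], which is absurd.  If [g z = A_j], Hurwitz's theorem produces points where
    [f_n = a_j], hence [|g_n'| <= r_n M], and [g'] vanishes at [z] after all.  So [g]
    omits three values, against Picard's theorem.

    The scale of a function is measured without spherical derivatives, by the discs on
    which it or its inverse is bounded by 2; a doubling argument finds centres and radii
    to rescale by.  Picard's theorem follows from the same rescaling (Zalcman, Ros): if
    [G = exp p] omits [0] and [1], then [exp (p / n)] omits the [n]-th roots of unity, so
    a rescaled limit of these functions omits the whole unit circle but takes values on
    both sides of it. *)

(** The bound 2 exceeds 1, so the charts [w] and [1 / w] overlap: near each point a meromorphic
    function or its inverse stays below 2, and on a disc where this holds Montel's theorem gives
    limits. A disc where it fails contains a point where the function is not bounded by 2 and a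
    point where its inverse is not. Once such a disc is rescaled to the unit disc both points
    survive in the limit, as [|g| >= 2] and [|1 / g| >= 2], infinity included, and this is why [g]
    is nonconstant.

    The bound [M] on the [a_j] also enters through Cauchy's estimate: the [a_j] vary by [O(r_n)] on
    rescaled discs, so their limits are constants, and [epsilon] keeps these apart. Hurwitz's
    theorem wants isolated zeros: [g'] cannot vanish on a disc, since [g] would then be constant
    there and, by the identity theorem, everywhere.

    Poles are absorbed by taking values in [sphere] and using the inversion [sinv] as a symmetry:
    statements are proved in the finite chart and carried to the other. Constants are crude
    throughout, because only their finiteness matters. *)

(** * Elementary estimates for the complex modulus *)

Lemma Cmod_minus_sym (x y : C) : Cmod (x - y) = Cmod (y - x).
Proof.
  rewrite <- Cmod_opp. f_equal. ring.
Qed.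

Lemma Cmod_sub_triangle (x y z : C) : Cmod (x - z) <= Cmod (x - y) + Cmod (y - z).
Proof.
  replace (x - z)%C with ((x - y) + (y - z))%C by ring. apply Cmod_triangle.
Qed.

Lemma Cmod_le_add (x y : C) : Cmod x <= Cmod y + Cmod (x - y).
Proof.
  replace x with (y + (x - y))%C at 1 by ring. apply Cmod_triangle.
Qed.

Lemma Cmod_minus_le (x y : C) : Cmod (x - y) <= Cmod x + Cmod y.
Proof.
  replace (x - y)%C with (x + - y)%C by ring.
  eapply Rle_trans; [apply Cmod_triangle|]. rewrite Cmod_opp. lra.
Qed.

Lemma Cmod_sub_diag (x : C) : Cmod (x - x) = 0.
Proof. replace (x - x)%C with (RtoC 0) by ring. apply Cmod_0. Qed.

Lemma Cmod_sub_eq_0 (x y : C) : Cmod (x - y) = 0 -> x = y.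
Proof.
  intros H. apply Cmod_eq_0 in H.
  replace x with (y + (x - y))%C by ring. rewrite H. ring.
Qed.

Lemma eq_of_Cmod_small (x y : C) : (forall e, 0 < e -> Cmod (x - y) <= e) -> x = y.
Proof.
  intros H. apply Cmod_sub_eq_0. apply Rle_antisym; [|apply Cmod_ge_0].
  apply le_epsilon. intros e He. rewrite Rplus_0_l. auto.
Qed.

Lemma zero_of_Cmod_small (x : C) : (forall e, 0 < e -> Cmod x <= e) -> x = 0.
Proof.
  intros H. apply eq_of_Cmod_small. intros e He. replace (x - 0)%C with x by ring. auto.
Qed.

Lemma Csub_neq_0 (x y : C) : x <> y -> (x - y)%C <> 0.
Proof.
  intros H E. apply H. apply Cmod_sub_eq_0. rewrite E. apply Cmod_0.
Qed.

Lemma Cmod_Rpos (r : R) : 0 <= r -> Cmod r = r.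
Proof. intros H. rewrite Cmod_R. apply Rabs_pos_eq, H. Qed.

Lemma Cmod_le_sum (x y : R) : Cmod (x, y) <= Rabs x + Rabs y.
Proof.
  replace (x, y) with (x + Ci * y)%C
    by (unfold Ci, Cplus, Cmult, RtoC; simpl; f_equal; ring).
  eapply Rle_trans; [apply Cmod_triangle|].
  rewrite Cmod_mult, Cmod_Ci, !Cmod_R. lra.
Qed.

Lemma Rabs_fst_le (z : C) : Rabs (fst z) <= Cmod z.
Proof. eapply Rle_trans; [|apply Rmax_Cmod]. apply Rmax_l. Qed.

Lemma Rabs_snd_le (z : C) : Rabs (snd z) <= Cmod z.
Proof. eapply Rle_trans; [|apply Rmax_Cmod]. apply Rmax_r. Qed.

(** * Continuity and differentiability *)

(** Continuity and differentiability are stated along a map [i : X -> C], so that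
    the real ([i = RtoC]) and the complex ([i = id]) variable share one calculus. *)
Definition cont {X : Type} (i : X -> C) (f : X -> C) (x : X) : Prop :=
  forall e, 0 < e -> exists d, 0 < d /\
    forall y, Cmod (i y - i x) < d -> Cmod (f y - f x) < e.

Definition diff {X : Type} (i : X -> C) (f : X -> C) (x : X) (l : C) : Prop :=
  forall e, 0 < e -> exists d, 0 < d /\
    forall y, Cmod (i y - i x) < d ->
      Cmod (f y - f x - l * (i y - i x)) <= e * Cmod (i y - i x).

Definition idC (z : C) : C := z.

Lemma cont_const {X} (i : X -> C) c x : cont i (fun _ => c) x.
Proof.
  intros e He. exists 1; split; [lra|]. intros y _. rewrite Cmod_sub_diag. lra.
Qed.

Lemma cont_id {X} (i : X -> C) x : cont i i x.
Proof. intros e He. exists e; split; auto. Qed.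

Lemma cont_plus {X} (i f g : X -> C) x :
  cont i f x -> cont i g x -> cont i (fun y => f y + g y)%C x.
Proof.
  intros Hf Hg e He.
  destruct (Hf (e/2)) as [d1 [Hd1 H1]]; [lra|].
  destruct (Hg (e/2)) as [d2 [Hd2 H2]]; [lra|].
  exists (Rmin d1 d2); split; [apply Rmin_glb_lt; auto|].
  intros y Hy.
  assert (A1 := H1 y (Rlt_le_trans _ _ _ Hy (Rmin_l _ _))).
  assert (A2 := H2 y (Rlt_le_trans _ _ _ Hy (Rmin_r _ _))).
  replace (f y + g y - (f x + g x))%C with ((f y - f x) + (g y - g x))%C by ring.
  eapply Rle_lt_trans; [apply Cmod_triangle|]. lra.
Qed.

Lemma cont_mult {X} (i f g : X -> C) x :
  cont i f x -> cont i g x -> cont i (fun y => f y * g y)%C x.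
Proof.
  intros Hf Hg e He.
  pose (A := Cmod (f x) + Cmod (g x) + 1).
  assert (HA : 1 <= A)
    by (unfold A; generalize (Cmod_ge_0 (f x)) (Cmod_ge_0 (g x)); lra).
  pose (e' := Rmin 1 (e / (2 * A))).
  assert (He' : 0 < e').
  { apply Rmin_glb_lt; [lra|]. apply Rdiv_lt_0_compat; lra. }
  assert (Hee : e' * (2 * A) <= e).
  { assert (Q : e / (2 * A) * (2 * A) = e) by (field; lra).
    eapply Rle_trans; [|right; apply Q].
    apply Rmult_le_compat_r; [lra|apply Rmin_r]. }
  assert (He1 : e' <= 1) by apply Rmin_l.
  destruct (Hf e' He') as [d1 [Hd1 H1]].
  destruct (Hg e' He') as [d2 [Hd2 H2]].
  exists (Rmin d1 d2); split; [apply Rmin_glb_lt; auto|].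
  intros y Hy.
  assert (A1 := H1 y (Rlt_le_trans _ _ _ Hy (Rmin_l _ _))).
  assert (A2 := H2 y (Rlt_le_trans _ _ _ Hy (Rmin_r _ _))).
  replace (f y * g y - f x * g x)%C
    with ((f y - f x) * (g y - g x) + (f y - f x) * g x + f x * (g y - g x))%C by ring.
  eapply Rle_lt_trans; [apply Cmod_triangle|].
  eapply Rle_lt_trans; [apply Rplus_le_compat_r, Cmod_triangle|].
  rewrite !Cmod_mult.
  assert (P1 := Cmod_ge_0 (f y - f x)). assert (P2 := Cmod_ge_0 (g y - g x)).
  assert (P3 := Cmod_ge_0 (f x)). assert (P4 := Cmod_ge_0 (g x)).
  unfold A in *. nra.
Qed.

Lemma cont_opp {X} (i f : X -> C) x : cont i f x -> cont i (fun y => - f y)%C x.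
Proof.
  intros Hf e He. destruct (Hf e He) as [d [Hd H]]. exists d; split; auto.
  intros y Hy. replace (- f y - - f x)%C with (- (f y - f x))%C by ring.
  rewrite Cmod_opp. auto.
Qed.

Lemma cont_minus {X} (i f g : X -> C) x :
  cont i f x -> cont i g x -> cont i (fun y => f y - g y)%C x.
Proof.
  intros Hf Hg. apply (cont_plus i f (fun y => - g y)%C); auto. now apply cont_opp.
Qed.

Lemma cont_neq0 {X} (i f : X -> C) x : cont i f x -> f x <> 0 ->
  exists d, 0 < d /\ forall y, Cmod (i y - i x) < d -> Cmod (f x) / 2 < Cmod (f y).
Proof.
  intros Hf H0. apply Cmod_gt_0 in H0.
  destruct (Hf (Cmod (f x) / 2)) as [d [Hd H]]; [lra|].
  exists d; split; auto. intros y Hy. specialize (H y Hy).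
  generalize (Cmod_le_add (f x) (f y)). rewrite (Cmod_minus_sym (f x)). lra.
Qed.

Lemma cont_inv {X} (i f : X -> C) x :
  cont i f x -> f x <> 0 -> cont i (fun y => / f y)%C x.
Proof.
  intros Hf H0 e He.
  destruct (cont_neq0 i f x Hf H0) as [d1 [Hd1 H1]].
  assert (Hp : 0 < Cmod (f x)) by now apply Cmod_gt_0.
  destruct (Hf (e * (Cmod (f x) * Cmod (f x)) / 2)) as [d2 [Hd2 H2]].
  { apply Rdiv_lt_0_compat; [|lra]. apply Rmult_lt_0_compat; nra. }
  exists (Rmin d1 d2); split; [apply Rmin_glb_lt; auto|].
  intros y Hy.
  assert (A1 := H1 y (Rlt_le_trans _ _ _ Hy (Rmin_l _ _))).
  assert (A2 := H2 y (Rlt_le_trans _ _ _ Hy (Rmin_r _ _))).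
  assert (Hy0 : f y <> 0) by (apply Cmod_gt_0; lra).
  replace (/ f y - / f x)%C with ((f x - f y) / (f y * f x))%C by (field; auto).
  rewrite Cmod_div, Cmod_mult, Cmod_minus_sym by now apply Cmult_neq_0.
  apply Rmult_lt_reg_r with (Cmod (f y) * Cmod (f x)); [nra|].
  unfold Rdiv. rewrite Rmult_assoc, Rinv_l, Rmult_1_r by nra.
  eapply Rlt_le_trans; [apply A2|].
  assert (0 < e * Cmod (f x)) by nra. nra.
Qed.

Lemma cont_div {X} (i f g : X -> C) x :
  cont i f x -> cont i g x -> g x <> 0 -> cont i (fun y => f y / g y)%C x.
Proof.
  intros. apply (cont_mult i f (fun y => / g y)%C); auto. now apply cont_inv.
Qed.

Lemma cont_comp {X} (i f : X -> C) (g : C -> C) x :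
  cont i f x -> cont idC g (f x) -> cont i (fun y => g (f y)) x.
Proof.
  intros Hf Hg e He. destruct (Hg e He) as [d [Hd H]].
  destruct (Hf d Hd) as [d' [Hd' H']]. exists d'; split; auto.
  intros y Hy. apply H. unfold idC. auto.
Qed.

Lemma cont_ext_loc {X} (i f g : X -> C) x r : 0 < r ->
  (forall y, Cmod (i y - i x) < r -> f y = g y) -> cont i f x -> cont i g x.
Proof.
  intros Hr E Hf e He. destruct (Hf e He) as [d [Hd H]].
  exists (Rmin d r); split; [apply Rmin_glb_lt; auto|].
  intros y Hy. rewrite <- !E.
  - apply H. eapply Rlt_le_trans; [apply Hy|apply Rmin_l].
  - rewrite Cmod_sub_diag; auto.
  - eapply Rlt_le_trans; [apply Hy|apply Rmin_r].
Qed.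

(** Caratheodory's reformulation, from which the calculus rules follow. *)
Lemma diff_slope {X} (i f : X -> C) x l : diff i f x l ->
  exists p, cont i p x /\ p x = l /\
    (exists r, 0 < r /\
    forall y, Cmod (i y - i x) < r -> (f y - f x = p y * (i y - i x))%C).
Proof.
  intros Hf.
  exists (fun y => if excluded_middle_informative (i y = i x) then l
                   else ((f y - f x) / (i y - i x))%C).
  split; [|split].
  - intros e He. destruct (Hf (e/2)) as [d [Hd H]]; [lra|].
    exists d; split; auto. intros y Hy.
    destruct (excluded_middle_informative (i x = i x)); [|tauto].
    destruct (excluded_middle_informative (i y = i x)).
    + rewrite Cmod_sub_diag; auto.
    + specialize (H y Hy). apply Csub_neq_0 in n.
      assert (0 < Cmod (i y - i x)) by now apply Cmod_gt_0.
      replace ((f y - f x) / (i y - i x) - l)%C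
        with ((f y - f x - l * (i y - i x)) / (i y - i x))%C by (field; auto).
      rewrite Cmod_div by auto. apply Rle_lt_trans with (e/2); [|lra].
      apply Rmult_le_reg_r with (Cmod (i y - i x)); auto.
      unfold Rdiv at 1. rewrite Rmult_assoc, Rinv_l by lra. lra.
  - destruct (excluded_middle_informative (i x = i x)); tauto.
  - destruct (Hf 1) as [d [Hd H]]; [lra|]. exists d; split; auto. intros y Hy.
    destruct (excluded_middle_informative (i y = i x)).
    + specialize (H y Hy). rewrite e, Cmod_sub_diag in H.
      replace (l * (i x - i x))%C with (RtoC 0) in H by ring.
      replace (f y - f x - 0)%C with (f y - f x)%C in H by ring.
      rewrite e. replace (l * (i x - i x))%C with (RtoC 0) by ring.
      apply Cmod_eq_0. generalize (Cmod_ge_0 (f y - f x)). lra.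
    + apply Csub_neq_0 in n. field. auto.
Qed.

Lemma diff_of_slope {X} (i f p : X -> C) x r : 0 < r -> cont i p x ->
  (forall y, Cmod (i y - i x) < r -> (f y - f x = p y * (i y - i x))%C) ->
  diff i f x (p x).
Proof.
  intros Hr Hp E e He. destruct (Hp e He) as [d [Hd H]].
  exists (Rmin d r); split; [apply Rmin_glb_lt; auto|]. intros y Hy.
  rewrite E by (eapply Rlt_le_trans; [apply Hy|apply Rmin_r]).
  replace (p y * (i y - i x) - p x * (i y - i x))%C
    with ((p y - p x) * (i y - i x))%C by ring.
  rewrite Cmod_mult. apply Rmult_le_compat_r; [apply Cmod_ge_0|].
  left. apply H. eapply Rlt_le_trans; [apply Hy|apply Rmin_l].
Qed.

Lemma diff_cont {X} (i f : X -> C) x l : diff i f x l -> cont i f x.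
Proof.
  intros Hf. destruct (diff_slope _ _ _ _ Hf) as [p [Hp [_ [r [Hr E]]]]].
  apply (cont_ext_loc i (fun y => f x + p y * (i y - i x))%C f x r Hr).
  - intros y Hy. rewrite <- E by auto. ring.
  - apply cont_plus; [apply cont_const|]. apply cont_mult; auto.
    apply cont_minus; [apply cont_id|apply cont_const].
Qed.

Lemma diff_ext_loc {X} (i f g : X -> C) x l r : 0 < r ->
  (forall y, Cmod (i y - i x) < r -> f y = g y) -> diff i f x l -> diff i g x l.
Proof.
  intros Hr E Hf e He. destruct (Hf e He) as [d [Hd H]].
  exists (Rmin d r); split; [apply Rmin_glb_lt; auto|].
  intros y Hy. rewrite <- !E.
  - apply H. eapply Rlt_le_trans; [apply Hy|apply Rmin_l].
  - rewrite Cmod_sub_diag; auto.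
  - eapply Rlt_le_trans; [apply Hy|apply Rmin_r].
Qed.

Lemma diff_ext {X} (i f g : X -> C) x l :
  (forall y, f y = g y) -> diff i f x l -> diff i g x l.
Proof. intros E. apply (diff_ext_loc i f g x l 1); auto; lra. Qed.

Lemma diff_eq {X} (i f : X -> C) x l m : l = m -> diff i f x l -> diff i f x m.
Proof. intros ->; auto. Qed.

Lemma diff_const {X} (i : X -> C) c x : diff i (fun _ => c) x 0.
Proof.
  intros e He. exists 1; split; [lra|]. intros y _.
  replace (c - c - 0 * (i y - i x))%C with (RtoC 0) by ring.
  rewrite Cmod_0. generalize (Cmod_ge_0 (i y - i x)). nra.
Qed.

Lemma diff_id {X} (i : X -> C) x : diff i i x 1.
Proof.
  intros e He. exists 1; split; [lra|]. intros y _.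
  replace (i y - i x - 1 * (i y - i x))%C with (RtoC 0) by ring.
  rewrite Cmod_0. generalize (Cmod_ge_0 (i y - i x)). nra.
Qed.

Lemma Rmin_case_lt (a b x : R) : x < Rmin a b -> x < a /\ x < b.
Proof. generalize (Rmin_l a b) (Rmin_r a b). lra. Qed.

Lemma diff_plus {X} (i f g : X -> C) x l m :
  diff i f x l -> diff i g x m -> diff i (fun y => f y + g y)%C x (l + m)%C.
Proof.
  intros Hf Hg.
  destruct (diff_slope _ _ _ _ Hf) as [p [Hp [<- [r [Hr E]]]]].
  destruct (diff_slope _ _ _ _ Hg) as [q [Hq [<- [s [Hs F]]]]].
  apply (diff_of_slope i _ (fun y => p y + q y)%C x (Rmin r s)).
  - now apply Rmin_glb_lt.
  - now apply cont_plus.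
  - intros y Hy. apply Rmin_case_lt in Hy as [].
    replace (f y + g y - (f x + g x))%C with ((f y - f x) + (g y - g x))%C by ring.
    rewrite E, F by auto. ring.
Qed.

Lemma diff_mult {X} (i f g : X -> C) x l m :
  diff i f x l -> diff i g x m ->
  diff i (fun y => f y * g y)%C x (f x * m + l * g x)%C.
Proof.
  intros Hf Hg. assert (Cf := diff_cont _ _ _ _ Hf).
  destruct (diff_slope _ _ _ _ Hf) as [p [Hp [<- [r [Hr E]]]]].
  destruct (diff_slope _ _ _ _ Hg) as [q [Hq [<- [s [Hs F]]]]].
  apply (diff_of_slope i _ (fun y => f y * q y + p y * g x)%C x (Rmin r s)).
  - now apply Rmin_glb_lt.
  - apply cont_plus; apply cont_mult; auto. apply cont_const.
  - intros y Hy. apply Rmin_case_lt in Hy as [].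
    replace (f y * g y - f x * g x)%C
      with (f y * (g y - g x) + (f y - f x) * g x)%C by ring.
    rewrite E, F by auto. ring.
Qed.

Lemma diff_scal {X} (i f : X -> C) c x l :
  diff i f x l -> diff i (fun y => c * f y)%C x (c * l)%C.
Proof.
  intros Hf. apply (diff_eq _ _ _ (c * l + 0 * f x)%C); [ring|].
  apply (diff_mult i (fun _ => c) f); auto. apply diff_const.
Qed.

Lemma diff_opp {X} (i f : X -> C) x l :
  diff i f x l -> diff i (fun y => - f y)%C x (- l)%C.
Proof.
  intros Hf. apply (diff_eq _ _ _ (-(1) * l)%C); [ring|].
  apply (diff_ext _ (fun y => -(1) * f y)%C); [intros; ring|]. now apply diff_scal.
Qed.

Lemma diff_minus {X} (i f g : X -> C) x l m :
  diff i f x l -> diff i g x m -> diff i (fun y => f y - g y)%C x (l - m)%C.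
Proof.
  intros Hf Hg. apply (diff_plus i f (fun y => - g y)%C); auto. now apply diff_opp.
Qed.

Lemma diff_comp {X} (i f : X -> C) (g : C -> C) x l m :
  diff i f x l -> diff idC g (f x) m -> diff i (fun y => g (f y)) x (m * l)%C.
Proof.
  intros Hf Hg. assert (Cf := diff_cont _ _ _ _ Hf).
  destruct (diff_slope _ _ _ _ Hf) as [p [Hp [<- [r [Hr E]]]]].
  destruct (diff_slope _ _ _ _ Hg) as [q [Hq [<- [s [Hs F]]]]].
  destruct (Cf s Hs) as [d [Hd D]].
  apply (diff_of_slope i _ (fun y => q (f y) * p y)%C x (Rmin r d)).
  - now apply Rmin_glb_lt.
  - apply cont_mult; auto. now apply (cont_comp i f q).
  - intros y Hy. apply Rmin_case_lt in Hy as [].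
    rewrite F by (apply D; auto). unfold idC. rewrite E by auto. ring.
Qed.

Lemma diff_inv {X} (i f : X -> C) x l :
  diff i f x l -> f x <> 0 -> diff i (fun y => / f y)%C x (- l / (f x * f x))%C.
Proof.
  intros Hf H0. assert (Cf := diff_cont _ _ _ _ Hf).
  destruct (diff_slope _ _ _ _ Hf) as [p [Hp [<- [r [Hr E]]]]].
  destruct (cont_neq0 _ _ _ Cf H0) as [d [Hd D]].
  apply (diff_of_slope i _ (fun y => - p y / (f y * f x))%C x (Rmin r d)).
  - now apply Rmin_glb_lt.
  - apply cont_div; [now apply cont_opp| |now apply Cmult_neq_0].
    apply cont_mult; auto. apply cont_const.
  - intros y Hy. apply Rmin_case_lt in Hy as [Hy1 Hy2].
    assert (Hy0 : f y <> 0).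
    { apply Cmod_gt_0. specialize (D y Hy2). generalize (Cmod_ge_0 (f x)). lra. }
    replace (/ f y - / f x)%C with (- (f y - f x) / (f y * f x))%C by (field; auto).
    rewrite E by auto. field. auto.
Qed.

Lemma diff_div {X} (i f g : X -> C) x l m :
  diff i f x l -> diff i g x m -> g x <> 0 ->
  diff i (fun y => f y / g y)%C x ((l * g x - f x * m) / (g x * g x))%C.
Proof.
  intros Hf Hg H0.
  apply (diff_eq _ _ _ (f x * (- m / (g x * g x)) + l * / g x)%C); [field; auto|].
  apply (diff_mult i f (fun y => / g y)%C); auto. now apply diff_inv.
Qed.

Lemma diff_unique (f : C -> C) z l m : diff idC f z l -> diff idC f z m -> l = m.
Proof.
  intros Hl Hm.
  assert (H := diff_minus _ _ _ _ _ _ Hl Hm).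
  apply eq_of_Cmod_small. intros e He. destruct (H e He) as [d [Hd D]].
  specialize (D (z + (d/2)%R)%C).
  unfold idC in D. replace (z + (d/2)%R - z)%C with (RtoC (d/2)) in D by ring.
  rewrite Cmod_Rpos in D by lra. specialize (D ltac:(lra)).
  replace (f (z + (d/2)%R) - f (z + (d/2)%R) - (f z - f z) - (l - m) * (d/2)%R)%C
    with (- ((l - m) * (d/2)%R))%C in D by ring.
  rewrite Cmod_opp, Cmod_mult, Cmod_Rpos in D by lra. nra.
Qed.

(** * The unit circle and derivatives of plane curves *)

Definition cis (t : R) : C := (cos t, sin t).

Lemma Cmod_cis t : Cmod (cis t) = 1.
Proof.
  unfold Cmod, cis; cbn [fst snd]. transitivity (sqrt 1); [f_equal|apply sqrt_1].
  transitivity (Rsqr (sin t) + Rsqr (cos t)); [unfold Rsqr; ring|apply sin2_cos2].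
Qed.

Lemma cis_neq0 t : cis t <> 0.
Proof. apply Cmod_gt_0. rewrite Cmod_cis. lra. Qed.

Lemma diff_pair (u v : R -> R) t a b :
  is_derive u t a -> is_derive v t b ->
  diff RtoC (fun t => (u t, v t) : C) t (a, b).
Proof.
  intros Hu Hv e He.
  apply is_derive_Reals in Hu. apply is_derive_Reals in Hv.
  destruct (Hu (e/2)) as [d1 D1]; [lra|]. destruct (Hv (e/2)) as [d2 D2]; [lra|].
  exists (Rmin d1 d2); split; [apply Rmin_glb_lt; apply cond_pos|].
  intros s Hs. apply Rmin_case_lt in Hs as [H1 H2].
  assert (Q : (RtoC s - RtoC t = RtoC (s - t))%C) by (rewrite RtoC_minus; auto).
  rewrite Q in *. rewrite Cmod_R in *.
  destruct (Req_dec (s - t) 0) as [E|E].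
  - assert (s = t) by lra. subst s. rewrite E.
    replace ((u t, v t) - (u t, v t) - (a, b) * 0%R)%C with (RtoC 0) by ring.
    rewrite Cmod_0, Rabs_R0. lra.
  - specialize (D1 (s - t) E H1). specialize (D2 (s - t) E H2).
    replace (t + (s - t)) with s in * by ring.
    replace ((u s, v s) - (u t, v t) - (a, b) * (s - t)%R)%C
      with (((u s - u t) / (s - t) - a) * (s - t), ((v s - v t) / (s - t) - b) * (s - t)).
    2:{ unfold Cminus, Cplus, Copp, Cmult, RtoC; simpl. f_equal; field; auto. }
    eapply Rle_trans; [apply Cmod_le_sum|]. rewrite !Rabs_mult.
    assert (0 < Rabs (s - t)) by now apply Rabs_pos_lt. nra.
Qed.

Lemma diff_cis t : diff RtoC cis t (Ci * cis t)%C.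
Proof.
  replace (Ci * cis t)%C with (- sin t, cos t)
    by (unfold Ci, cis, Cmult; simpl; f_equal; ring).
  apply diff_pair; auto_derive; auto; ring.
Qed.

Lemma diff_components (F : R -> C) t l : diff RtoC F t l ->
  is_derive (fun t => fst (F t)) t (fst l) /\ is_derive (fun t => snd (F t)) t (snd l).
Proof.
  intros H.
  (* Both coordinates at once: a projection enters only through its real linearity and its bound by
     [Cmod]. *)
  assert (K : forall pr : C -> R,
    (forall z, Rabs (pr z) <= Cmod z) ->
    (forall z w (r : R), pr (z - w * r)%C = pr z - pr w * r) ->
    (forall z w, pr (z - w)%C = pr z - pr w) ->
    is_derive (fun t => pr (F t)) t (pr l)).
  { intros pr Hb Hl Hm. apply is_derive_Reals. intros e He.
    destruct (H (e/2)) as [d [Hd D]]; [lra|].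
    exists (mkposreal d Hd). intros h Hh0 Hh. simpl in Hh.
    specialize (D (t + h)).
    assert (Q : (RtoC (t + h) - RtoC t = RtoC h)%C) by (rewrite RtoC_plus; ring).
    rewrite Q, Cmod_R in D. specialize (D Hh).
    specialize (Hb (F (t + h)%R - F t - l * h)%C). rewrite Hl, Hm in Hb.
    assert (0 < Rabs h) by now apply Rabs_pos_lt.
    replace ((pr (F (t + h)) - pr (F t)) / h - pr l)
      with ((pr (F (t + h)) - pr (F t) - pr l * h) / h) by (field; auto).
    unfold Rdiv. rewrite Rabs_mult, Rabs_inv.
    apply Rmult_lt_reg_r with (Rabs h); auto.
    rewrite Rmult_assoc, Rinv_l by lra. nra. }
  split; apply K; intros.
  - apply Rabs_fst_le.
  - unfold Cminus, Cplus, Copp, Cmult, RtoC; simpl; ring.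
  - reflexivity.
  - apply Rabs_snd_le.
  - unfold Cminus, Cplus, Copp, Cmult, RtoC; simpl; ring.
  - reflexivity.
Qed.

Lemma cont_components (F : R -> C) t : cont RtoC F t ->
  continuous (fun t => fst (F t)) t /\ continuous (fun t => snd (F t)) t.
Proof.
  intros H.
  assert (K : forall pr : C -> R,
    (forall z, Rabs (pr z) <= Cmod z) ->
    (forall z w, pr (z - w)%C = pr z - pr w) ->
    continuous (fun t => pr (F t)) t).
  { intros pr Hb Hm. apply continuity_pt_filterlim.
    intros e He. destruct (H e He) as [d [Hd D]]. exists d; split; auto.
    intros s [_ Hs]. simpl in *. unfold R_dist in *. rewrite <- Hm.
    eapply Rle_lt_trans; [apply Hb|]. apply D.
    rewrite <- RtoC_minus, Cmod_R. auto. }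
  split; apply K; intros; try reflexivity; [apply Rabs_fst_le|apply Rabs_snd_le].
Qed.

(** * Integrals of complex functions of a real variable *)

Definition CI (f : R -> C) (a b : R) : C :=
  (RInt (fun t => fst (f t)) a b, RInt (fun t => snd (f t)) a b).

Definition conton (f : R -> C) (a b : R) : Prop :=
  forall t, a <= t <= b -> cont RtoC f t.

Lemma conton_ex_RInt f a b : a <= b -> conton f a b ->
  ex_RInt (fun t => fst (f t)) a b /\ ex_RInt (fun t => snd (f t)) a b.
Proof.
  intros Hab H. split; apply (ex_RInt_continuous (V := R_CompleteNormedModule));
    intros z Hz; rewrite Rmin_left, Rmax_right in Hz by auto;
    apply cont_components, H, Hz.
Qed.

Lemma CI_ext f g a b : a <= b ->
  (forall t, a <= t <= b -> f t = g t) -> CI f a b = CI g a b.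
Proof.
  intros Hab H. unfold CI. f_equal; apply RInt_ext; intros x Hx;
    rewrite Rmin_left, Rmax_right in Hx by auto; rewrite H; auto; lra.
Qed.

Lemma RInt_lin (u v : R -> R) (p q a b : R) : ex_RInt u a b -> ex_RInt v a b ->
  RInt (fun t => p * u t + q * v t) a b = p * RInt u a b + q * RInt v a b.
Proof.
  intros Hu Hv. apply (is_RInt_unique (V := R_CompleteNormedModule)).
  apply (is_RInt_plus (V := R_NormedModule) (fun t => p * u t) (fun t => q * v t));
  apply (is_RInt_scal (V := R_NormedModule)), (RInt_correct (V := R_CompleteNormedModule)); auto.
Qed.

Lemma CI_plus f g a b : a <= b -> conton f a b -> conton g a b ->
  CI (fun t => f t + g t)%C a b = (CI f a b + CI g a b)%C.
Proof.
  intros Hab Hf Hg.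
  destruct (conton_ex_RInt f a b Hab Hf). destruct (conton_ex_RInt g a b Hab Hg).
  unfold CI. unfold Cplus at 3. simpl. f_equal;
  rewrite <- (Rmult_1_l (RInt (fun t => _ (f t)) a b)), <- (Rmult_1_l (RInt (fun t => _ (g t)) a b)),
    <- RInt_lin by auto; apply RInt_ext; intros; simpl; ring.
Qed.

Lemma CI_scal c f a b : a <= b -> conton f a b ->
  CI (fun t => c * f t)%C a b = (c * CI f a b)%C.
Proof.
  intros Hab Hf. destruct (conton_ex_RInt f a b Hab Hf) as [H1 H2].
  unfold CI. unfold Cmult at 3. simpl. f_equal.
  - unfold Rminus. rewrite Ropp_mult_distr_l, <- RInt_lin by auto.
    apply RInt_ext; intros; simpl; ring.
  - rewrite <- RInt_lin by auto.
    apply RInt_ext; intros; simpl; ring.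
Qed.

Lemma conton_mult f g a b : conton f a b -> conton g a b -> conton (fun t => f t * g t)%C a b.
Proof. intros Hf Hg t Ht. apply cont_mult; auto. Qed.

Lemma conton_minus f g a b : conton f a b -> conton g a b -> conton (fun t => f t - g t)%C a b.
Proof. intros Hf Hg t Ht. apply cont_minus; auto. Qed.

Lemma conton_const c a b : conton (fun _ => c) a b.
Proof. intros t _. apply cont_const. Qed.

Lemma CI_minus f g a b : a <= b -> conton f a b -> conton g a b ->
  CI (fun t => f t - g t)%C a b = (CI f a b - CI g a b)%C.
Proof.
  intros Hab Hf Hg.
  rewrite (CI_ext _ (fun t => f t + (-(1)) * g t)%C) by (auto; intros; ring).
  rewrite CI_plus, CI_scal by (auto; apply conton_mult; auto; apply conton_const). ring.
Qed.

(** The factor [2] comes from bounding the two coordinates separately. *)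
Lemma CI_bound f a b M : a <= b -> conton f a b ->
  (forall t, a <= t <= b -> Cmod (f t) <= M) -> Cmod (CI f a b) <= 2 * (b - a) * M.
Proof.
  intros Hab Hf HM. destruct (conton_ex_RInt f a b Hab Hf) as [H1 H2].
  eapply Rle_trans; [apply Cmod_le_sum|].
  assert (B1 : Rabs (RInt (fun t => fst (f t)) a b) <= (b - a) * M).
  { apply abs_RInt_le_const; auto. intros t Ht.
    eapply Rle_trans; [apply Rabs_fst_le|]. auto. }
  assert (B2 : Rabs (RInt (fun t => snd (f t)) a b) <= (b - a) * M).
  { apply abs_RInt_le_const; auto. intros t Ht.
    eapply Rle_trans; [apply Rabs_snd_le|]. auto. }
  lra.
Qed.

Lemma CI_Chasles f a b c : a <= b -> b <= c -> conton f a c ->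
  CI f a c = (CI f a b + CI f b c)%C.
Proof.
  intros Hab Hbc Hf.
  destruct (conton_ex_RInt f a b Hab) as [H1 H2]; [intros t Ht; apply Hf; lra|].
  destruct (conton_ex_RInt f b c Hbc) as [H3 H4]; [intros t Ht; apply Hf; lra|].
  unfold CI, Cplus; simpl. f_equal; symmetry;
  apply (RInt_Chasles (V := R_CompleteNormedModule)); auto.
Qed.

Lemma CI_derive (F F' : R -> C) a b : a <= b ->
  (forall t, a <= t <= b -> diff RtoC F t (F' t)) -> conton F' a b ->
  CI F' a b = (F b - F a)%C.
Proof.
  intros Hab HF HF'. unfold CI, Cminus, Cplus, Copp. simpl. f_equal;
  apply is_RInt_unique, (is_RInt_derive (V := R_CompleteNormedModule)
     (fun t => _ (F t))); intros x Hx;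
  rewrite Rmin_left, Rmax_right in Hx by auto.
  - apply (diff_components F x (F' x)), HF, Hx.
  - apply cont_components, HF', Hx.
  - apply (diff_components F x (F' x)), HF, Hx.
  - apply cont_components, HF', Hx.
Qed.

Lemma CI_const c a b : a <= b -> CI (fun _ => c) a b = (c * (b - a)%R)%C.
Proof.
  intros Hab. rewrite (CI_derive (fun t => c * t)%C).
  - rewrite RtoC_minus. ring.
  - auto.
  - intros t _. apply (diff_eq _ _ _ (c * 1)%C); [ring|]. apply diff_scal, diff_id.
  - apply conton_const.
Qed.

(** * Goursat's theorem and Cauchy's formula *)

Record rect := Rect { rl : R; rr : R; rb : R; rt : R }.

Definition quarter (q : rect) (k : bool * bool) : rect :=
  let ms := (rl q + rr q) / 2 in
  let mt := (rb q + rt q) / 2 in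
  Rect (if fst k then rl q else ms) (if fst k then ms else rr q)
       (if snd k then rb q else mt) (if snd k then mt else rt q).

(** The middle inequalities order the sides of [q], so [sub_rect Q Q] says that [Q] itself is a
    rectangle, possibly a degenerate one. *)
Definition sub_rect (q p : rect) : Prop :=
  rl p <= rl q /\ rl q <= rr q /\ rr q <= rr p /\
  rb p <= rb q /\ rb q <= rt q /\ rt q <= rt p.

Definition rsize (q : rect) : R := (rr q - rl q) + (rt q - rb q).

Lemma nested_intervals (a b : nat -> R) :
  (forall n, a n <= a (S n) /\ a (S n) <= b (S n) /\ b (S n) <= b n) ->
  exists s, forall n, a n <= s <= b n.
Proof.
  intros H.
  assert (Ha : forall n m, (n <= m)%nat -> a n <= a m).
  { intros n m Hnm. induction Hnm; [lra|]. destruct (H m). lra. }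
  assert (Hb : forall n m, (n <= m)%nat -> b m <= b n).
  { intros n m Hnm. induction Hnm; [lra|]. destruct (H m) as [_ [_ ?]]. lra. }
  assert (Hab : forall n m, a n <= b m).
  { intros n m. destruct (H (n + m)%nat) as [H1 [H2 H3]].
    assert (H4 := Ha n (n + m)%nat ltac:(lia)).
    assert (H5 := Hb m (n + m)%nat ltac:(lia)). lra. }
  destruct (completeness (fun x => exists n, x = a n)) as [s [Hs1 Hs2]].
  - exists (b O). intros x [n ->]. apply Hab.
  - exists (a O). now exists O.
  - exists s. intros n. split.
    + apply Hs1. now exists n.
    + apply Hs2. intros x [m ->]. apply Hab.
Qed.

Fixpoint bisect (pick : rect -> bool * bool) (q : rect) (n : nat) : rect :=
  match n with
  | O => q
  | S n => quarter (bisect pick q n) (pick (bisect pick q n))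
  end.

(** The bisection half of Goursat's argument, for any additive function [J] of rectangles. Some
    quarter carries at least a fourth of [|J|], while [rsize] halves, so [|J|] and the square of
    [rsize] are compared at the same rate [1/4]. The local bound at the common point of the nested
    rectangles therefore gives [|J Q| <= e * rsize Q ^ 2] for every positive [e]. *)
Lemma goursat_bisection (J : rect -> C) (Q : rect) :
  sub_rect Q Q ->
  (forall q, sub_rect q Q ->
     J q = (J (quarter q (true, true)) + J (quarter q (true, false))
            + J (quarter q (false, true)) + J (quarter q (false, false)))%C) ->
  (forall s t, rl Q <= s <= rr Q -> rb Q <= t <= rt Q -> forall e, 0 < e ->
     exists d, 0 < d /\ forall q, sub_rect q Q ->
       rl q <= s <= rr q -> rb q <= t <= rt q -> rsize q < d ->
       Cmod (J q) <= e * (rsize q * rsize q)) ->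
  J Q = 0.
Proof.
  intros HQ Hadd Hloc.
  assert (Hpick : forall q, exists k, sub_rect q Q ->
            Cmod (J q) <= 4 * Cmod (J (quarter q k))).
  { intros q. destruct (excluded_middle_informative (sub_rect q Q)) as [Hq|Hq].
    2:{ exists (true, true). tauto. }
    specialize (Hadd q Hq).
    assert (B : Cmod (J q) <= Cmod (J (quarter q (true, true)))
      + Cmod (J (quarter q (true, false))) + Cmod (J (quarter q (false, true)))
      + Cmod (J (quarter q (false, false)))).
    { rewrite Hadd.
      eapply Rle_trans; [apply Cmod_triangle|apply Rplus_le_compat_r].
      eapply Rle_trans; [apply Cmod_triangle|apply Rplus_le_compat_r].
      apply Cmod_triangle. }
    destruct (Rle_dec (Cmod (J q)) (4 * Cmod (J (quarter q (true, true))))); [eauto|].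
    destruct (Rle_dec (Cmod (J q)) (4 * Cmod (J (quarter q (true, false))))); [eauto|].
    destruct (Rle_dec (Cmod (J q)) (4 * Cmod (J (quarter q (false, true))))); [eauto|].
    exists (false, false). intros _. lra. }
  pose (pick := fun q => proj1_sig (constructive_indefinite_description _ (Hpick q))).
  assert (Pick : forall q, sub_rect q Q -> Cmod (J q) <= 4 * Cmod (J (quarter q (pick q)))).
  { intros q. unfold pick.
    destruct (constructive_indefinite_description _ (Hpick q)); auto. }
  pose (q := bisect pick Q).
  assert (Hsub1 : forall n, sub_rect (q n) (q n) -> sub_rect (q (S n)) (q n)).
  { intros n Hn. unfold q; simpl. fold (q n). unfold sub_rect, quarter in *.
    destruct (pick (q n)) as [[|] [|]]; simpl; lra. }
  assert (Hsub : forall n, sub_rect (q n) Q).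
  { intros n. induction n; [exact HQ|].
    assert (sub_rect (q n) (q n)) by (unfold sub_rect in *; lra).
    specialize (Hsub1 n H). unfold sub_rect in *; lra. }
  assert (Hself : forall n, sub_rect (q n) (q n)).
  { intros n. specialize (Hsub n). unfold sub_rect in *; lra. }
  assert (Hsize : forall n, rsize (q n) = rsize Q * (/2) ^ n).
  { intros n. induction n; [unfold q; simpl; ring|].
    simpl. rewrite <- Rmult_assoc, (Rmult_comm (rsize Q)), Rmult_assoc, <- IHn.
    unfold q; simpl. fold (q n). unfold rsize, quarter.
    destruct (pick (q n)) as [[|] [|]]; simpl; lra. }
  assert (HJ : forall n, Cmod (J Q) * (/4) ^ n <= Cmod (J (q n))).
  { intros n. induction n; [unfold q; simpl; lra|].
    specialize (Pick (q n) (Hsub n)). change (quarter (q n) (pick (q n))) with (q (S n)) in Pick.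
    simpl. lra. }
  destruct (nested_intervals (fun n => rl (q n)) (fun n => rr (q n))) as [s Hs].
  { intros n. specialize (Hsub1 n (Hself n)). unfold sub_rect in Hsub1. lra. }
  destruct (nested_intervals (fun n => rb (q n)) (fun n => rt (q n))) as [t Ht].
  { intros n. specialize (Hsub1 n (Hself n)). unfold sub_rect in Hsub1. lra. }
  assert (Hz : forall e, 0 < e -> Cmod (J Q) <= e * (rsize Q * rsize Q)).
  { intros e He.
    destruct (Hloc s t (Hs O) (Ht O) e He) as [d [Hd D]].
    assert (Hsz0 : 0 <= rsize Q) by (unfold rsize; unfold sub_rect in HQ; lra).
    (* The [+ 1] covers a rectangle reduced to a point. *)
    destruct (pow_lt_1_zero (/2)) with (y := d / (rsize Q + 1)) as [N HN].
    { rewrite Rabs_pos_eq; lra. }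
    { apply Rdiv_lt_0_compat; lra. }
    specialize (HN N (le_n N)).
    rewrite Rabs_pos_eq in HN by (apply pow_le; lra).
    assert (Hp : 0 < (/2) ^ N) by (apply pow_lt; lra).
    assert (rsize (q N) < d).
    { rewrite Hsize. apply Rlt_le_trans with ((rsize Q + 1) * (d / (rsize Q + 1))); [nra|].
      right; field; lra. }
    specialize (D (q N) (Hsub N) (Hs N) (Ht N) H). rewrite Hsize in D.
    specialize (HJ N).
    assert (E4 : (/4) ^ N = (/2) ^ N * (/2) ^ N).
    { rewrite <- Rpow_mult_distr. f_equal. lra. }
    rewrite E4 in HJ. assert (0 < (/2) ^ N * (/2) ^ N) by nra.
    apply Rmult_le_reg_r with ((/2) ^ N * (/2) ^ N); auto. nra. }
  apply Cmod_eq_0. apply Rle_antisym; [|apply Cmod_ge_0].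
  apply le_epsilon. intros e He.
  assert (0 <= rsize Q * rsize Q) by nra.
  specialize (Hz (e / (rsize Q * rsize Q + 1)) ltac:(apply Rdiv_lt_0_compat; lra)).
  eapply Rle_trans; [apply Hz|]. rewrite Rplus_0_l.
  apply Rmult_le_reg_r with (rsize Q * rsize Q + 1); [lra|].
  field_simplify; [|lra]. nra.
Qed.

(** The integral of [h dz] around the boundary of the image of [q] under [P], whose
    partial derivatives are [Ps] and [Pt]. *)
Definition boundary_integral (h : C -> C) (P Ps Pt : R -> R -> C) (q : rect) : C :=
  (CI (fun s => h (P s (rb q)) * Ps s (rb q)) (rl q) (rr q)
   + CI (fun t => h (P (rr q) t) * Pt (rr q) t) (rb q) (rt q)
   - CI (fun s => h (P s (rt q)) * Ps s (rt q)) (rl q) (rr q)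
   - CI (fun t => h (P (rl q) t) * Pt (rl q) t) (rb q) (rt q))%C.

Definition in_rect (Q : rect) (s t : R) : Prop := rl Q <= s <= rr Q /\ rb Q <= t <= rt Q.

(** The Lipschitz clause keeps the image of a small rectangle within [L * rsize] of the image of any
    of its points; it is demanded here rather than derived from the bounds on [Ps] and [Pt]. *)
Definition smooth_map (Q : rect) (P Ps Pt : R -> R -> C) (L : R) : Prop :=
  forall s t, in_rect Q s t ->
    diff RtoC (fun s => P s t) s (Ps s t) /\ diff RtoC (fun t => P s t) t (Pt s t) /\
    cont RtoC (fun s => Ps s t) s /\ cont RtoC (fun t => Pt s t) t /\
    Cmod (Ps s t) <= L /\ Cmod (Pt s t) <= L /\
    forall s' t', in_rect Q s' t' -> Cmod (P s' t' - P s t) <= L * (Rabs (s' - s) + Rabs (t' - t)).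

(** [A] is a primitive of the affine function [h0 + h1 (z - z0)], so that part of the integral
    depends on the end points only. Around a rectangle these contributions cancel, and only the
    error terms remain. *)
Lemma edge_estimate (g : R -> C) (g' : R -> C) (h : C -> C) (h0 h1 z0 : C) a b L M :
  a <= b ->
  (forall x, a <= x <= b -> diff RtoC g x (g' x) /\ cont RtoC g' x /\
     cont idC h (g x) /\ Cmod (g' x) <= L /\
     Cmod (h (g x) - h0 - h1 * (g x - z0)) <= M) ->
  let A := fun z => (h0 * z + h1 * ((z - z0) * (z - z0)) * / 2)%C in
  Cmod (CI (fun x => h (g x) * g' x)%C a b - (A (g b) - A (g a))) <= 2 * (b - a) * (M * L).
Proof.
  intros Hab H A.
  assert (C1 : conton (fun x => h (g x) * g' x)%C a b).
  { intros x Hx. destruct (H x Hx) as [H1 [H2 [H3 _]]].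
    apply cont_mult; auto. apply (cont_comp _ g h); auto. now apply (diff_cont _ _ _ (g' x)). }
  assert (C2 : conton (fun x => (h0 + h1 * (g x - z0)) * g' x)%C a b).
  { intros x Hx. destruct (H x Hx) as [H1 [H2 _]].
    apply cont_mult; auto. apply cont_plus; [apply cont_const|].
    apply cont_mult; [apply cont_const|]. apply cont_minus; [|apply cont_const].
    now apply (diff_cont _ _ _ (g' x)). }
  replace (A (g b) - A (g a))%C with (CI (fun x => (h0 + h1 * (g x - z0)) * g' x)%C a b).
  - rewrite <- CI_minus by auto. apply CI_bound; auto.
    { now apply conton_minus. }
    intros x Hx. destruct (H x Hx) as [_ [_ [_ [H1 H2]]]].
    replace (h (g x) * g' x - (h0 + h1 * (g x - z0)) * g' x)%C
      with ((h (g x) - h0 - h1 * (g x - z0)) * g' x)%C by ring.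
    rewrite Cmod_mult. apply Rmult_le_compat; auto; apply Cmod_ge_0.
  - apply (CI_derive (fun x => A (g x))); auto.
    intros x Hx. destruct (H x Hx) as [H1 _]. unfold A.
    assert (D0 : diff RtoC (fun x => g x - z0)%C x (g' x)).
    { apply (diff_eq _ _ _ (g' x - 0)%C); [ring|]. apply diff_minus; auto. apply diff_const. }
    assert (D1 := diff_mult _ _ _ _ _ _ D0 D0).
    assert (D2 := diff_scal _ _ (h1 * / 2)%C _ _ D1).
    assert (D3 := diff_scal _ _ h0 _ _ H1).
    assert (D4 := diff_plus _ _ _ _ _ _ D3 D2).
    eapply diff_eq; [|eapply diff_ext; [|apply D4]].
    + simpl. field.
    + intros y; simpl. ring.
Qed.

(** At the point reached by bisection [h] is affine up to an error that is small compared with the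
    distance. The affine part integrates to zero around each rectangle, and the rest is of the order
    [e * rsize ^ 2] required by the bisection. *)
Lemma goursat (h : C -> C) (P Ps Pt : R -> R -> C) (Q : rect) (L : R) :
  sub_rect Q Q -> 0 < L -> smooth_map Q P Ps Pt L ->
  (forall s t, in_rect Q s t -> exists l, diff idC h (P s t) l) ->
  boundary_integral h P Ps Pt Q = 0.
Proof.
  intros HQ HL HP Hh.
  assert (Cs : forall s t, in_rect Q s t -> cont RtoC (fun s => h (P s t) * Ps s t)%C s).
  { intros s t Hst. destruct (HP s t Hst) as [H1 [H2 [H3 [H4 _]]]].
    apply cont_mult; auto. apply (cont_comp _ (fun s => P s t) h).
    - eapply diff_cont; eauto.
    - destruct (Hh s t Hst) as [l Hl]. eapply diff_cont; eauto. }
  assert (Ct : forall s t, in_rect Q s t -> cont RtoC (fun t => h (P s t) * Pt s t)%C t).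
  { intros s t Hst. destruct (HP s t Hst) as [H1 [H2 [H3 [H4 _]]]].
    apply cont_mult; auto. apply (cont_comp _ (fun t => P s t) h).
    - eapply diff_cont; eauto.
    - destruct (Hh s t Hst) as [l Hl]. eapply diff_cont; eauto. }
  apply goursat_bisection; auto.
  - intros q Hq. unfold boundary_integral, quarter; simpl.
    unfold sub_rect in Hq.
    set (ms := (rl q + rr q) / 2). set (mt := (rb q + rt q) / 2).
    assert (rl q <= ms <= rr q) by (unfold ms; lra).
    assert (rb q <= mt <= rt q) by (unfold mt; lra).
    assert (Es : forall t, rb q <= t <= rt q ->
       CI (fun s => h (P s t) * Ps s t)%C (rl q) (rr q) =
       (CI (fun s => h (P s t) * Ps s t)%C (rl q) ms + CI (fun s => h (P s t) * Ps s t)%C ms (rr q))%C).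
    { intros t Ht. apply CI_Chasles; try lra. intros s Hs. apply Cs. unfold in_rect; lra. }
    assert (Et : forall s, rl q <= s <= rr q ->
       CI (fun t => h (P s t) * Pt s t)%C (rb q) (rt q) =
       (CI (fun t => h (P s t) * Pt s t)%C (rb q) mt + CI (fun t => h (P s t) * Pt s t)%C mt (rt q))%C).
    { intros s Hs. apply CI_Chasles; try lra. intros t Ht. apply Ct. unfold in_rect; lra. }
    rewrite (Es (rb q)), (Es (rt q)), (Et (rl q)), (Et (rr q)) by lra. ring.
  - intros s t Hs Ht e He.
    assert (Hst : in_rect Q s t) by (split; auto).
    destruct (Hh s t Hst) as [h1 Hd].
    set (z0 := P s t) in *. set (h0 := h z0).
    (* One factor [L] converts [rsize] into a distance in the image, the other bounds the
       derivatives of [P]. With the factor 2 of [CI_bound] and each side length occurring twice, the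
       four edges add up to exactly [e * (rsize q * rsize q)]. *)
    destruct (Hd (e / (4 * L * L))) as [d [Hd0 D]].
    { apply Rdiv_lt_0_compat; nra. }
    exists (d / L). split; [now apply Rdiv_lt_0_compat|].
    intros q Hq Hqs Hqt Hsz.
    assert (Hin : forall s' t', in_rect q s' t' ->
       in_rect Q s' t' /\ Cmod (h (P s' t') - h0 - h1 * (P s' t' - z0)) <= e / (4 * L) * rsize q).
    { intros s' t' [H1 H2]. unfold sub_rect in Hq.
      assert (Hin' : in_rect Q s' t') by (unfold in_rect; lra). split; auto.
      destruct (HP s t Hst) as [_ [_ [_ [_ [_ [_ Lip]]]]]].
      specialize (Lip s' t' Hin').
      assert (Rabs (s' - s) + Rabs (t' - t) <= rsize q).
      { unfold rsize. assert (Rabs (s' - s) <= rr q - rl q) by (apply Rabs_le; lra).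
        assert (Rabs (t' - t) <= rt q - rb q) by (apply Rabs_le; lra). lra. }
      assert (Hdist : Cmod (P s' t' - z0) <= L * rsize q).
      { unfold z0. eapply Rle_trans; [apply Lip|]. apply Rmult_le_compat_l; lra. }
      assert (L * rsize q < d).
      { apply Rmult_lt_reg_r with (/ L); [now apply Rinv_0_lt_compat|].
        replace (L * rsize q * / L) with (rsize q) by (field; lra). auto. }
      specialize (D (P s' t')). unfold idC in D. eapply Rle_trans; [apply D; lra|].
      replace (e / (4 * L) * rsize q) with (e / (4 * L * L) * (L * rsize q)) by (field; lra).
      apply Rmult_le_compat_l; auto. left. apply Rdiv_lt_0_compat; nra. }
    assert (Hq' := Hq). unfold sub_rect in Hq'.
    set (M := e / (4 * L) * rsize q) in *.
    set (A := fun z => (h0 * z + h1 * ((z - z0) * (z - z0)) * / 2)%C).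
    assert (Bs : forall t', rb q <= t' <= rt q ->
      Cmod (CI (fun s => h (P s t') * Ps s t')%C (rl q) (rr q) - (A (P (rr q) t') - A (P (rl q) t')))
        <= 2 * (rr q - rl q) * (M * L)).
    { intros t' Ht'. apply (edge_estimate (fun s => P s t') (fun s => Ps s t')); [lra|].
      intros x Hx. destruct (Hin x t' (conj Hx Ht')) as [Hi Hb].
      destruct (HP x t' Hi) as [H1 [H2 [H3 [H4 [H5 [H6 _]]]]]].
      repeat split; auto. destruct (Hh x t' Hi) as [l Hl]. eapply diff_cont; eauto. }
    assert (Bt : forall s', rl q <= s' <= rr q ->
      Cmod (CI (fun t => h (P s' t) * Pt s' t)%C (rb q) (rt q) - (A (P s' (rt q)) - A (P s' (rb q))))
        <= 2 * (rt q - rb q) * (M * L)).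
    { intros s' Hs'. apply (edge_estimate (fun t => P s' t) (fun t => Pt s' t)); [lra|].
      intros x Hx. destruct (Hin s' x (conj Hs' Hx)) as [Hi Hb].
      destruct (HP s' x Hi) as [H1 [H2 [H3 [H4 [H5 [H6 _]]]]]].
      repeat split; auto. destruct (Hh s' x Hi) as [l Hl]. eapply diff_cont; eauto. }
    assert (B1 := Bs (rb q) ltac:(lra)). assert (B2 := Bs (rt q) ltac:(lra)).
    assert (B3 := Bt (rl q) ltac:(lra)). assert (B4 := Bt (rr q) ltac:(lra)).
    unfold boundary_integral.
    match type of B1 with Cmod ?u <= _ => match type of B2 with Cmod ?v <= _ =>
    match type of B3 with Cmod ?w <= _ => match type of B4 with Cmod ?x <= _ =>
      match goal with |- Cmod ?z <= _ => replace z with (u + x - v - w)%C by ring end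
    end end end end.
    eapply Rle_trans; [apply Cmod_minus_le|].
    eapply Rle_trans; [apply Rplus_le_compat_r, Cmod_minus_le|].
    eapply Rle_trans; [apply Rplus_le_compat_r, Rplus_le_compat_r, Cmod_triangle|].
    assert (EM : M * L = e / 4 * rsize q) by (unfold M; field; lra).
    rewrite EM in *.
    replace (e * (rsize q * rsize q)) with
      (2 * (rr q - rl q) * (e / 4 * rsize q) + 2 * (rt q - rb q) * (e / 4 * rsize q)
       + 2 * (rr q - rl q) * (e / 4 * rsize q) + 2 * (rt q - rb q) * (e / 4 * rsize q))
      by (unfold rsize; field).
    lra.
Qed.

Lemma cis_0 : cis 0 = RtoC 1.
Proof. unfold cis. now rewrite cos_0, sin_0. Qed.

Lemma cis_2PI : cis (2 * PI) = RtoC 1.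
Proof. unfold cis. now rewrite cos_2PI, sin_2PI. Qed.

Lemma cis_lip s t : Cmod (cis s - cis t) <= 4 * Rabs (s - t).
Proof.
  assert (K : forall a b, a <= b -> Cmod (cis b - cis a) <= 2 * (b - a)).
  { intros a b Hab.
    rewrite <- (CI_derive cis (fun t => Ci * cis t)%C a b); auto.
    - eapply Rle_trans; [apply CI_bound with (M := 1); auto|lra].
      + intros x _. apply cont_mult; [apply cont_const|]. eapply diff_cont, diff_cis.
      + intros x _. rewrite Cmod_mult, Cmod_cis, Cmod_Ci. lra.
    - intros; apply diff_cis.
    - intros x _. apply cont_mult; [apply cont_const|]. eapply diff_cont, diff_cis. }
  destruct (Rle_dec s t).
  - rewrite Cmod_minus_sym, Rabs_left1 by lra. specialize (K s t r). lra.
  - rewrite Rabs_pos_eq by lra. specialize (K t s ltac:(lra)). lra.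
Qed.

(** The homotopy [P] moves the circle of centre [w] and radius [d] to the unit circle. Goursat's
    theorem is applied on [[0, 1] x [0, 2 PI]], where the sides [t = 0] and [t = 2 PI] trace the
    same path and cancel. *)
Lemma circle_deformation (h : C -> C) (w : C) (d : R) :
  Cmod w <= 1/2 -> 0 < d <= 1/2 ->
  (forall z, Cmod z < 2 -> z <> w -> exists l, diff idC h z l) ->
  CI (fun t => h (cis t) * (Ci * cis t))%C 0 (2 * PI) =
  CI (fun t => h (w + d * cis t) * (Ci * (d * cis t)))%C 0 (2 * PI).
Proof.
  intros Hw Hd Hh.
  set (rho := fun s => (1 - s) * d + s).
  set (P := fun s t => ((1 - s)%R * w + rho s * cis t)%C).
  set (Ps := fun (s t : R) => (- w + (1 - d)%R * cis t)%C).
  set (Pt := fun s t => (rho s * (Ci * cis t))%C).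
  set (Q := Rect 0 1 0 (2 * PI)).
  assert (HPI := PI_RGT_0).
  assert (G : boundary_integral h P Ps Pt Q = 0).
  { apply goursat with (L := 4).
    - unfold sub_rect; simpl; lra.
    - lra.
    - intros s t [Hs Ht]; simpl in Hs, Ht.
      assert (Hr : 0 <= rho s <= 1) by (unfold rho; nra).
      assert (Dr : diff RtoC (fun s => RtoC (rho s)) s (1 - d)%R).
      { apply (diff_ext _ (fun s : R => d + (1 - d)%R * s)%C).
        - intros y. unfold rho. rewrite <- RtoC_mult, <- RtoC_plus. f_equal. ring.
        - apply (diff_eq _ _ _ (0 + (1 - d)%R * 1)%C); [ring|].
          apply diff_plus; [apply diff_const|]. apply diff_scal, diff_id. }
      assert (Dw : diff RtoC (fun s => RtoC (1 - s)) s (-(1))%C).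
      { apply (diff_ext _ (fun s : R => 1 - s)%C).
        - intros y. now rewrite <- RtoC_minus.
        - apply (diff_eq _ _ _ (0 - 1)%C); [ring|].
          apply diff_minus; [apply diff_const|]. apply diff_id. }
      split; [|split; [|split; [|split; [|split; [|split]]]]].
      + unfold P, Ps.
        apply (diff_eq _ _ _ (((1 - s)%R * 0 + -(1) * w) + (rho s * 0 + (1 - d)%R * cis t))%C); [ring|].
        apply diff_plus.
        * apply (diff_mult _ (fun s => RtoC (1 - s)) (fun _ => w)); [auto|apply diff_const].
        * apply (diff_mult _ (fun s => RtoC (rho s)) (fun _ => cis t)); [auto|apply diff_const].
      + unfold P, Pt. apply (diff_eq _ _ _ (0 + rho s * (Ci * cis t))%C); [ring|].
        apply diff_plus; [apply diff_const|]. apply diff_scal, diff_cis.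
      + unfold Ps. apply cont_const.
      + unfold Pt. apply cont_mult; [apply cont_const|].
        apply cont_mult; [apply cont_const|]. eapply diff_cont, diff_cis.
      + unfold Ps. eapply Rle_trans; [apply Cmod_triangle|].
        rewrite Cmod_opp, Cmod_mult, Cmod_cis, Cmod_Rpos by lra. lra.
      + unfold Pt. rewrite !Cmod_mult, Cmod_cis, Cmod_Ci, Cmod_Rpos by lra. lra.
      + intros s' t' [Hs' Ht']; simpl in Hs', Ht'.
        replace (P s' t' - P s t)%C
          with ((s' - s)%R * (- w + (1 - d)%R * cis t') + rho s * (cis t' - cis t))%C.
        * eapply Rle_trans; [apply Cmod_triangle|]. rewrite !Cmod_mult, Cmod_R.
          rewrite (Cmod_Rpos (rho s)) by lra.
          assert (Cmod (- w + (1 - d)%R * cis t') <= 4).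
          { eapply Rle_trans; [apply Cmod_triangle|].
            rewrite Cmod_opp, Cmod_mult, Cmod_cis, Cmod_Rpos by lra. lra. }
          assert (H2 := cis_lip t' t). assert (H3 := Rabs_pos (s' - s)).
          assert (H4 := Cmod_ge_0 (cis t' - cis t)). nra.
        * unfold P, rho. rewrite !RtoC_plus, !RtoC_mult, !RtoC_minus. ring.
    - intros s t [Hs Ht]; simpl in Hs, Ht.
      assert (Hr : 0 <= rho s <= 1) by (unfold rho; nra).
      apply Hh.
      + unfold P. eapply Rle_lt_trans; [apply Cmod_triangle|].
        rewrite !Cmod_mult, Cmod_cis, !Cmod_Rpos by lra.
        assert (rho s <= 1) by lra. nra.
      (* The homotopy avoids [w]: equality would force [rho s = s * Cmod w <= s / 2], whereas
         [rho s >= s], and [rho s = d > 0] when [s = 0]. *)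
      + intros E. assert (E2 : (rho s * cis t = s * w)%C).
        { replace (rho s * cis t)%C with (P s t - (1 - s)%R * w)%C by (unfold P; ring).
          rewrite E. rewrite RtoC_minus. ring. }
        apply (f_equal Cmod) in E2. rewrite !Cmod_mult, Cmod_cis, !Cmod_Rpos in E2 by lra.
        assert (s * Cmod w <= s * (1/2)) by (apply Rmult_le_compat_l; lra).
        unfold rho in E2. nra. }
  unfold boundary_integral in G; simpl in G.
  rewrite (CI_ext (fun s => h (P s (2 * PI)%R) * Ps s (2 * PI)%R)%C (fun s => h (P s 0) * Ps s 0)%C) in G.
  2:{ lra. }
  2:{ intros s _. unfold P, Ps. now rewrite cis_0, cis_2PI. }
  rewrite (CI_ext (fun t => h (P 1 t) * Pt 1 t)%C (fun t => h (cis t) * (Ci * cis t))%C) in G.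
  2:{ lra. }
  2:{ intros t _. unfold P, Pt, rho.
      replace ((1 - 1) * d + 1) with 1 by ring. replace (1 - 1) with 0 by ring.
      f_equal; [f_equal|]; ring. }
  rewrite (CI_ext (fun t => h (P 0 t) * Pt 0 t)%C
      (fun t => h (w + d * cis t) * (Ci * (d * cis t)))%C) in G.
  2:{ lra. }
  2:{ intros t _. unfold P, Pt, rho.
      replace ((1 - 0) * d + 0) with d by ring. replace (1 - 0) with 1 by ring.
      f_equal; [f_equal|]; ring. }
  apply Cmod_sub_eq_0. transitivity (Cmod 0); [|apply Cmod_0]. f_equal. rewrite <- G. ring.
Qed.

(** Cauchy transform of [p] on the unit circle. *)
Definition CT (p : R -> C) (w : C) : C := CI (fun t => p t / (cis t - w))%C 0 (2 * PI).

Lemma cis_sub_bound t w : Cmod w <= 1/2 -> 1/2 <= Cmod (cis t - w).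
Proof.
  intros Hw. assert (H := Cmod_le_add (cis t) w). rewrite Cmod_cis in H. lra.
Qed.

Lemma cis_sub_neq0 t w : Cmod w <= 1/2 -> (cis t - w)%C <> 0.
Proof. intros Hw. apply Cmod_gt_0. generalize (cis_sub_bound t w Hw). lra. Qed.

Lemma cont_cis t : cont RtoC cis t.
Proof. eapply diff_cont, diff_cis. Qed.

(** After deformation to a circle of radius [d'] about [w] the integral of [f z / (z - w)] becomes
    that of [Ci * f (w + d' * cis t)], which tends to [2 PI Ci f w] by continuity. In the density,
    [cis t / (2 PI)] stands for [dz / (2 PI Ci)]. *)
Lemma cauchy_formula (f : C -> C) (w : C) :
  (forall z, Cmod z < 2 -> exists l, diff idC f z l) -> Cmod w <= 1/2 ->
  f w = CT (fun t => f (cis t) * cis t / (2 * PI)%R)%C w.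
Proof.
  intros Hf Hw. assert (HPI := PI_RGT_0).
  set (h := fun z => (f z / (z - w))%C).
  assert (Hh : forall z, Cmod z < 2 -> z <> w -> exists l, diff idC h z l).
  { intros z Hz Hzw. destruct (Hf z Hz) as [l Hl]. eexists. unfold h.
    apply (diff_div idC f (fun z => z - w)%C); [apply Hl| |now apply Csub_neq_0].
    apply diff_minus; [apply diff_id|apply diff_const]. }
  assert (Cf : cont idC f w).
  { destruct (Hf w) as [l Hl]; [lra|]. eapply diff_cont; eauto. }
  set (I := CI (fun t => h (cis t) * (Ci * cis t))%C 0 (2 * PI)).
  assert (E : I = (2 * PI * Ci * f w)%C).
  { apply eq_of_Cmod_small. intros e He.
    destruct (Cf (e / (4 * PI))) as [d [Hd D]]; [apply Rdiv_lt_0_compat; lra|].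
    pose (d' := Rmin (d/2) (1/2)).
    assert (Hd' : 0 < d' <= 1/2).
    { unfold d'. split; [apply Rmin_glb_lt; lra|apply Rmin_r]. }
    assert (Hd2 : d' < d) by (unfold d'; generalize (Rmin_l (d/2) (1/2)); lra).
    assert (Hdz : RtoC d' <> 0) by (intros E; apply RtoC_inj in E; lra).
    assert (Dom : forall t, Cmod (w + d' * cis t) < 2).
    { intros t. eapply Rle_lt_trans; [apply Cmod_triangle|].
      rewrite Cmod_mult, Cmod_cis, Cmod_Rpos by lra. lra. }
    unfold I. rewrite (circle_deformation h w d') by auto.
    rewrite (CI_ext _ (fun t => Ci * f (w + d' * cis t))%C).
    2:{ lra. }
    2:{ intros t _. unfold h.
        assert (w + d' * cis t - w <> 0)%C.
        { replace (w + d' * cis t - w)%C with (d' * cis t)%C by ring.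
          apply Cmult_neq_0; auto. apply cis_neq0. }
        field. auto. }
    replace (2 * PI * Ci * f w)%C with (CI (fun _ => Ci * f w)%C 0 (2 * PI)).
    2:{ rewrite CI_const by lra. rewrite Rminus_0_r, RtoC_mult. ring. }
    assert (Cn : conton (fun t => Ci * f (w + d' * cis t))%C 0 (2 * PI)).
    { intros t _. apply cont_mult; [apply cont_const|].
      apply (cont_comp _ (fun t => w + d' * cis t)%C f).
      - apply cont_plus; [apply cont_const|]. apply cont_mult; [apply cont_const|apply cont_cis].
      - destruct (Hf _ (Dom t)) as [l Hl]. eapply diff_cont; eauto. }
    rewrite <- CI_minus; [|lra|auto|apply conton_const].
    eapply Rle_trans; [apply CI_bound with (M := e / (4 * PI))|].
    - lra.
    - apply conton_minus; auto. apply conton_const.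
    - intros t _. replace (Ci * f (w + d' * cis t) - Ci * f w)%C
        with (Ci * (f (w + d' * cis t) - f w))%C by ring.
      rewrite Cmod_mult, Cmod_Ci, Rmult_1_l. left. apply D. unfold idC.
      replace (w + d' * cis t - w)%C with (d' * cis t)%C by ring.
      rewrite Cmod_mult, Cmod_cis, Cmod_Rpos; lra.
    - right. field. lra. }
  assert (HP0 : RtoC PI <> 0) by (intros E1; apply RtoC_inj in E1; lra).
  assert (HCi : Ci <> 0) by (apply Cmod_gt_0; rewrite Cmod_Ci; lra).
  transitivity (/ (2 * PI * Ci) * I)%C.
  { rewrite E. field. repeat split; auto. }
  unfold I, CT. rewrite <- CI_scal; [|lra|].
  - apply CI_ext; [lra|]. intros t _. unfold h. rewrite RtoC_mult. field.
    repeat split; auto. now apply cis_sub_neq0.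
  - intros t _. apply cont_mult.
    + apply (cont_comp _ cis h); [apply cont_cis|].
      destruct (Hh (cis t)) as [l Hl].
      * rewrite Cmod_cis; lra.
      * intros E2. apply (cis_sub_neq0 t w Hw). rewrite E2. ring.
      * eapply diff_cont; eauto.
    + apply cont_mult; [apply cont_const|apply cont_cis].
Qed.

(** * Cauchy estimates and limits of holomorphic functions *)

Lemma conton_bounded p a b : a <= b -> conton p a b ->
  exists M, 0 < M /\ forall t, a <= t <= b -> Cmod (p t) <= M.
Proof.
  intros Hab Hp.
  destruct (continuity_ab_maj (fun t => Cmod (p t)) a b Hab) as [m [Hm _]].
  - intros t Ht e He. destruct (Hp t Ht e He) as [d [Hd D]].
    exists d; split; auto. intros s [_ Hs]. simpl in *. unfold R_dist in *.
    assert (H : Cmod (p s - p t) < e) by (apply D; rewrite <- RtoC_minus, Cmod_R; auto).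
    apply Rabs_def1.
    + generalize (Cmod_le_add (p s) (p t)). lra.
    + generalize (Cmod_le_add (p t) (p s)). rewrite Cmod_minus_sym. lra.
  - exists (Cmod (p m) + 1). split; [generalize (Cmod_ge_0 (p m)); lra|].
    intros t Ht. specialize (Hm t Ht). lra.
Qed.

(** The Cauchy transform differentiated under the integral sign. *)
Definition CTd (p : R -> C) (w : C) : C :=
  CI (fun t => p t / ((cis t - w) * (cis t - w)))%C 0 (2 * PI).

Lemma cont_cis_sub t w : cont RtoC (fun t => cis t - w)%C t.
Proof. apply cont_minus; [apply cont_cis|apply cont_const]. Qed.

Lemma conton_CT p w : Cmod w <= 1/2 -> conton p 0 (2 * PI) ->
  conton (fun t => p t / (cis t - w))%C 0 (2 * PI).
Proof.
  intros Hw Hp t Ht. apply cont_div; auto; [apply cont_cis_sub|now apply cis_sub_neq0].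
Qed.

Lemma conton_CTd p w : Cmod w <= 1/2 -> conton p 0 (2 * PI) ->
  conton (fun t => p t / ((cis t - w) * (cis t - w)))%C 0 (2 * PI).
Proof.
  intros Hw Hp t Ht. apply cont_div; auto.
  - apply cont_mult; apply cont_cis_sub.
  - apply Cmult_neq_0; now apply cis_sub_neq0.
Qed.

Lemma Cmod_div_le x y M e : Cmod x <= M -> 0 < e -> e <= Cmod y -> Cmod (x / y) <= M / e.
Proof.
  intros Hx He Hy. assert (y <> 0) by (apply Cmod_gt_0; lra).
  rewrite Cmod_div by auto. unfold Rdiv. apply Rmult_le_compat; auto.
  - apply Cmod_ge_0.
  - left. apply Rinv_0_lt_compat. lra.
  - apply Rinv_le_contravar; auto.
Qed.

Lemma CT_bound p w M : Cmod w <= 1/2 -> conton p 0 (2 * PI) ->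
  (forall t, 0 <= t <= 2 * PI -> Cmod (p t) <= M) -> Cmod (CT p w) <= 8 * PI * M.
Proof.
  intros Hw Hp HM. assert (HPI := PI_RGT_0). unfold CT.
  eapply Rle_trans; [apply CI_bound with (M := M / (1/2)); [lra|now apply conton_CT|]|].
  - intros t Ht. apply Cmod_div_le; auto; [lra|]. now apply cis_sub_bound.
  - right. field.
Qed.

Lemma Cmod_mult_ge x y a b : 0 <= a -> 0 <= b -> a <= Cmod x -> b <= Cmod y -> a * b <= Cmod (x * y).
Proof. intros. rewrite Cmod_mult. apply Rmult_le_compat; auto. Qed.

Lemma CTd_bound p w M : Cmod w <= 1/2 -> conton p 0 (2 * PI) ->
  (forall t, 0 <= t <= 2 * PI -> Cmod (p t) <= M) -> Cmod (CTd p w) <= 16 * PI * M.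
Proof.
  intros Hw Hp HM. assert (HPI := PI_RGT_0). unfold CTd.
  eapply Rle_trans; [apply CI_bound with (M := M / (1/2*(1/2))); [lra|now apply conton_CTd|]|].
  - intros t Ht. apply Cmod_div_le; auto; [lra|].
    apply Cmod_mult_ge; try lra; now apply cis_sub_bound.
  - right. field.
Qed.

(** The integrand of the difference is exactly [p (w' - w)^2 / ((cis t - w)^2 (cis t - w'))]. The
    three factors below are at least [1/2], which gives 8, and [CI_bound] contributes [4 PI]. The
    estimate depends on the density only through [M], so it yields both differentiability and
    uniform Taylor bounds. *)
Lemma CT_expansion p w w' M : Cmod w <= 1/2 -> Cmod w' <= 1/2 -> conton p 0 (2 * PI) ->
  (forall t, 0 <= t <= 2 * PI -> Cmod (p t) <= M) ->
  Cmod (CT p w' - CT p w - CTd p w * (w' - w)) <= 32 * PI * M * (Cmod (w' - w) * Cmod (w' - w)).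
Proof.
  intros Hw Hw' Hp HM. assert (HPI := PI_RGT_0). unfold CT, CTd.
  assert (C1 := conton_CT p w Hw Hp). assert (C2 := conton_CT p w' Hw' Hp).
  assert (C3 := conton_CTd p w Hw Hp).
  assert (C4 : conton (fun t => (w' - w) * (p t / ((cis t - w) * (cis t - w))))%C 0 (2 * PI))
    by (apply conton_mult; [apply conton_const|auto]).
  rewrite Cmult_comm, <- CI_scal by (auto; lra).
  rewrite <- !CI_minus by (auto; try lra; now apply conton_minus).
  eapply Rle_trans; [apply CI_bound with
    (M := M * (Cmod (w' - w) * Cmod (w' - w)) / (1/2*(1/2)*(1/2)))|].
  - lra.
  - apply conton_minus; auto. now apply conton_minus.
  - intros t Ht.
    assert (N1 := cis_sub_neq0 t w Hw). assert (N2 := cis_sub_neq0 t w' Hw').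
    replace (p t / (cis t - w') - p t / (cis t - w) -
       (w' - w) * (p t / ((cis t - w) * (cis t - w))))%C with
      (p t * ((w' - w) * (w' - w)) / ((cis t - w) * (cis t - w) * (cis t - w')))%C
      by (field; auto).
    apply Cmod_div_le.
    + rewrite !Cmod_mult. apply Rmult_le_compat_r; auto. apply Rmult_le_pos; apply Cmod_ge_0.
    + lra.
    + apply Cmod_mult_ge; try lra; [|now apply cis_sub_bound].
      apply Cmod_mult_ge; try lra; now apply cis_sub_bound.
  - right. field.
Qed.

(** * Holomorphic functions on discs and their scaled Cauchy estimates *)

Definition holB (f : C -> C) (c : C) (r : R) : Prop :=
  forall z, Cmod (z - c) < r -> exists l, diff idC f z l.

Definition der (f : C -> C) (z : C) : C :=
  match excluded_middle_informative (exists l, diff idC f z l) with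
  | left H => proj1_sig (constructive_indefinite_description _ H)
  | right _ => 0
  end.

Lemma der_spec f z : (exists l, diff idC f z l) -> diff idC f z (der f z).
Proof.
  intros H. unfold der. destruct (excluded_middle_informative _) as [H'|H']; [|tauto].
  now destruct (constructive_indefinite_description _ H').
Qed.

Lemma der_eq f z l : diff idC f z l -> der f z = l.
Proof. intros H. apply (diff_unique f z); auto. apply der_spec. eauto. Qed.

Lemma diff_affine (f : C -> C) (c k u l : C) :
  diff idC f (c + k * u)%C l -> diff idC (fun u => f (c + k * u)%C) u (l * k)%C.
Proof.
  intros H. apply (diff_comp idC (fun u => c + k * u)%C f); auto.
  apply (diff_eq _ _ _ (0 + k * 1)%C); [ring|].
  apply diff_plus; [apply diff_const|]. apply diff_scal, diff_id.
Qed.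

Lemma diff_affine_inv (f : C -> C) (c k u l : C) : k <> 0 ->
  diff idC (fun u => f (c + k * u)%C) u l -> diff idC f (c + k * u)%C (l / k)%C.
Proof.
  intros Hk H.
  apply (diff_ext _ (fun z => (fun u => f (c + k * u)%C) (- c / k + / k * z)%C)).
  { intros z. simpl. replace (c + k * (- c / k + / k * z))%C with z by (field; auto). reflexivity. }
  apply (diff_affine (fun u => f (c + k * u)%C) (- c / k)%C (/ k)%C).
  replace (- c / k + / k * (c + k * u))%C with u by (field; auto). auto.
Qed.

Lemma quadratic_diff (f : C -> C) w l K r : 0 < r -> 0 <= K ->
  (forall w', Cmod (w' - w) < r ->
     Cmod (f w' - f w - l * (w' - w)) <= K * (Cmod (w' - w) * Cmod (w' - w))) ->
  diff idC f w l.
Proof.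
  intros Hr HK H e He.
  exists (Rmin r (e / (K + 1))). split.
  - apply Rmin_glb_lt; auto. apply Rdiv_lt_0_compat; lra.
  - intros y Hy. unfold idC in *. apply Rmin_case_lt in Hy as [H1 H2].
    eapply Rle_trans; [apply H; auto|]. rewrite <- Rmult_assoc.
    apply Rmult_le_compat_r; [apply Cmod_ge_0|].
    assert (Cmod (y - w) * (K + 1) <= e).
    { replace e with (e / (K + 1) * (K + 1)) by (field; lra).
      apply Rmult_le_compat_r; lra. }
    generalize (Cmod_ge_0 (y - w)). nra.
Qed.

Lemma half_disc_nbhd (w w' : C) : Cmod (w' - w) < 1/2 - Cmod w -> Cmod w' <= 1/2.
Proof. intros H. generalize (Cmod_le_add w' w). lra. Qed.

Lemma CT_diff p w : Cmod w < 1/2 -> conton p 0 (2 * PI) -> diff idC (CT p) w (CTd p w).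
Proof.
  intros Hw Hp. assert (HPI := PI_RGT_0).
  destruct (conton_bounded p 0 (2 * PI) ltac:(lra) Hp) as [M [HM0 HM]].
  apply (quadratic_diff _ _ _ (32 * PI * M) (1/2 - Cmod w)); [lra|nra|].
  intros w' Hw'. apply CT_expansion; auto; [lra|]. now apply half_disc_nbhd with w.
Qed.

(** Cauchy data of [f] on the circle of centre [c] and radius [r / 2], in the
    coordinate [z = c + (r / 2) u]. *)
Definition cdata (f : C -> C) (c : C) (r : R) (t : R) : C :=
  (f (c + (r/2)%R * cis t) * cis t / (2 * PI)%R)%C.

Lemma Cmod_scaled (c : C) r u : 0 < r -> Cmod (c + (r/2)%R * u - c) = r / 2 * Cmod u.
Proof.
  intros Hr. replace (c + (r/2)%R * u - c)%C with ((r/2)%R * u)%C by ring.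
  rewrite Cmod_mult, Cmod_Rpos; lra.
Qed.

Lemma half_neq0 r : 0 < r -> RtoC (r/2) <> 0.
Proof. intros H E. apply RtoC_inj in E. lra. Qed.

Lemma twoPI_neq0 : RtoC (2 * PI) <> 0.
Proof. intros H. apply RtoC_inj in H. generalize PI_RGT_0. lra. Qed.

Lemma cont_circle f c r t : 0 < r -> holB f c r ->
  cont RtoC (fun t => f (c + (r/2)%R * cis t)%C) t.
Proof.
  intros Hr Hf. apply (cont_comp _ (fun t => c + (r/2)%R * cis t)%C f).
  - apply cont_plus; [apply cont_const|]. apply cont_mult; [apply cont_const|apply cont_cis].
  - destruct (Hf (c + (r/2)%R * cis t)%C) as [l Hl].
    + rewrite Cmod_scaled, Cmod_cis by auto. lra.
    + eapply diff_cont; eauto.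
Qed.

Lemma cdata_cont f c r a b : 0 < r -> holB f c r -> conton (cdata f c r) a b.
Proof.
  intros Hr Hf t _. unfold cdata. apply cont_div; [|apply cont_const|apply twoPI_neq0].
  apply cont_mult; [now apply cont_circle|apply cont_cis].
Qed.

Lemma cdata_bound f c r M t : Cmod (f (c + (r/2)%R * cis t)%C) <= M ->
  Cmod (cdata f c r t) <= M / (2 * PI).
Proof.
  intros H. assert (HPI := PI_RGT_0). unfold cdata. apply Cmod_div_le.
  - rewrite Cmod_mult, Cmod_cis. lra.
  - lra.
  - rewrite Cmod_Rpos; lra.
Qed.

(** In the coordinate [u] the disc of radius [r] becomes [|u| < 2], the circle of integration
    [|u| = 1], and [|u| <= 1/2] corresponds to the disc of radius [r / 4]; this is the origin of the
    [r / 4] in the statements below. *)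
Lemma cauchy_scaled f c r u : 0 < r -> holB f c r -> Cmod u <= 1/2 ->
  f (c + (r/2)%R * u)%C = CT (cdata f c r) u.
Proof.
  intros Hr Hf Hu.
  apply (cauchy_formula (fun u => f (c + (r/2)%R * u)%C)); auto.
  intros z Hz. destruct (Hf (c + (r/2)%R * z)%C) as [l Hl].
  - rewrite Cmod_scaled by auto. nra.
  - eexists. apply diff_affine; eauto.
Qed.

Lemma der_scaled f c r u : 0 < r -> holB f c r -> Cmod u < 1/2 ->
  der f (c + (r/2)%R * u)%C = (CTd (cdata f c r) u / (r/2)%R)%C.
Proof.
  intros Hr Hf Hu. apply der_eq. apply diff_affine_inv; [now apply half_neq0|].
  apply (diff_ext_loc _ (CT (cdata f c r)) _ _ _ (1/2 - Cmod u)); [lra| |].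
  - intros y Hy. symmetry. apply cauchy_scaled; auto. now apply half_disc_nbhd with u.
  - apply CT_diff; auto. now apply cdata_cont.
Qed.

Lemma unscale (c : C) r z : 0 < r -> Cmod (z - c) < r / 4 ->
  exists u, Cmod u < 1/2 /\ z = (c + (r/2)%R * u)%C /\ Cmod (z - c) = r / 2 * Cmod u.
Proof.
  intros Hr Hz. assert (H0 := half_neq0 r Hr).
  exists ((z - c) / (r/2)%R)%C.
  assert (E : Cmod ((z - c) / (r/2)%R) = Cmod (z - c) / (r/2)).
  { rewrite Cmod_div, Cmod_Rpos; auto. lra. }
  rewrite E. repeat split.
  - apply Rmult_lt_reg_r with (r/2); [lra|]. unfold Rdiv at 1. rewrite Rmult_assoc, Rinv_l; lra.
  - field. auto.
  - field. lra.
Qed.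

Lemma der_bound f c r M z : 0 < r -> holB f c r ->
  (forall y, Cmod (y - c) < r -> Cmod (f y) <= M) -> Cmod (z - c) < r / 4 ->
  Cmod (der f z) <= 16 * M / r.
Proof.
  intros Hr Hf HM Hz. assert (HPI := PI_RGT_0).
  destruct (unscale c r z Hr Hz) as [u [Hu [-> _]]].
  rewrite der_scaled by auto.
  replace (16 * M / r) with (8 * M / (r/2)) by (field; lra).
  apply Cmod_div_le; [|lra|rewrite Cmod_Rpos; lra].
  replace (8 * M) with (16 * PI * (M / (2 * PI))) by (field; lra).
  apply CTd_bound; [lra|now apply cdata_cont|].
  intros t _. apply cdata_bound, HM. rewrite Cmod_scaled, Cmod_cis by auto. lra.
Qed.

(** In the coordinate [u] the constant of [CT_expansion] is [32 PI * (M / (2 PI)) = 16 M], and each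
    of the two factors [v - u] costs [2 / r] when it is turned back into [z' - z]. *)
Lemma taylor_bound f c r M z z' : 0 < r -> holB f c r ->
  (forall y, Cmod (y - c) < r -> Cmod (f y) <= M) ->
  Cmod (z - c) < r / 4 -> Cmod (z' - c) < r / 4 ->
  Cmod (f z' - f z - der f z * (z' - z)) <= 64 * M / (r * r) * (Cmod (z' - z) * Cmod (z' - z)).
Proof.
  intros Hr Hf HM Hz Hz'. assert (HPI := PI_RGT_0).
  destruct (unscale c r z Hr Hz) as [u [Hu [-> _]]].
  destruct (unscale c r z' Hr Hz') as [v [Hv [-> _]]].
  rewrite der_scaled, !cauchy_scaled by (auto; lra).
  replace (c + (r/2)%R * v - (c + (r/2)%R * u))%C with ((r/2)%R * (v - u))%C by ring.
  replace (CTd (cdata f c r) u / (r/2)%R * ((r/2)%R * (v - u)))%C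
    with (CTd (cdata f c r) u * (v - u))%C by (field; now apply half_neq0).
  rewrite Cmod_mult, Cmod_Rpos by lra.
  eapply Rle_trans; [apply CT_expansion with (M := M / (2 * PI)); try lra|].
  - now apply cdata_cont.
  - intros t _. apply cdata_bound, HM. rewrite Cmod_scaled, Cmod_cis by auto. lra.
  - right. field. lra.
Qed.

(** Points of the disc of radius [r / 4] are at most [r / 2] apart, so the quadratic term adds
    [32 M / r] to the [16 M / r] of the derivative. *)
Lemma lip_bound f c r M z z' : 0 < r -> holB f c r ->
  (forall y, Cmod (y - c) < r -> Cmod (f y) <= M) ->
  Cmod (z - c) < r / 4 -> Cmod (z' - c) < r / 4 ->
  Cmod (f z' - f z) <= 48 * M / r * Cmod (z' - z).
Proof.
  intros Hr Hf HM Hz Hz'.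
  assert (HM0 : 0 <= M).
  { eapply Rle_trans; [apply Cmod_ge_0|apply (HM c)]. rewrite Cmod_sub_diag; auto. }
  assert (T := taylor_bound f c r M z z' Hr Hf HM Hz Hz').
  assert (D := der_bound f c r M z Hr Hf HM Hz).
  assert (Hd : Cmod (z' - z) <= r / 2).
  { generalize (Cmod_sub_triangle z' c z). rewrite (Cmod_minus_sym c z). lra. }
  assert (H := Cmod_le_add (f z' - f z) (der f z * (z' - z))).
  rewrite Cmod_mult in H. assert (Hz0 := Cmod_ge_0 (z' - z)).
  eapply Rle_trans; [apply H|].
  assert (Cmod (der f z) * Cmod (z' - z) <= 16 * M / r * Cmod (z' - z))
    by (apply Rmult_le_compat_r; auto).
  assert (64 * M / (r * r) * (Cmod (z' - z) * Cmod (z' - z))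
     <= 64 * M / (r * r) * (r / 2 * Cmod (z' - z))).
  { apply Rmult_le_compat_l; [|nra]. apply Rmult_le_pos; [lra|].
    left. apply Rinv_0_lt_compat. nra. }
  replace (48 * M / r * Cmod (z' - z)) with
    (16 * M / r * Cmod (z' - z) + 64 * M / (r * r) * (r / 2 * Cmod (z' - z))) by (field; lra).
  lra.
Qed.

Lemma holB_sub f c r c' r' : holB f c r -> Cmod (c' - c) + r' <= r -> holB f c' r'.
Proof.
  intros H Hr z Hz. apply H. generalize (Cmod_sub_triangle z c' c). lra.
Qed.

Lemma holB_center f c r : 0 < r -> holB f c r -> exists l, diff idC f c l.
Proof. intros Hr H. apply H. rewrite Cmod_sub_diag; auto. Qed.

(** A maximum principle with the constant 4 in place of 1, read off the Cauchy formula. *)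
Lemma center_bound f c r M : 0 < r -> holB f c r ->
  (forall t, 0 <= t <= 2 * PI -> Cmod (f (c + (r/2)%R * cis t)%C) <= M) ->
  forall z, Cmod (z - c) < r/4 -> Cmod (f z) <= 4 * M.
Proof.
  intros Hr Hf HM z Hz. assert (HPI := PI_RGT_0).
  destruct (unscale c r z Hr Hz) as [u [Hu [-> _]]].
  rewrite cauchy_scaled by (auto; lra).
  replace (4 * M) with (8 * PI * (M / (2 * PI))) by (field; lra).
  apply CT_bound; [lra|now apply cdata_cont|].
  intros t Ht. apply cdata_bound; auto.
Qed.

Lemma holB_bounded f c r : 0 < r -> holB f c r ->
  exists M, 0 < M /\ forall z, Cmod (z - c) < r/4 -> Cmod (f z) <= M.
Proof.
  intros Hr Hf. assert (HPI := PI_RGT_0).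
  destruct (conton_bounded (fun t => f (c + (r/2)%R * cis t)%C) 0 (2 * PI)) as [M [HM0 HM]].
  - lra.
  - intros t _. now apply cont_circle.
  - exists (4 * M). split; [lra|]. now apply center_bound.
Qed.

Lemma holB_cont f c r z : holB f c r -> Cmod (z - c) < r -> cont idC f z.
Proof. intros H Hz. destruct (H z Hz) as [l Hl]. eapply diff_cont; eauto. Qed.

Definition ucv (u : nat -> C -> C) (v : C -> C) (c : C) (r : R) : Prop :=
  forall e, 0 < e -> exists N, forall n, (N <= n)%nat ->
    forall z, Cmod (z - c) < r -> Cmod (u n z - v z) < e.

Lemma ucv_sub u v c r c' r' : ucv u v c r -> Cmod (c' - c) + r' <= r -> ucv u v c' r'.
Proof.
  intros H Hr e He. destruct (H e He) as [N HN]. exists N. intros n Hn z Hz.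
  apply HN; auto. generalize (Cmod_sub_triangle z c' c). lra.
Qed.

Lemma ucv_cont u v c r z : ucv u v c r ->
  (exists N, forall n, (N <= n)%nat -> holB (u n) c r) -> Cmod (z - c) < r -> cont idC v z.
Proof.
  intros H [N1 Hu] Hz e He. destruct (H (e/3)) as [N HN]; [lra|].
  set (n := (N + N1)%nat).
  destruct (holB_cont (u n) c r z (Hu n ltac:(lia)) Hz (e/3)) as [d [Hd D]]; [lra|].
  exists (Rmin d (r - Cmod (z - c))). split; [apply Rmin_glb_lt; lra|].
  unfold idC in *. intros y Hy. apply Rmin_case_lt in Hy as [H1 H2].
  assert (Hy : Cmod (y - c) < r) by (generalize (Cmod_sub_triangle y z c); lra).
  specialize (D y H1). assert (A1 := HN n ltac:(lia) y Hy). assert (A2 := HN n ltac:(lia) z Hz).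
  generalize (Cmod_sub_triangle (v y) (u n y) (v z)) (Cmod_sub_triangle (u n y) (u n z) (v z)).
  rewrite (Cmod_minus_sym (v y) (u n y)). lra.
Qed.

(** Cauchy's formula passes to the limit: near each point [v] is the Cauchy transform of its own
    continuous boundary data, and Cauchy transforms are differentiable. *)
Lemma weierstrass u v c r : ucv u v c r ->
  (exists N, forall n, (N <= n)%nat -> holB (u n) c r) -> holB v c r.
Proof.
  intros H Hu z Hz. set (s := r - Cmod (z - c)).
  assert (Hs : 0 < s) by (unfold s; lra). assert (HPI := PI_RGT_0).
  assert (H' : ucv u v z s) by (apply (ucv_sub u v c r); auto; unfold s; lra).
  assert (Hu' : exists N, forall n, (N <= n)%nat -> holB (u n) z s).
  { destruct Hu as [N HN]. exists N. intros n Hn.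
    apply (holB_sub (u n) c r); auto. unfold s; lra. }
  assert (Cc : conton (cdata v z s) 0 (2 * PI)).
  { intros t _. unfold cdata. apply cont_div; [|apply cont_const|apply twoPI_neq0].
    apply cont_mult; [|apply cont_cis].
    apply (cont_comp _ (fun t => z + (s/2)%R * cis t)%C v).
    - apply cont_plus; [apply cont_const|]. apply cont_mult; [apply cont_const|apply cont_cis].
    - apply (ucv_cont u v z s); auto. rewrite Cmod_scaled, Cmod_cis by auto. lra. }
  assert (E : forall w, Cmod w < 1/2 -> v (z + (s/2)%R * w)%C = CT (cdata v z s) w).
  { intros w Hw. apply eq_of_Cmod_small. intros e He.
    (* Four fifths of [e] go to the transforms, whose bound has the factor 4, and one fifth to the
       values at the point itself. *)
    destruct (H' (e / 5)) as [N1 HN1]; [lra|]. destruct Hu' as [N2 HN2].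
    set (n := (N1 + N2)%nat). specialize (HN1 n ltac:(lia)). specialize (HN2 n ltac:(lia)).
    assert (A1 := HN1 (z + (s/2)%R * w)%C).
    rewrite Cmod_scaled in A1 by auto. specialize (A1 ltac:(nra)).
    rewrite (cauchy_scaled (u n) z s w Hs HN2) in A1 by lra.
    assert (A2 : Cmod (CT (cdata (u n) z s) w - CT (cdata v z s) w) <= 4 * (e/5)).
    { unfold CT. rewrite <- CI_minus; [|lra|apply conton_CT; auto; try lra; now apply cdata_cont
        |apply conton_CT; auto; lra].
      rewrite (CI_ext _ (fun t => (cdata (u n) z s t - cdata v z s t) / (cis t - w))%C).
      2:{ lra. }
      2:{ intros t _. field. apply cis_sub_neq0. lra. }
      replace (4 * (e/5)) with (8 * PI * (e/5 / (2 * PI))) by (field; lra).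
      apply (CT_bound (fun t => cdata (u n) z s t - cdata v z s t)%C); [lra| |].
      - apply conton_minus; auto. now apply cdata_cont.
      - intros t _. unfold cdata.
        replace (u n (z + (s/2)%R * cis t)%C * cis t / (2 * PI)%R -
           v (z + (s/2)%R * cis t)%C * cis t / (2 * PI)%R)%C with
          ((u n (z + (s/2)%R * cis t)%C - v (z + (s/2)%R * cis t)%C) * cis t / (2 * PI)%R)%C
          by (field; apply twoPI_neq0).
        apply Cmod_div_le; [|lra|rewrite Cmod_Rpos; lra].
        rewrite Cmod_mult, Cmod_cis, Rmult_1_r. left. apply HN1.
        rewrite Cmod_scaled, Cmod_cis by auto. lra. }
    generalize (Cmod_sub_triangle (v (z + (s/2)%R * w)%C) (CT (cdata (u n) z s) w) (CT (cdata v z s) w)).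
    rewrite (Cmod_minus_sym (v (z + (s/2)%R * w)%C) (CT (cdata (u n) z s) w)). lra. }
  exists (CTd (cdata v z s) 0 / (s/2)%R)%C.
  replace z with (z + (s/2)%R * 0)%C at 1 by ring.
  apply diff_affine_inv; [now apply half_neq0|].
  apply (diff_ext_loc _ (CT (cdata v z s)) _ _ _ (1/2)); [lra| |].
  - intros y Hy. unfold idC in Hy. replace (y - 0)%C with y in Hy by ring.
    symmetry. now apply E.
  - apply CT_diff; auto. rewrite Cmod_0; lra.
Qed.

(** [der f] is the uniform limit of difference quotients of [f]. *)
Lemma der_hol f c r : holB f c r -> holB (der f) c r.
Proof.
  intros Hf z Hz. set (s := (r - Cmod (z - c)) / 4).
  assert (Hs : 0 < s) by (unfold s; lra).
  destruct (holB_bounded f z (4 * s)) as [M [HM0 HM]]; [lra| |].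
  { apply (holB_sub f c r); auto. unfold s; lra. }
  assert (Hf' : holB f z s) by (apply (holB_sub f c r); auto; unfold s; lra).
  assert (HM' : forall y, Cmod (y - z) < s -> Cmod (f y) <= M) by (intros y Hy; apply HM; lra).
  (* With [w] within [s / 8] of [z] and steps at most [s / 8], the point [w + k n] stays in the disc
     of radius [s / 4] where Taylor's bound holds. *)
  set (k := fun n => s / 8 * / (INR n + 1)).
  assert (Hk : forall n, 0 < k n <= s / 8 /\ k n <= s * / (INR n + 1)).
  { intros n. assert (P := pos_INR n). assert (Q : 0 < / (INR n + 1)) by (apply Rinv_0_lt_compat; lra).
    assert (Q' : / (INR n + 1) <= 1) by (rewrite <- Rinv_1; apply Rinv_le_contravar; lra).
    unfold k. repeat split; nra. }
  assert (Hk0 : forall n, RtoC (k n) <> 0).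
  { intros n E. apply RtoC_inj in E. destruct (Hk n). lra. }
  apply (holB_center (der f) z (s/8)); [lra|].
  apply (weierstrass (fun n w => (f (w + k n)%C - f w) / k n)%C).
  - intros e He. set (K := 64 * M / (s * s) * s + 1).
    assert (HK : 0 < 64 * M / (s * s)) by (apply Rdiv_lt_0_compat; nra).
    destruct (archimed_cor1 (e / K)) as [N [HN1 HN2]]; [apply Rdiv_lt_0_compat; unfold K; nra|].
    exists N. intros n Hn w Hw. destruct (Hk n) as [[K1 K2] K3].
    assert (E : Cmod (w + k n - w) = k n).
    { replace (w + k n - w)%C with (RtoC (k n)) by ring. apply Cmod_Rpos; lra. }
    assert (T := taylor_bound f z s M w (w + k n)%C Hs Hf' HM' ltac:(lra)
      ltac:(generalize (Cmod_sub_triangle (w + k n) w z); lra)).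
    rewrite E in T. replace (w + k n - w)%C with (RtoC (k n)) in T by ring.
    replace ((f (w + k n)%C - f w) / k n - der f w)%C
      with ((f (w + k n)%C - f w - der f w * k n) / k n)%C by (field; auto).
    rewrite Cmod_div, (Cmod_Rpos (k n)) by (auto; lra).
    apply Rle_lt_trans with (64 * M / (s * s) * k n).
    + apply Rmult_le_reg_r with (k n); auto. unfold Rdiv at 1. rewrite Rmult_assoc, Rinv_l; lra.
    + assert (Q : / (INR n + 1) < e / K).
      { eapply Rle_lt_trans; [|apply HN1]. apply Rinv_le_contravar; [apply lt_0_INR; lia|].
        apply le_INR in Hn. lra. }
      assert (Q0 : 0 < / (INR n + 1)) by (apply Rinv_0_lt_compat; generalize (pos_INR n); lra).
      apply Rle_lt_trans with (K * / (INR n + 1)).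
      * unfold K. nra.
      * replace e with (K * (e / K)) by (field; unfold K; nra).
        apply Rmult_lt_compat_l; auto. unfold K. nra.
  - exists O. intros n _ w Hw. destruct (Hk n) as [[K1 K2] _].
    destruct (Hf' w) as [l Hl]; [lra|]. destruct (Hf' (w + k n)%C) as [m Hm].
    { generalize (Cmod_sub_triangle (w + k n) w z).
      replace (w + k n - w)%C with (RtoC (k n)) by ring. rewrite Cmod_Rpos; lra. }
    eexists. apply diff_div; [|apply diff_const|auto]. apply diff_minus; [|apply Hl].
    apply (diff_comp idC (fun w => w + k n)%C f); [|apply Hm].
    apply diff_plus; [apply diff_id|apply diff_const].
Qed.

Lemma der_minus f g z : (exists l, diff idC f z l) -> (exists l, diff idC g z l) ->
  der (fun z => f z - g z)%C z = (der f z - der g z)%C.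
Proof.
  intros Hf Hg. apply der_eq. apply diff_minus; now apply der_spec.
Qed.

(** Cauchy's estimate for the derivative of [u n - v]; taking 17 against the 16 of [der_bound] keeps
    the inequality strict. *)
Lemma ucv_der u v c r : 0 < r -> ucv u v c r ->
  (exists N, forall n, (N <= n)%nat -> holB (u n) c r) ->
  ucv (fun n => der (u n)) (der v) c (r/4).
Proof.
  intros Hr H Hu e He. assert (Hv := weierstrass u v c r H Hu).
  destruct Hu as [N2 HN2].
  destruct (H (e * r / 17)) as [N1 HN1]; [apply Rdiv_lt_0_compat; [nra|lra]|].
  exists (N1 + N2)%nat. intros n Hn z Hz.
  assert (Hz' : Cmod (z - c) < r) by lra.
  rewrite <- der_minus; [|apply HN2; auto; lia|apply Hv; auto].
  apply Rle_lt_trans with (16 * (e * r / 17) / r).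
  - apply der_bound with (c := c); auto.
    + intros y Hy. destruct (HN2 n ltac:(lia) y Hy) as [l Hl]. destruct (Hv y Hy) as [m Hm].
      eexists. apply diff_minus; eauto.
    + intros y Hy. left. apply HN1; auto. lia.
  - replace (16 * (e * r / 17) / r) with (16 / 17 * e) by (field; lra). lra.
Qed.

(** * Zeros, Hurwitz's theorem and removable singularities *)

(** Since [1 / (cis t - w) = 1 / cis t + w / (cis t (cis t - w))], dividing the density by [cis]
    strips off the constant term of the power series. Thus [CT (shifts p n) 0] is the [n]-th Taylor
    coefficient of [CT p] at 0. *)
Definition shift (p : R -> C) (t : R) : C := (p t / cis t)%C.

Fixpoint shifts (p : R -> C) (n : nat) : R -> C :=
  match n with O => p | S n => shift (shifts p n) end.

Lemma shift_cont p a b : conton p a b -> conton (shift p) a b.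
Proof.
  intros Hp t Ht. apply cont_div; auto; [apply cont_cis|apply cis_neq0].
Qed.

Lemma CT_shift p w : Cmod w <= 1/2 -> conton p 0 (2 * PI) ->
  CT p w = (CT p 0 + w * CT (shift p) w)%C.
Proof.
  intros Hw Hp. assert (HPI := PI_RGT_0).
  assert (H0 : Cmod 0 <= 1/2) by (rewrite Cmod_0; lra).
  unfold CT.
  assert (C1 : conton (fun t => w * (shift p t / (cis t - w)))%C 0 (2 * PI)).
  { apply conton_mult; [apply conton_const|]. apply conton_CT; auto. now apply shift_cont. }
  rewrite <- CI_scal by (try lra; apply conton_CT; auto; now apply shift_cont).
  rewrite <- CI_plus by (auto; try lra; now apply conton_CT).
  apply CI_ext; [lra|]. intros t _. unfold shift.
  assert (N1 := cis_sub_neq0 t w Hw). assert (N2 := cis_neq0 t).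
  field. repeat split; auto.
Qed.

Lemma shifts_cont p n a b : conton p a b -> conton (shifts p n) a b.
Proof. intros Hp. induction n; simpl; auto. now apply shift_cont. Qed.

Lemma shifts_Cmod p n t : Cmod (shifts p n t) = Cmod (p t).
Proof.
  induction n; simpl; auto. unfold shift.
  rewrite Cmod_div, Cmod_cis, IHn by apply cis_neq0. field.
Qed.

Lemma CT_shifts p n w : Cmod w <= 1/2 -> conton p 0 (2 * PI) ->
  (forall k, (k < n)%nat -> CT (shifts p k) 0 = 0) ->
  CT p w = (w ^ n * CT (shifts p n) w)%C.
Proof.
  intros Hw Hp. induction n; intros H.
  - simpl. ring.
  - rewrite IHn by (intros; apply H; lia).
    rewrite (CT_shift (shifts p n)) by (auto; now apply shifts_cont).
    rewrite H by lia. simpl. ring.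
Qed.

Lemma least_counterexample (P : nat -> Prop) :
  (forall n, P n) \/ exists n, ~ P n /\ forall k, (k < n)%nat -> P k.
Proof.
  destruct (classic (forall n, P n)) as [H|H]; auto. right.
  assert (H' : exists n, ~ P n).
  { destruct (classic (exists n, ~ P n)) as [E|E]; auto.
    exfalso. apply H. intros n.
    destruct (classic (P n)); auto. exfalso; eauto. }
  destruct H' as [n Hn]. revert Hn. induction n as [n IH] using (well_founded_induction Wf_nat.lt_wf).
  intros Hn. destruct (classic (forall k, (k < n)%nat -> P k)) as [E|E]; eauto.
  assert (E' : exists k, (k < n)%nat /\ ~ P k).
  { destruct (classic (exists k, (k < n)%nat /\ ~ P k)) as [F|F]; auto.
    exfalso. apply E. intros k Hk.
    destruct (classic (P k)); auto. exfalso; eauto. }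
  destruct E' as [k [Hk1 Hk2]]. eauto.
Qed.

(** The first nonzero Taylor coefficient decides. If there is none, [|f|] is bounded by [2 ^ (- N)]
    times a constant for every [N]. If it has index [n], then [f] is [u ^ n] times a Cauchy
    transform that does not vanish near 0. *)
Lemma isolated_zeros f c r : 0 < r -> holB f c r ->
  (forall z, Cmod (z - c) < r/4 -> f z = 0) \/
  exists s, 0 < s /\ forall z, 0 < Cmod (z - c) < s -> f z <> 0.
Proof.
  intros Hr Hf. assert (HPI := PI_RGT_0).
  set (p := cdata f c r). assert (Cp : conton p 0 (2 * PI)) by now apply cdata_cont.
  destruct (least_counterexample (fun n => CT (shifts p n) 0 = 0)) as [H|[n [Hn H]]].
  - left. intros z Hz. destruct (unscale c r z Hr Hz) as [u [Hu [-> _]]].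
    rewrite cauchy_scaled by (auto; lra). fold p.
    destruct (conton_bounded p 0 (2 * PI) ltac:(lra) Cp) as [M [HM0 HM]].
    apply zero_of_Cmod_small. intros e He.
    destruct (pow_lt_1_zero (/2)) with (y := e / (8 * PI * M)) as [N HN].
    { rewrite Rabs_pos_eq; lra. }
    { apply Rdiv_lt_0_compat; auto. nra. }
    specialize (HN N (le_n N)). rewrite Rabs_pos_eq in HN by (apply pow_le; lra).
    rewrite (CT_shifts p N) by (auto; lra). rewrite Cmod_mult, Cmod_pow.
    assert (Cmod (CT (shifts p N) u) <= 8 * PI * M).
    { apply CT_bound; [lra|now apply shifts_cont|]. intros t Ht. rewrite shifts_Cmod; auto. }
    apply Rle_trans with ((/2)^N * (8 * PI * M)).
    + apply Rmult_le_compat; auto; try apply Cmod_ge_0.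
      * apply pow_le, Cmod_ge_0.
      * apply pow_incr. split; [apply Cmod_ge_0|lra].
    + replace e with (e / (8 * PI * M) * (8 * PI * M)) at 1 by (field; split; lra).
      apply Rmult_le_compat_r; [nra|]. lra.
  - right. assert (Cn : cont idC (CT (shifts p n)) 0).
    { eapply diff_cont. apply CT_diff; [rewrite Cmod_0; lra|]. now apply shifts_cont. }
    destruct (cont_neq0 _ _ _ Cn Hn) as [d [Hd D]].
    exists (Rmin (r/4) (r/2 * d)). split; [apply Rmin_glb_lt; nra|].
    intros z [Hz0 Hz]. apply Rmin_case_lt in Hz as [H1 H2].
    destruct (unscale c r z Hr H1) as [u [Hu [-> E]]].
    rewrite cauchy_scaled by (auto; lra). fold p.
    rewrite (CT_shifts p n) by (auto; lra).
    assert (Hu0 : 0 < Cmod u) by nra.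
    apply Cmult_neq_0.
    + apply Cmod_gt_0. rewrite Cmod_pow. now apply pow_lt.
    + apply Cmod_gt_0. specialize (D u). unfold idC in D.
      replace (u - 0)%C with u in D by ring.
      assert (Cmod u < d) by nra. specialize (D H0).
      generalize (Cmod_ge_0 (CT (shifts p n) 0)). lra.
Qed.

(** Without a zero of [u n] near [c] the inverse [1 / u n] is holomorphic there and bounded on a
    small circle, on which [v] is bounded away from 0. [center_bound] then bounds [1 / u n] at the
    centre, although [u n c] tends to [v c = 0]. *)
Lemma hurwitz u v c r : 0 < r -> ucv u v c r ->
  (exists N, forall n, (N <= n)%nat -> holB (u n) c r) -> v c = 0 ->
  (exists s, 0 < s /\ forall z, 0 < Cmod (z - c) < s -> v z <> 0) ->
  forall s, 0 < s -> exists N, forall n, (N <= n)%nat ->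
    exists z, Cmod (z - c) < s /\ Cmod (z - c) < r /\ u n z = 0.
Proof.
  intros Hr Hc Hu Hv0 [s0 [Hs0 Hiso]] s1 Hs1. assert (HPI := PI_RGT_0).
  assert (Hv := weierstrass u v c r Hc Hu).
  set (s := Rmin s1 (Rmin s0 r)).
  assert (Hs : 0 < s) by (unfold s; repeat apply Rmin_glb_lt; auto).
  assert (L1 : s <= s1) by apply Rmin_l.
  assert (L2 : s <= s0) by (eapply Rle_trans; [apply Rmin_r|apply Rmin_l]).
  assert (L3 : s <= r) by (eapply Rle_trans; [apply Rmin_r|apply Rmin_r]).
  assert (Hvs : holB v c s) by (apply (holB_sub v c r); auto; rewrite Cmod_sub_diag; lra).
  assert (Nz : forall t, v (c + (s/2)%R * cis t)%C <> 0).
  { intros t. apply Hiso. rewrite Cmod_scaled, Cmod_cis by auto. lra. }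
  destruct (conton_bounded (fun t => / v (c + (s/2)%R * cis t)%C)%C 0 (2 * PI)) as [M [HM0 HM]].
  { lra. }
  { intros t _. apply cont_inv; auto. now apply cont_circle. }
  assert (Hlow : forall t, 0 <= t <= 2 * PI -> / M <= Cmod (v (c + (s/2)%R * cis t)%C)).
  { intros t Ht. specialize (HM t Ht). rewrite Cmod_inv in HM by auto.
    assert (P := Nz t). apply Cmod_gt_0 in P.
    rewrite <- (Rinv_inv (Cmod (v _))). apply Rinv_le_contravar; auto.
    now apply Rinv_0_lt_compat. }
  assert (HiM : 0 < / M) by now apply Rinv_0_lt_compat.
  (* On the circle [|v| >= / M], so [|1 / u n| <= 2 M] there and at most [8 M] at the centre;
     [|u n c| < / M / 16] contradicts this by a factor 2. *)
  destruct (Hc (/ M / 16)) as [N1 HN1]; [lra|]. destruct Hu as [N2 HN2].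
  exists (N1 + N2)%nat. intros n Hn.
  destruct (classic (exists z, Cmod (z - c) < s /\ u n z = 0)) as [[z [H1 H2]]|H].
  { exists z. repeat split; auto; lra. }
  exfalso.
  assert (Hn0 : forall z, Cmod (z - c) < s -> u n z <> 0).
  { intros z Hz E. apply H. eauto. }
  assert (Hun : holB (u n) c r) by (apply HN2; lia).
  assert (Hg : holB (fun z => / u n z)%C c s).
  { intros z Hz. destruct (Hun z) as [l Hl]; [lra|]. eexists. apply diff_inv; eauto. }
  assert (B : Cmod (/ u n c)%C <= 4 * (2 * M)).
  { apply (center_bound (fun z => / u n z)%C c s); auto.
    - intros t Ht. specialize (Hlow t Ht).
      set (z := (c + (s/2)%R * cis t)%C) in *.
      assert (Hz : Cmod (z - c) < s) by (unfold z; rewrite Cmod_scaled, Cmod_cis; lra).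
      rewrite Cmod_inv by auto.
      assert (Hd : Cmod (u n z - v z) < / M / 16) by (apply HN1; [lia|lra]).
      assert (/ M / 2 <= Cmod (u n z)).
      { generalize (Cmod_le_add (v z) (u n z)). rewrite Cmod_minus_sym. lra. }
      replace (2 * M) with (/ (/ M / 2)) by (field; lra).
      apply Rinv_le_contravar; lra.
    - rewrite Cmod_sub_diag. lra. }
  assert (Hnc : u n c <> 0) by (apply Hn0; rewrite Cmod_sub_diag; auto).
  rewrite Cmod_inv in B by auto.
  assert (Hd : Cmod (u n c - v c) < / M / 16) by (apply HN1; [lia|rewrite Cmod_sub_diag; auto]).
  rewrite Hv0 in Hd. replace (u n c - 0)%C with (u n c) in Hd by ring.
  apply Cmod_gt_0 in Hnc.
  assert (8 * M * Cmod (u n c) >= 1).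
  { apply Rle_ge. replace 1 with (/ Cmod (u n c) * Cmod (u n c)) by (field; lra).
    apply Rmult_le_compat_r; lra. }
  assert (8 * M * Cmod (u n c) < 8 * M * (/ M / 16)) by (apply Rmult_lt_compat_l; lra).
  replace (8 * M * (/ M / 16)) with (1/2) in H1 by (field; lra). lra.
Qed.

Lemma cont_zero_limit (H : C -> C) (c : C) r : 0 < r -> cont idC H c ->
  (forall z, 0 < Cmod (z - c) < r -> H z = 0) -> H c = 0.
Proof.
  intros Hr Hc H0. apply zero_of_Cmod_small. intros e He.
  destruct (Hc e He) as [d [Hd D]].
  set (s := Rmin (d/2) (r/2)). assert (Hs : 0 < s) by (apply Rmin_glb_lt; lra).
  assert (s < d) by (generalize (Rmin_l (d/2) (r/2)); unfold s; lra).
  assert (s < r) by (generalize (Rmin_r (d/2) (r/2)); unfold s; lra).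
  specialize (D (c + s)%C). unfold idC in D.
  assert (E : Cmod (c + s - c) = s).
  { replace (c + s - c)%C with (RtoC s) by ring. apply Cmod_Rpos; lra. }
  rewrite E in D. rewrite H0 in D by (rewrite E; lra).
  replace (0 - H c)%C with (- H c)%C in D by ring. rewrite Cmod_opp in D. left; auto.
Qed.

(** The function [(z - c)^2 f z] is holomorphic at [c] too, with slope [(z - c) f z] there.
    Continuity of [f] makes its first two Taylor coefficients vanish; the remaining Cauchy
    transform, divided by [(r / 2)^2], is holomorphic and agrees with [f], at [c] by continuity. *)
Lemma removable f c r : 0 < r -> cont idC f c ->
  (forall z, 0 < Cmod (z - c) < r -> exists l, diff idC f z l) -> exists l, diff idC f c l.
Proof.
  intros Hr Hc Hf. assert (HPI := PI_RGT_0).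
  set (k := fun z => ((z - c) * (z - c) * f z)%C).
  assert (Csub : forall z, cont idC (fun z => z - c)%C z).
  { intros z. apply cont_minus; [apply cont_id|apply cont_const]. }
  assert (Hk : holB k c r).
  { intros z Hz. destruct (Req_dec (Cmod (z - c)) 0) as [E|E].
    - apply Cmod_sub_eq_0 in E. subst z. eexists.
      apply (diff_of_slope idC k (fun z => (z - c) * f z)%C c 1); [lra| |].
      + apply cont_mult; auto.
      + intros y _. unfold k, idC. ring.
    - destruct (Hf z) as [l Hl]; [generalize (Cmod_ge_0 (z - c)); lra|].
      assert (D : diff idC (fun z => z - c)%C z (1 - 0)%C)
        by (apply diff_minus; [apply diff_id|apply diff_const]).
      eexists. apply (diff_mult idC (fun z => (z - c) * (z - c))%C f); [|apply Hl].
      apply (diff_mult idC (fun z => z - c)%C (fun z => z - c)%C); apply D. }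
  set (p := cdata k c r). assert (Cp : conton p 0 (2 * PI)) by now apply cdata_cont.
  set (p1 := shift p). set (p2 := shift p1).
  assert (Cp1 : conton p1 0 (2 * PI)) by now apply shift_cont.
  assert (Cp2 : conton p2 0 (2 * PI)) by now apply shift_cont.
  set (F := fun u => f (c + (r/2)%R * u)%C).
  assert (CF : cont idC F 0).
  { unfold F. apply (cont_comp idC (fun u => c + (r/2)%R * u)%C f).
    - apply cont_plus; [apply cont_const|]. apply cont_mult; [apply cont_const|apply cont_id].
    - now replace (c + (r/2)%R * 0)%C with c by ring. }
  assert (Hr2 := half_neq0 r Hr).
  assert (E : forall u, Cmod u <= 1/2 ->
    ((r/2)%R * (r/2)%R * (u * u) * F u = CT p 0 + u * (CT p1 0 + u * CT p2 u))%C).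
  { intros u Hu. unfold p2. rewrite <- CT_shift by auto. unfold p1. rewrite <- CT_shift by auto.
    unfold p. rewrite <- cauchy_scaled by auto. unfold k, F. ring. }
  assert (Z0 : CT p 0 = 0).
  { specialize (E 0). rewrite Cmod_0 in E. specialize (E ltac:(lra)).
    replace (CT p 0) with (CT p 0 + 0 * (CT p1 0 + 0 * CT p2 0))%C by ring.
    rewrite <- E. ring. }
  rewrite Z0 in E.
  assert (C2 : cont idC (CT p2) 0).
  { eapply diff_cont, CT_diff; auto. rewrite Cmod_0; lra. }
  assert (Z1 : CT p1 0 = 0).
  { assert (Z : ((fun u => CT p1 0 + u * CT p2 u - (r/2)%R * (r/2)%R * (u * F u)) 0 = 0)%C).
    { apply (cont_zero_limit (fun u => CT p1 0 + u * CT p2 u - (r/2)%R * (r/2)%R * (u * F u))%C 0 (1/2)); [lra| |].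
      - apply cont_minus.
        + apply cont_plus; [apply cont_const|]. apply cont_mult; [apply cont_id|auto].
        + apply cont_mult; [apply cont_const|]. apply cont_mult; [apply cont_id|auto].
      - intros u Hu. replace (u - 0)%C with u in Hu by ring.
        specialize (E u ltac:(lra)). assert (Hu0 : u <> 0) by (apply Cmod_gt_0; lra).
        replace (CT p1 0 + u * CT p2 u - (r/2)%R * (r/2)%R * (u * F u))%C with
          ((0 + u * (CT p1 0 + u * CT p2 u) - (r/2)%R * (r/2)%R * (u * u) * F u) / u)%C
          by (field; auto).
        rewrite E. unfold Cdiv. ring. }
    cbv beta in Z. eapply eq_trans; [|exact Z]. ring. }
  rewrite Z1 in E.
  assert (E2 : forall u, 0 < Cmod u < 1/2 -> (F u = CT p2 u / ((r/2)%R * (r/2)%R))%C).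
  { intros u Hu. specialize (E u ltac:(lra)). assert (Hu0 : u <> 0) by (apply Cmod_gt_0; lra).
    replace (F u) with ((r/2)%R * (r/2)%R * (u * u) * F u / ((r/2)%R * (r/2)%R * (u * u)))%C
      by (field; auto).
    rewrite E. field. auto. }
  assert (Z2 : ((fun u => F u - CT p2 u / ((r/2)%R * (r/2)%R)) 0 = 0)%C).
  { apply (cont_zero_limit (fun u => F u - CT p2 u / ((r/2)%R * (r/2)%R))%C 0 (1/2)); [lra| |].
    - apply cont_minus; auto. apply cont_div; auto; [apply cont_const|now apply Cmult_neq_0].
    - intros u Hu. replace (u - 0)%C with u in Hu by ring. rewrite E2 by auto. ring. }
  cbv beta in Z2.
  assert (E3 : forall u, Cmod u < 1/2 -> (CT p2 u / ((r/2)%R * (r/2)%R) = F u)%C).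
  { intros u Hu. destruct (Req_dec (Cmod u) 0) as [N|N].
    - apply Cmod_eq_0 in N. subst u.
      symmetry. apply Cmod_sub_eq_0. rewrite Z2. apply Cmod_0.
    - symmetry. apply E2. generalize (Cmod_ge_0 u). lra. }
  assert (D2 : diff idC (CT p2) 0 (CTd p2 0)) by (apply CT_diff; auto; rewrite Cmod_0; lra).
  eexists. replace c with (c + (r/2)%R * 0)%C at 1 by ring.
  apply diff_affine_inv; auto.
  apply (diff_ext_loc _ (fun u => / ((r/2)%R * (r/2)%R) * CT p2 u)%C _ _ _ (1/2)); [lra| |].
  - intros y Hy. unfold idC in Hy. replace (y - 0)%C with y in Hy by ring.
    eapply eq_trans; [|apply (E3 y Hy)]. unfold Cdiv. ring.
  - apply diff_scal, D2.
Qed.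

(** * Entire functions and logarithms *)

Definition entire (f : C -> C) : Prop := forall z, exists l, diff idC f z l.

Lemma entire_holB f c r : entire f -> holB f c r.
Proof. intros H z _. apply H. Qed.

Lemma liouville f M : entire f -> (forall z, Cmod (f z) <= M) -> forall z w, f z = f w.
Proof.
  intros Hf HM z w.
  assert (HM0 : 0 <= M) by (eapply Rle_trans; [apply Cmod_ge_0|apply (HM 0)]).
  apply eq_of_Cmod_small. intros e He.
  set (d := Cmod (z - w)). assert (Hd : 0 <= d) by apply Cmod_ge_0.
  (* The first two terms put [z] in the quarter disc about [w]; the last makes the Lipschitz bound
     [48 * M / r * d] at most [e]. *)
  set (r := 4 * d + 4 + 48 * M * d / e).
  assert (Hq : 0 <= 48 * M * d / e).
  { apply Rmult_le_pos; [nra|]. left. now apply Rinv_0_lt_compat. }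
  assert (Hr : 0 < r) by (unfold r; lra).
  eapply Rle_trans; [apply (lip_bound f w r M)|]; auto.
  - now apply entire_holB.
  - rewrite Cmod_sub_diag. lra.
  - fold d. unfold r. lra.
  - fold d. replace (48 * M / r * d) with (48 * M * d / r) by (field; lra).
    apply Rmult_le_reg_r with r; auto. unfold Rdiv at 1. rewrite Rmult_assoc, Rinv_l by lra.
    assert (48 * M * d / e * e = 48 * M * d) by (field; lra). unfold r. nra.
Qed.

Lemma zero_derivative_ball f c r : (forall z, Cmod (z - c) < r -> diff idC f z 0) ->
  forall z, Cmod (z - c) < r -> f z = f c.
Proof.
  intros Hf z Hz. apply Cmod_sub_eq_0.
  assert (E := CI_derive (fun t => f (c + t * (z - c))%C) (fun _ => RtoC 0) 0 1 ltac:(lra)).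
  transitivity (Cmod 0); [f_equal|apply Cmod_0].
  replace (f z - f c)%C with (f (c + 1 * (z - c))%C - f (c + 0 * (z - c))%C)%C
    by (f_equal; [|f_equal]; f_equal; ring).
  rewrite <- E.
  - rewrite CI_const by lra. ring.
  - intros t Ht. apply (diff_eq _ _ _ (0 * (0 + (t * 0 + 1 * (z - c))))%C); [ring|].
    apply (diff_comp RtoC (fun t : R => c + t * (z - c))%C f).
    + apply diff_plus; [apply diff_const|].
      apply (diff_mult RtoC RtoC (fun _ => (z - c)%C)); [apply diff_id|apply diff_const].
    + apply Hf. replace (c + t * (z - c) - c)%C with (t * (z - c))%C by ring.
      rewrite Cmod_mult, Cmod_Rpos by lra. generalize (Cmod_ge_0 (z - c)). nra.
  - apply conton_const.
Qed.

Lemma zero_derivative_constant f : (forall z, diff idC f z 0) -> forall z w, f z = f w.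
Proof.
  intros Hf z w. apply (zero_derivative_ball f w (Cmod (z - w) + 1)); auto. lra.
Qed.

Definition Cexp (z : C) : C := (exp (fst z) * cis (snd z))%C.

Lemma cis_plus s t : cis (s + t) = (cis s * cis t)%C.
Proof. unfold cis, Cmult; simpl. rewrite cos_plus, sin_plus. f_equal; ring. Qed.

Lemma Cexp_plus z w : Cexp (z + w) = (Cexp z * Cexp w)%C.
Proof. unfold Cexp. simpl. rewrite exp_plus, cis_plus, RtoC_mult. ring. Qed.

Lemma Cexp_0 : Cexp 0 = RtoC 1.
Proof. unfold Cexp; simpl. rewrite exp_0, cis_0. ring. Qed.

Lemma Cexp_neq0 z : Cexp z <> 0.
Proof.
  unfold Cexp. apply Cmult_neq_0; [|apply cis_neq0].
  intros H. apply RtoC_inj in H. generalize (exp_pos (fst z)). lra.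
Qed.

(** At 0 the increment is split into those of [exp] and [cis] and their product, which is of second
    order; the functional equation carries the derivative to [z]. *)
Lemma Cexp_diff z : diff idC Cexp z (Cexp z).
Proof.
  assert (D0 : diff idC Cexp 0 1).
  { intros e He.
    set (e' := Rmin 1 (e/16)). assert (He' : 0 < e') by (apply Rmin_glb_lt; lra).
    assert (He1 : e' <= e/16) by apply Rmin_r.
    assert (DE : diff RtoC (fun t => (exp t, 0) : C) 0 (exp 0, 0)).
    { apply (diff_pair exp (fun _ => 0)); auto_derive; auto; ring. }
    destruct (DE e' He') as [d1 [Hd1 D1]].
    destruct (diff_cont _ _ _ _ DE e' He') as [d2 [Hd2 D2]].
    destruct (diff_cis 0 e' He') as [d3 [Hd3 D3]].
    exists (Rmin d1 (Rmin d2 d3)). split; [repeat apply Rmin_glb_lt; auto|].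
    unfold idC. intros y Hy. rewrite Cexp_0. replace (y - 0)%C with y in * by ring.
    apply Rmin_case_lt in Hy as [Hy1 Hy2]. apply Rmin_case_lt in Hy2 as [Hy2 Hy3]. destruct y as [a b].
    assert (Ha : Rabs a <= Cmod (a, b)) by apply (Rabs_fst_le (a, b)).
    assert (Hb : Rabs b <= Cmod (a, b)) by apply (Rabs_snd_le (a, b)).
    assert (Qa : Cmod (RtoC a - RtoC 0) = Rabs a) by (rewrite <- RtoC_minus, Cmod_R; f_equal; ring).
    assert (Qb : Cmod (RtoC b - RtoC 0) = Rabs b) by (rewrite <- RtoC_minus, Cmod_R; f_equal; ring).
    specialize (D1 a). specialize (D2 a). specialize (D3 b). rewrite Qa in D1, D2. rewrite Qb in D3.
    specialize (D1 ltac:(lra)). specialize (D2 ltac:(lra)). specialize (D3 ltac:(lra)).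
    rewrite exp_0, cis_0 in *.
    assert (X : forall x : R, ((x, 0) : C) = RtoC x) by reflexivity. rewrite !X in *.
    assert (L := cis_lip b 0). rewrite cis_0, Rminus_0_r in L.
    replace (Cexp (a, b) - 1 - 1 * (a, b))%C with
      ((exp a - 1 - 1 * (a - 0)) + (cis b - 1 - Ci * 1 * (b - 0)) + (exp a - 1) * (cis b - 1))%C.
    2:{ unfold Cexp; cbn [fst snd].
        replace ((a, b) : C) with (a + Ci * b)%C
          by (unfold Ci, Cplus, Cmult, RtoC; simpl; f_equal; ring). ring. }
    eapply Rle_trans; [apply Cmod_triangle|].
    eapply Rle_trans; [apply Rplus_le_compat_r, Cmod_triangle|].
    rewrite Cmod_mult.
    assert (Cmod (exp a - 1) * Cmod (cis b - 1) <= e' * (4 * Rabs b)).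
    { apply Rmult_le_compat; try apply Cmod_ge_0; auto. left; auto. }
    assert (0 <= Cmod (a, b)) by apply Cmod_ge_0.
    assert (e' * Rabs a <= e/16 * Cmod (a, b)) by (apply Rmult_le_compat; auto; try lra; apply Rabs_pos).
    assert (e' * Rabs b <= e/16 * Cmod (a, b)) by (apply Rmult_le_compat; auto; try lra; apply Rabs_pos).
    nra. }
  apply (diff_ext _ (fun y => Cexp z * Cexp (y - z))%C).
  { intros y. rewrite <- Cexp_plus. f_equal. ring. }
  apply (diff_eq _ _ _ (Cexp z * (1 * (1 - 0)))%C); [ring|].
  apply diff_scal. apply (diff_comp idC (fun y => y - z)%C Cexp).
  - apply diff_minus; [apply diff_id|apply diff_const].
  - now replace (z - z)%C with (RtoC 0) by ring.
Qed.

Lemma unit_cis (c : C) : Cmod c = 1 -> exists t, c = cis t.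
Proof.
  destruct c as [x y]. intros H.
  assert (H2 : x * x + y * y = 1).
  { assert (E := Cmod2_alt (x, y)). rewrite H in E. unfold Re, Im in E; simpl in E. lra. }
  assert (Hx : -1 <= x <= 1) by nra.
  assert (Hs : sqrt (1 - Rsqr x) = Rabs y).
  { rewrite <- sqrt_Rsqr_abs. f_equal. unfold Rsqr. lra. }
  destruct (Rle_dec 0 y) as [Hy|Hy].
  - exists (acos x). unfold cis. rewrite cos_acos, sin_acos, Hs, Rabs_pos_eq by auto. auto.
  - exists (- acos x). unfold cis. rewrite cos_neg, sin_neg, cos_acos, sin_acos, Hs by auto.
    rewrite Rabs_left1 by lra. f_equal. ring.
Qed.

Lemma Cexp_surj (c : C) : c <> 0 -> exists g, Cexp g = c.
Proof.
  intros Hc. assert (Hm : 0 < Cmod c) by now apply Cmod_gt_0.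
  assert (Hm0 : RtoC (Cmod c) <> 0) by (intros E; apply RtoC_inj in E; lra).
  destruct (unit_cis (c / Cmod c)%C) as [t Ht].
  { rewrite Cmod_div, Cmod_Rpos by (auto; lra). field. lra. }
  exists (ln (Cmod c), t). unfold Cexp; cbn [fst snd]. rewrite exp_ln, <- Ht by auto.
  field. auto.
Qed.

(** The primitive is the integral of [f] along the segment from 0. Differentiating [z * f (t * z)]
    in [z] gives [q t], which is also the derivative of [t * f (t * z)] in [t], so [q] integrates to
    [f z]. Taylor's bound makes the error quadratic. *)
Lemma primitive_exists f : entire f -> exists F, forall z, diff idC F z (f z).
Proof.
  intros Hf. exists (fun z => CI (fun t => z * f (t * z))%C 0 1). intros z.
  assert (Cf : forall w, cont idC f w) by (intros w; destruct (Hf w) as [l Hl]; eapply diff_cont; eauto).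
  assert (Hf' : entire (der f)).
  { intros w. apply (der_hol f w 1); [now apply entire_holB|]. rewrite Cmod_sub_diag; lra. }
  assert (Cf' : forall w, cont idC (der f) w)
    by (intros w; destruct (Hf' w) as [l Hl]; eapply diff_cont; eauto).
  (* Both segments, to [z] and to any [z'] within 1 of it, lie in the disc of radius [r / 4]. *)
  set (r := 4 * (Cmod z + 1)). assert (Hz0 := Cmod_ge_0 z).
  assert (Hr : 0 < r) by (unfold r; lra).
  destruct (holB_bounded f 0 (4 * r)) as [M [HM0 HM]]; [lra|now apply entire_holB|].
  assert (HM' : forall y, Cmod (y - 0) < r -> Cmod (f y) <= M) by (intros y Hy; apply HM; lra).
  assert (Dt : forall (y : C) t, diff RtoC (fun t : R => t * y)%C t y).
  { intros y t. apply (diff_eq _ _ _ (t * 0 + 1 * y)%C); [ring|].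
    apply (diff_mult RtoC RtoC (fun _ => y)); [apply diff_id|apply diff_const]. }
  assert (Cy : forall y, conton (fun t => y * f (t * y))%C 0 1).
  { intros y t _. apply cont_mult; [apply cont_const|].
    apply (cont_comp _ (fun t : R => t * y)%C f); auto. eapply diff_cont, Dt. }
  set (q := fun t : R => (t * (der f (t * z) * z) + 1 * f (t * z))%C).
  assert (Cq : conton q 0 1).
  { intros t _. unfold q. apply cont_plus.
    - apply cont_mult; [apply cont_id|]. apply cont_mult; [|apply cont_const].
      apply (cont_comp _ (fun t : R => t * z)%C (der f)); auto. eapply diff_cont, Dt.
    - apply cont_mult; [apply cont_const|].
      apply (cont_comp _ (fun t : R => t * z)%C f); auto. eapply diff_cont, Dt. }
  assert (Eq : CI q 0 1 = f z).
  { rewrite (CI_derive (fun t => t * f (t * z))%C); auto; try lra.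
    - replace (1 * z)%C with z by ring. ring.
    - intros t _. unfold q. apply (diff_mult RtoC RtoC (fun t => f (t * z)%C)); [apply diff_id|].
      apply (diff_comp RtoC (fun t : R => t * z)%C f); [apply Dt|]. now apply der_spec. }
  set (K := (Cmod z + 1) * (64 * M / (r * r)) + 16 * M / r).
  assert (HK1 : 0 <= 64 * M / (r * r)).
  { apply Rmult_le_pos; [lra|]. left. apply Rinv_0_lt_compat. nra. }
  assert (HK2 : 0 <= 16 * M / r).
  { apply Rmult_le_pos; [lra|]. left. now apply Rinv_0_lt_compat. }
  apply (quadratic_diff _ _ _ (2 * K) 1); [lra|unfold K; nra|].
  intros z' Hz'. set (d := (z' - z)%C) in *.
  assert (Hzz : Cmod z' < Cmod z + 1) by (generalize (Cmod_le_add z' z); fold d; lra).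
  rewrite <- Eq, Cmult_comm.
  rewrite <- CI_scal by (auto; lra).
  assert (C3 : conton (fun t => d * q t)%C 0 1) by (apply conton_mult; auto; apply conton_const).
  rewrite <- !CI_minus by (auto; try lra; now apply conton_minus).
  replace (2 * K * (Cmod d * Cmod d)) with (2 * (1 - 0) * (K * (Cmod d * Cmod d))) by ring.
  apply CI_bound; [lra|apply conton_minus; auto; now apply conton_minus|].
  intros t Ht. unfold q.
  replace (z' * f (t * z') - z * f (t * z) - d * (t * (der f (t * z) * z) + 1 * f (t * z)))%C
    with (z' * (f (t * z') - f (t * z) - der f (t * z) * (t * z' - t * z))
          + (d * d) * (t * der f (t * z)))%C by (unfold d; ring).
  assert (T1 : Cmod (t * z - 0) < r / 4).
  { replace (t * z - 0)%C with (t * z)%C by ring. rewrite Cmod_mult, Cmod_Rpos by lra.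
    unfold r. nra. }
  assert (T2 : Cmod (t * z' - 0) < r / 4).
  { replace (t * z' - 0)%C with (t * z')%C by ring. rewrite Cmod_mult, Cmod_Rpos by lra.
    generalize (Cmod_ge_0 z'). unfold r. nra. }
  assert (A1 := taylor_bound f 0 r M _ _ Hr (entire_holB f 0 r Hf) HM' T1 T2).
  assert (A2 := der_bound f 0 r M _ Hr (entire_holB f 0 r Hf) HM' T1).
  replace (t * z' - t * z)%C with (t * d)%C in * by (unfold d; ring).
  rewrite Cmod_mult, (Cmod_Rpos t) in A1 by lra.
  eapply Rle_trans; [apply Cmod_triangle|]. rewrite !Cmod_mult, (Cmod_Rpos t) by lra.
  assert (Hd0 := Cmod_ge_0 d). set (dd := Cmod d * Cmod d) in *.
  assert (Hdd : 0 <= dd) by (unfold dd; nra).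
  assert (B1 : t * Cmod d * (t * Cmod d) <= dd) by (unfold dd; apply Rmult_le_compat; nra).
  assert (B2 : 64 * M / (r * r) * (t * Cmod d * (t * Cmod d)) <= 64 * M / (r * r) * dd)
    by (apply Rmult_le_compat_l; auto).
  unfold K. rewrite Rmult_plus_distr_r. apply Rplus_le_compat.
  - rewrite Rmult_assoc. apply Rmult_le_compat; try apply Cmod_ge_0; lra.
  - rewrite (Rmult_comm _ dd). apply Rmult_le_compat_l; auto.
    assert (0 <= Cmod (der f (t * z))) by apply Cmod_ge_0. nra.
Qed.

(** With [F] a primitive of [G' / G], the quotient of [G] by [Cexp] of [F] has derivative 0; the
    constant is itself an exponential and is added to [F]. *)
Lemma entire_log G : entire G -> (forall z, G z <> 0) ->
  exists p, entire p /\ forall z, G z = Cexp (p z).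
Proof.
  intros HG H0.
  assert (HG' : entire (der G)).
  { intros w. apply (der_hol G w 1); [now apply entire_holB|]. rewrite Cmod_sub_diag; lra. }
  destruct (primitive_exists (fun z => der G z / G z)%C) as [F HF].
  { intros z. destruct (HG z) as [l Hl]. destruct (HG' z) as [m Hm].
    eexists. apply diff_div; eauto. }
  assert (Hc : forall z w, (G z / Cexp (F z) = G w / Cexp (F w))%C).
  { apply (zero_derivative_constant (fun z => G z / Cexp (F z))%C). intros z.
    assert (D1 := der_spec G z (HG z)).
    assert (D2 := diff_comp idC F Cexp z _ _ (HF z) (Cexp_diff (F z))).
    assert (D3 := diff_div _ _ _ _ _ _ D1 D2 (Cexp_neq0 _)).
    eapply diff_eq; [|apply D3]. simpl. field. split; [apply H0|apply Cexp_neq0]. }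
  destruct (Cexp_surj (G 0 / Cexp (F 0))%C) as [g Hg].
  { apply Cmult_neq_0; auto. intros E.
    apply (Cmult_neq_0 (Cexp (F 0)) (/ Cexp (F 0))%C (Cexp_neq0 _)).
    - intros E'. assert (Cexp (F 0) * / Cexp (F 0) = 1)%C by (apply Cinv_r, Cexp_neq0).
      rewrite E' in H. replace (Cexp (F 0) * 0)%C with (RtoC 0) in H by ring.
      apply RtoC_inj in H. lra.
    - rewrite E. ring. }
  exists (fun z => g + F z)%C. split.
  - intros z. eexists. apply diff_plus; [apply diff_const|apply HF].
  - intros z. rewrite Cexp_plus, Hg, (Hc 0 z). field. apply Cexp_neq0.
Qed.

(** * Compactness of bounded holomorphic functions *)

Definition sincr (phi : nat -> nat) : Prop := forall n, (phi n < phi (S n))%nat.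

Lemma sincr_lt phi n m : sincr phi -> (n < m)%nat -> (phi n < phi m)%nat.
Proof. intros H Hnm. induction Hnm; [apply H|]. specialize (H m). lia. Qed.

Lemma sincr_ge phi n : sincr phi -> (n <= phi n)%nat.
Proof. intros H. induction n; [lia|]. specialize (H n). lia. Qed.

Lemma sincr_comp phi psi : sincr phi -> sincr psi -> sincr (fun n => phi (psi n)).
Proof. intros H1 H2 n. apply sincr_lt; auto. Qed.

Lemma extract (P : nat -> nat -> Prop) :
  (forall k N, exists p, (N <= p)%nat /\ P k p) ->
  exists phi, sincr phi /\ forall k, P k (phi k).
Proof.
  intros H.
  pose (F := fun k N => proj1_sig (constructive_indefinite_description _ (H k N))).
  assert (HF : forall k N, (N <= F k N)%nat /\ P k (F k N)).
  { intros k N. unfold F. now destruct (constructive_indefinite_description _ (H k N)). }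
  exists (fix phi k := match k with O => F O O | S k => F (S k) (S (phi k)) end).
  split.
  - intros n. apply (HF (S n) (S _)).
  - intros [|k]; apply HF.
Qed.

(** An eventual subsequence; [n <= psi n] in place of monotonicity is enough to carry limits
    over. *)
Definition subseq_of (phi' phi : nat -> nat) : Prop :=
  exists N psi, forall n, (N <= n)%nat -> phi' n = phi (psi n) /\ (n <= psi n)%nat.

(** [Phi (S k)] refines [Phi k] so that [Q k] holds, and the result is [Phi n n]. It is drawn from
    [Phi (S k)] only from the index [S k] on, whence the stability of [Q k] under [subseq_of]. *)
Lemma diagonal (Q : nat -> (nat -> nat) -> Prop) :
  (forall k phi, sincr phi -> exists psi, sincr psi /\ Q k (fun n => phi (psi n))) ->
  (forall k phi phi', subseq_of phi' phi -> Q k phi -> Q k phi') ->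
  exists phi, sincr phi /\ forall k, Q k phi.
Proof.
  intros Hex Hsub.
  assert (Hex' : forall k phi, exists psi, sincr psi /\ (sincr phi -> Q k (fun n => phi (psi n)))).
  { intros k phi. destruct (excluded_middle_informative (sincr phi)) as [H|H].
    - destruct (Hex k phi H) as [psi [H1 H2]]. eauto.
    - exists (fun n => n). split; [intros n; lia|tauto]. }
  pose (F := fun k phi => proj1_sig (constructive_indefinite_description _ (Hex' k phi))).
  assert (HF : forall k phi, sincr (F k phi) /\ (sincr phi -> Q k (fun n => phi (F k phi n)))).
  { intros k phi. unfold F. now destruct (constructive_indefinite_description _ (Hex' k phi)). }
  pose (Phi := fix Phi k : nat -> nat := match k with
      | O => fun n => n | S k => fun n => Phi k (F k (Phi k) n) end).
  assert (HPhi : forall k, sincr (Phi k)).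
  { induction k; [intros n; simpl; lia|]. simpl. apply sincr_comp; auto. apply HF. }
  assert (HQ : forall k, Q k (Phi (S k))).
  { intros k. apply (HF k (Phi k)). apply HPhi. }
  exists (fun n => Phi n n). split.
  - intros n. simpl. apply sincr_lt; auto.
    generalize (sincr_ge (F n (Phi n)) (S n)). destruct (HF n (Phi n)). intuition lia.
  - intros k. apply (Hsub k (Phi (S k))); auto.
    assert (HT : forall m, exists T, sincr T /\ forall n, Phi (m + S k)%nat n = Phi (S k) (T n)).
    { induction m as [|m [T [HT1 HT2]]].
      - exists (fun n => n). split; [intros n; lia|auto].
      - exists (fun n => T (F (m + S k)%nat (Phi (m + S k)%nat) n)). split.
        + apply sincr_comp; auto. apply HF.
        + intros n. simpl. apply HT2. }
    destruct (choice _ HT) as [T HT'].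
    exists (S k), (fun n => T (n - S k)%nat n). intros n Hn.
    destruct (HT' (n - S k)%nat) as [H1 H2]. rewrite <- H2.
    replace (n - S k + S k)%nat with n by lia. split; auto. now apply sincr_ge.
Qed.

Definition ccv (u : nat -> C) (l : C) : Prop :=
  forall e, 0 < e -> exists N, forall n, (N <= n)%nat -> Cmod (u n - l) < e.

Definition ccauchy (u : nat -> C) : Prop :=
  forall e, 0 < e -> exists N, forall n m, (N <= n)%nat -> (N <= m)%nat -> Cmod (u n - u m) < e.

Lemma ccauchy_ccv u : ccauchy u -> exists l, ccv u l.
Proof.
  intros H.
  assert (K : forall pr : C -> R, (forall z, Rabs (pr z) <= Cmod z) ->
    (forall z w, pr (z - w)%C = pr z - pr w) -> exists l, Un_cv (fun n => pr (u n)) l).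
  { intros pr Hb Hm. destruct (Rcomplete.R_complete (fun n => pr (u n))) as [l Hl]; [|eauto].
    intros e He. destruct (H e He) as [N HN]. exists N. intros n m Hn Hm'.
    unfold R_dist. rewrite <- Hm. eapply Rle_lt_trans; [apply Hb|]. apply HN; auto. }
  destruct (K fst) as [a Ha]; [apply Rabs_fst_le|reflexivity|].
  destruct (K snd) as [b Hb]; [apply Rabs_snd_le|reflexivity|].
  exists (a, b). intros e He.
  destruct (Ha (e/2)) as [N1 HN1]; [lra|]. destruct (Hb (e/2)) as [N2 HN2]; [lra|].
  exists (N1 + N2)%nat. intros n Hn.
  specialize (HN1 n ltac:(lia)). specialize (HN2 n ltac:(lia)). unfold R_dist in *.
  eapply Rle_lt_trans.
  - replace (u n - (a, b))%C with (fst (u n) - a, snd (u n) - b) by reflexivity.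
    apply Cmod_le_sum.
  - lra.
Qed.

Lemma ccv_ccauchy u l : ccv u l -> ccauchy u.
Proof.
  intros H e He. destruct (H (e/2)) as [N HN]; [lra|]. exists N. intros n m Hn Hm.
  generalize (Cmod_sub_triangle (u n) l (u m)) (HN n Hn) (HN m Hm).
  rewrite (Cmod_minus_sym l (u m)). lra.
Qed.

Lemma ccv_unique u l m : ccv u l -> ccv u m -> l = m.
Proof.
  intros Hl Hm. apply eq_of_Cmod_small. intros e He.
  destruct (Hl (e/2)) as [N1 HN1]; [lra|]. destruct (Hm (e/2)) as [N2 HN2]; [lra|].
  specialize (HN1 (N1 + N2)%nat ltac:(lia)). specialize (HN2 (N1 + N2)%nat ltac:(lia)).
  generalize (Cmod_sub_triangle l (u (N1 + N2)%nat) m).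
  rewrite (Cmod_minus_sym l (u (N1 + N2)%nat)). lra.
Qed.

Lemma ccv_subseq (u : nat -> C) (l : C) psi :
  ccv u l -> (forall n, (n <= psi n)%nat) -> ccv (fun n => u (psi n)) l.
Proof.
  intros H Hp e He. destruct (H e He) as [N HN]. exists N. intros n Hn.
  apply HN. specialize (Hp n). lia.
Qed.

Lemma real_bolzano_weierstrass (u : nat -> R) M : (forall n, Rabs (u n) <= M) ->
  exists phi l, sincr phi /\ Un_cv (fun n => u (phi n)) l.
Proof.
  intros HM.
  destruct (Bolzano_Weierstrass u (fun x => - M <= x <= M)) as [l Hl].
  - apply compact_P3.
  - intros n. specialize (HM n). apply Rabs_le_between in HM. lra.
  - destruct (extract (fun k p => Rabs (u p - l) < / (INR k + 1))) as [phi [H1 H2]].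
    + intros k N.
      assert (Hk : 0 < / (INR k + 1)) by (apply Rinv_0_lt_compat; generalize (pos_INR k); lra).
      destruct (Hl (fun x => Rabs (x - l) < / (INR k + 1)) N) as [p [Hp1 Hp2]].
      * exists (mkposreal _ Hk). intros x Hx. apply Hx.
      * eauto.
    + exists phi, l. split; auto. intros e He.
      destruct (archimed_cor1 e He) as [N [HN1 HN2]]. exists N. intros n Hn. unfold R_dist.
      eapply Rlt_trans; [apply H2|]. eapply Rle_lt_trans; [|apply HN1].
      apply Rinv_le_contravar; [apply lt_0_INR; lia|].
      apply le_INR in Hn. lra.
Qed.

Lemma bolzano_weierstrass (u : nat -> C) M : (forall n, Cmod (u n) <= M) ->
  exists phi l, sincr phi /\ ccv (fun n => u (phi n)) l.
Proof.
  intros HM.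
  destruct (real_bolzano_weierstrass (fun n => fst (u n)) M) as [p1 [a [H1 Ha]]].
  { intros n. eapply Rle_trans; [apply Rabs_fst_le|auto]. }
  destruct (real_bolzano_weierstrass (fun n => snd (u (p1 n))) M) as [p2 [b [H2 Hb]]].
  { intros n. eapply Rle_trans; [apply Rabs_snd_le|auto]. }
  exists (fun n => p1 (p2 n)), (a, b). split; [now apply sincr_comp|].
  intros e He.
  destruct (Ha (e/2)) as [N1 HN1]; [lra|]. destruct (Hb (e/2)) as [N2 HN2]; [lra|].
  exists (N1 + N2)%nat. intros n Hn.
  specialize (HN1 (p2 n)). specialize (HN2 n ltac:(lia)). unfold R_dist in *.
  assert (G := sincr_ge p2 n H2). specialize (HN1 ltac:(lia)).
  eapply Rle_lt_trans.
  - replace (u (p1 (p2 n)) - (a, b))%C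
      with (fst (u (p1 (p2 n))) - a, snd (u (p1 (p2 n))) - b) by reflexivity.
    apply Cmod_le_sum.
  - lra.
Qed.

(** Convergence of all Taylor coefficients of uniformly bounded Cauchy transforms
    gives uniform convergence: the tails are bounded by [2 ^ (- K)]. *)
Lemma CT_uniform_cauchy M K : forall p : nat -> R -> C,
  (forall n, conton (p n) 0 (2 * PI)) ->
  (forall n t, 0 <= t <= 2 * PI -> Cmod (p n t) <= M) ->
  (forall k, ccauchy (fun n => CT (shifts (p n) k) 0)) ->
  forall e, 0 < e -> exists N, forall n m, (N <= n)%nat -> (N <= m)%nat ->
    forall w, Cmod w <= 1/2 -> Cmod (CT (p n) w - CT (p m) w) <= e + (/2)^K * (16 * PI * M).
Proof.
  assert (HPI := PI_RGT_0).
  induction K; intros p Hc HM Hcau e He.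
  - exists O. intros n m _ _ w Hw. eapply Rle_trans; [apply Cmod_minus_le|].
    assert (A1 := CT_bound (p n) w M Hw (Hc n) (HM n)).
    assert (A2 := CT_bound (p m) w M Hw (Hc m) (HM m)). simpl. lra.
  - destruct (Hcau O (e/2)) as [N1 HN1]; [lra|].
    destruct (IHK (fun n => shift (p n))) with (e := e/2) as [N2 HN2].
    + intros n. now apply shift_cont.
    + intros n t Ht. unfold shift. rewrite Cmod_div, Cmod_cis by apply cis_neq0.
      specialize (HM n t Ht). lra.
    + intros k. assert (E : forall n, shifts (shift (p n)) k = shifts (p n) (S k)).
      { intros n. clear. induction k; simpl; auto. rewrite IHk. auto. }
      specialize (Hcau (S k)). intros e' He'. destruct (Hcau e' He') as [N HN]. exists N.
      intros n m. rewrite !E. apply HN.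
    + lra.
    + exists (N1 + N2)%nat. intros n m Hn Hm w Hw.
      rewrite (CT_shift (p n)), (CT_shift (p m)) by auto.
      specialize (HN1 n m ltac:(lia) ltac:(lia)). specialize (HN2 n m ltac:(lia) ltac:(lia) w Hw).
      simpl in HN1.
      replace (CT (p n) 0 + w * CT (shift (p n)) w - (CT (p m) 0 + w * CT (shift (p m)) w))%C
        with ((CT (p n) 0 - CT (p m) 0) + w * (CT (shift (p n)) w - CT (shift (p m)) w))%C by ring.
      eapply Rle_trans; [apply Cmod_triangle|]. rewrite Cmod_mult. simpl.
      assert (Cmod w * Cmod (CT (shift (p n)) w - CT (shift (p m)) w)
        <= 1/2 * (e/2 + (/2)^K * (16 * PI * M)))
        by (apply Rmult_le_compat; auto; apply Cmod_ge_0).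
      lra.
Qed.

(** Each Taylor coefficient is bounded in [n], so by Bolzano-Weierstrass and the diagonal argument
    all of them converge along one subsequence. [CT_uniform_cauchy] turns this into uniform
    convergence on the quarter disc. *)
Lemma montel (u : nat -> C -> C) c r M : 0 < r -> (forall n, holB (u n) c r) ->
  (forall n z, Cmod (z - c) < r -> Cmod (u n z) <= M) ->
  exists phi v, sincr phi /\ ucv (fun n => u (phi n)) v c (r/4).
Proof.
  intros Hr Hu HM. assert (HPI := PI_RGT_0).
  set (p := fun n => cdata (u n) c r).
  assert (Cp : forall n, conton (p n) 0 (2 * PI)) by (intros n; now apply cdata_cont).
  assert (Bp : forall n t, 0 <= t <= 2 * PI -> Cmod (p n t) <= M / (2 * PI)).
  { intros n t _. apply cdata_bound, HM. rewrite Cmod_scaled, Cmod_cis by auto. lra. }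
  destruct (diagonal (fun k phi => ccauchy (fun n => CT (shifts (p (phi n)) k) 0))) as [phi [H1 H2]].
  - intros k phi Hphi.
    destruct (bolzano_weierstrass (fun n => CT (shifts (p (phi n)) k) 0) (8 * PI * (M / (2 * PI))))
      as [psi [l [Hpsi Hl]]].
    { intros n. apply CT_bound; [rewrite Cmod_0; lra|now apply shifts_cont|].
      intros t Ht. rewrite shifts_Cmod. auto. }
    exists psi. split; auto. eapply ccv_ccauchy, Hl.
  - intros k phi phi' [N0 [psi Hs]] Hc e He. destruct (Hc e He) as [N HN].
    exists (N + N0)%nat. intros n m Hn Hm.
    destruct (Hs n ltac:(lia)) as [-> ?]. destruct (Hs m ltac:(lia)) as [-> ?].
    apply HN; lia.
  - assert (HC : forall e, 0 < e -> exists N, forall n m, (N <= n)%nat -> (N <= m)%nat ->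
        forall z, Cmod (z - c) < r/4 -> Cmod (u (phi n) z - u (phi m) z) <= e).
    { intros e He.
      assert (HM0 : 0 <= M).
      { eapply Rle_trans; [apply Cmod_ge_0|apply (HM O c)]. rewrite Cmod_sub_diag; lra. }
      destruct (pow_lt_1_zero (/2)) with (y := (e/2) / (8 * M + 1)) as [K HK].
      { rewrite Rabs_pos_eq; lra. }
      { apply Rdiv_lt_0_compat; lra. }
      specialize (HK K (le_n K)). rewrite Rabs_pos_eq in HK by (apply pow_le; lra).
      destruct (CT_uniform_cauchy (M / (2 * PI)) K (fun n => p (phi n))) with (e := e/2) as [N HN]; auto.
      { lra. }
      exists N. intros n m Hn Hm z Hz.
      destruct (unscale c r z Hr Hz) as [w [Hw [-> _]]].
      rewrite !cauchy_scaled by (auto; lra).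
      eapply Rle_trans; [apply HN; auto; lra|].
      replace (16 * PI * (M / (2 * PI))) with (8 * M) by (field; lra).
      assert ((/2)^K * (8 * M + 1) <= e/2).
      { replace (e/2) with (e/2/(8 * M + 1) * (8 * M + 1)) by (field; lra).
        apply Rmult_le_compat_r; lra. }
      assert (0 < (/2)^K) by (apply pow_lt; lra). lra. }
    assert (HL : forall z, exists l, Cmod (z - c) < r/4 -> ccv (fun n => u (phi n) z) l).
    { intros z. destruct (Rlt_dec (Cmod (z - c)) (r/4)) as [Hz|Hz]; [|exists (RtoC 0); tauto].
      destruct (ccauchy_ccv (fun n => u (phi n) z)) as [l Hl]; [|eauto].
      intros e He. destruct (HC (e/2)) as [N HN]; [lra|]. exists N. intros n m Hn Hm.
      specialize (HN n m Hn Hm z Hz). lra. }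
    destruct (choice _ HL) as [v Hv]. exists phi, v. split; auto.
    intros e He. destruct (HC (e/2)) as [N HN]; [lra|]. exists N. intros n Hn z Hz.
    destruct (Hv z Hz (e/2)) as [N2 HN2]; [lra|].
    specialize (HN n (N + N2)%nat Hn ltac:(lia) z Hz). specialize (HN2 (N + N2)%nat ltac:(lia)).
    generalize (Cmod_sub_triangle (u (phi n) z) (u (phi (N + N2)%nat) z) (v z)). lra.
Qed.

(** * Functions with values in the sphere *)

Definition sinv (p : sphere) : sphere :=
  match p with
  | Inf => Fin 0
  | Fin z => if excluded_middle_informative (z = 0) then Inf else Fin (/ z)%C
  end.

(** The 0 at [Inf] is a mere default; [val] is used together with the finiteness of its argument. *)
Definition val (p : sphere) : C := match p with Fin z => z | Inf => 0 end.

Lemma Cinv_neq0 (z : C) : z <> 0 -> (/ z)%C <> 0.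
Proof.
  intros H E. assert (K := Cinv_r z H). rewrite E in K.
  replace (z * 0)%C with (RtoC 0) in K by ring. apply RtoC_inj in K. lra.
Qed.

Lemma Cinv_inv (z : C) : z <> 0 -> (/ / z)%C = z.
Proof. intros H. field. auto. Qed.

Lemma sinv_Inf : sinv Inf = Fin 0. Proof. reflexivity. Qed.

Lemma sinv_0 : sinv (Fin 0) = Inf.
Proof. simpl. destruct (excluded_middle_informative _); tauto. Qed.

Lemma sinv_Fin (z : C) : z <> 0 -> sinv (Fin z) = Fin (/ z)%C.
Proof. intros H. simpl. destruct (excluded_middle_informative _); tauto. Qed.

Lemma sinv_invol p : sinv (sinv p) = p.
Proof.
  destruct p as [z|]; [|rewrite sinv_Inf; apply sinv_0].
  destruct (excluded_middle_informative (z = 0)) as [->|H].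
  - now rewrite sinv_0.
  - rewrite sinv_Fin, sinv_Fin by auto using Cinv_neq0. now rewrite Cinv_inv.
Qed.

Lemma Fin_val p : p <> Inf -> p = Fin (val p).
Proof. destruct p; tauto. Qed.

Lemma sinv_val p : p <> Inf -> val p <> 0 -> sinv p <> Inf /\ val (sinv p) = (/ val p)%C.
Proof.
  destruct p as [z|]; [|tauto]. intros _ H. simpl in H. rewrite sinv_Fin by auto.
  split; [discriminate|reflexivity].
Qed.

Lemma val_neq0 p : p <> Inf -> sinv p <> Inf -> val p <> 0.
Proof. destruct p as [z|]; [|tauto]. intros _ H E. simpl in E. subst z. now rewrite sinv_0 in H. Qed.

(** [f] is holomorphic near [z] as a map into the sphere, in one of the charts
    [w] and [1 / w]. *)
Definition schart (f : C -> sphere) (z : C) : Prop :=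
  exists r, 0 < r /\ exists u, holB u z r /\ forall y, Cmod (y - z) < r -> f y = Fin (u y).

(** Unlike [meromorphic_on], this admits a function identically [Inf] near [z], so the class is
    stable under [sinv] and under locally uniform limits. *)
Definition smero (f : C -> sphere) (z : C) : Prop :=
  schart f z \/ schart (fun y => sinv (f y)) z.

Lemma schart_ext f g z : (forall y, f y = g y) -> schart f z -> schart g z.
Proof.
  intros E [r [Hr [u [Hu Hf]]]]. exists r; split; auto. exists u; split; auto.
  intros y Hy. rewrite <- E. auto.
Qed.

Lemma smero_sinv f z : smero f z -> smero (fun y => sinv (f y)) z.
Proof.
  intros [H|H]; [right|left; auto]. apply (schart_ext f); auto.
  intros y. now rewrite sinv_invol.
Qed.

Lemma smero_finite_chart f z : smero f z -> f z <> Inf -> schart f z.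
Proof.
  intros [H|[r [Hr [u [Hu Hf]]]]] Hz; auto.
  assert (Hu0 : u z <> 0).
  { specialize (Hf z ltac:(rewrite Cmod_sub_diag; auto)). intros E. rewrite E in Hf.
    apply Hz. rewrite <- (sinv_invol (f z)), Hf. apply sinv_0. }
  destruct (holB_center u z r Hr Hu) as [l Hl].
  destruct (cont_neq0 idC u z (diff_cont _ _ _ _ Hl) Hu0) as [d [Hd D]].
  assert (N : forall y, Cmod (y - z) < d -> u y <> 0).
  { intros y Hy. apply Cmod_gt_0. specialize (D y Hy). generalize (Cmod_ge_0 (u z)). lra. }
  exists (Rmin r d). split; [now apply Rmin_glb_lt|].
  exists (fun y => / u y)%C. split.
  - intros y Hy. apply Rmin_case_lt in Hy as [H1 H2].
    destruct (Hu y H1) as [m Hm]. eexists. apply diff_inv; eauto.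
  - intros y Hy. apply Rmin_case_lt in Hy as [H1 H2].
    rewrite <- (sinv_invol (f y)), Hf, sinv_Fin; auto.
Qed.

Lemma smero_finite_holB f c r :
  (forall z, Cmod (z - c) < r -> smero f z /\ f z <> Inf) -> holB (fun z => val (f z)) c r.
Proof.
  intros H z Hz. destruct (H z Hz) as [H1 H2].
  destruct (smero_finite_chart f z H1 H2) as [s [Hs [u [Hu Hf]]]].
  destruct (holB_center u z s Hs Hu) as [l Hl]. exists l.
  apply (diff_ext_loc idC u _ _ _ s); auto. intros y Hy. rewrite Hf; auto.
Qed.

Definition sbound (a : R) (p : sphere) : Prop := p <> Inf /\ Cmod (val p) <= a.

Definition tame1 (f : C -> sphere) (c : C) (r : R) : Prop :=
  forall z, Cmod (z - c) < r -> sbound 2 (f z).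

Definition tame (f : C -> sphere) (c : C) (r : R) : Prop :=
  tame1 f c r \/ tame1 (fun z => sinv (f z)) c r.

Lemma tame1_sub f c r c' r' : tame1 f c r -> Cmod (c' - c) + r' <= r -> tame1 f c' r'.
Proof. intros H Hr z Hz. apply H. generalize (Cmod_sub_triangle z c' c). lra. Qed.

Lemma tame_sub f c r c' r' : tame f c r -> Cmod (c' - c) + r' <= r -> tame f c' r'.
Proof. intros [H|H] Hr; [left|right]; eapply tame1_sub; eauto. Qed.

Lemma tame1_ext f g c r : (forall z, f z = g z) -> tame1 f c r -> tame1 g c r.
Proof. intros E H z Hz. rewrite <- E. auto. Qed.

Lemma tame_sinv f c r : tame f c r -> tame (fun z => sinv (f z)) c r.
Proof.
  intros [H|H]; [right|left; auto]. apply (tame1_ext f); auto. intros z; now rewrite sinv_invol.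
Qed.

(** The bound 2 leaves room on both sides of 1: if [|u z| <= 1] then [|u| < 3/2] nearby, and
    otherwise [|u| > 1/2] nearby, so that the inverse stays below 2. *)
Lemma schart_tame f z : schart f z -> exists r, 0 < r /\ tame f z r.
Proof.
  intros [r [Hr [u [Hu Hf]]]].
  destruct (holB_center u z r Hr Hu) as [l Hl]. assert (Cu := diff_cont _ _ _ _ Hl).
  destruct (Cu (1/2)) as [d [Hd D]]; [lra|]. unfold idC in D.
  exists (Rmin r d). split; [now apply Rmin_glb_lt|].
  destruct (Rle_dec (Cmod (u z)) 1) as [H|H].
  - left. intros y Hy. apply Rmin_case_lt in Hy as [H1 H2].
    rewrite (Hf y H1). split; [discriminate|]. simpl.
    generalize (Cmod_le_add (u y) (u z)) (D y H2). lra.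
  - right. intros y Hy. apply Rmin_case_lt in Hy as [H1 H2].
    assert (K : 1/2 < Cmod (u y)).
    { generalize (Cmod_le_add (u z) (u y)) (D y H2). rewrite Cmod_minus_sym. lra. }
    assert (Hy0 : u y <> 0) by (apply Cmod_gt_0; lra).
    rewrite (Hf y H1), sinv_Fin by auto. split; [discriminate|]. simpl.
    rewrite Cmod_inv by auto. replace 2 with (/ (1/2)) by field. apply Rinv_le_contravar; lra.
Qed.

Lemma smero_tame f z : smero f z -> exists r, 0 < r /\ tame f z r.
Proof.
  intros [H|H]; destruct (schart_tame _ _ H) as [r [Hr Ht]]; exists r; split; auto.
  apply tame_sinv in Ht. destruct Ht as [Ht|Ht]; [left|right]; revert Ht; apply tame1_ext;
    intros y; now rewrite sinv_invol.
Qed.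

(** * Chartwise convergence and gluing of limits *)

(** The conditions on [f n] are asked for large [n] only, because rescaled functions are meromorphic
    on discs that grow with [n]. *)
Definition ucv1 (f : nat -> C -> sphere) (g : C -> sphere) (c : C) (r : R) : Prop :=
  (exists N, forall n, (N <= n)%nat ->
     (forall z, Cmod (z - c) < r -> f n z <> Inf) /\ holB (fun z => val (f n z)) c r) /\
  (forall z, Cmod (z - c) < r -> g z <> Inf) /\
  ucv (fun n z => val (f n z)) (fun z => val (g z)) c r.

(** Uniform convergence on a disc in one of the charts [w] and [1 / w]. *)
Definition scv (f : nat -> C -> sphere) (g : C -> sphere) (c : C) (r : R) : Prop :=
  ucv1 f g c r \/ ucv1 (fun n z => sinv (f n z)) (fun z => sinv (g z)) c r.

Lemma ucv1_sub f g c r c' r' : ucv1 f g c r -> Cmod (c' - c) + r' <= r -> ucv1 f g c' r'.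
Proof.
  intros [[N H1] [H2 H3]] Hr.
  assert (K : forall z, Cmod (z - c') < r' -> Cmod (z - c) < r).
  { intros z Hz. generalize (Cmod_sub_triangle z c' c). lra. }
  split; [|split].
  - exists N. intros n Hn. destruct (H1 n Hn). split; auto. eapply holB_sub; eauto.
  - auto.
  - eapply ucv_sub; eauto.
Qed.

Lemma scv_sub f g c r c' r' : scv f g c r -> Cmod (c' - c) + r' <= r -> scv f g c' r'.
Proof. intros [H|H] Hr; [left|right]; eapply ucv1_sub; eauto. Qed.

Lemma ucv1_subseq f f' g c r :
  (exists N psi, forall n, (N <= n)%nat -> (forall z, f' n z = f (psi n) z) /\ (n <= psi n)%nat) ->
  ucv1 f g c r -> ucv1 f' g c r.
Proof.
  intros [N0 [psi Hs]] [[N H1] [H2 H3]]. split; [|split]; auto.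
  - exists (N + N0)%nat. intros n Hn. destruct (Hs n ltac:(lia)) as [E Hp].
    destruct (H1 (psi n) ltac:(lia)) as [A1 A2]. split.
    + intros z Hz. rewrite E. auto.
    + intros z Hz. destruct (A2 z Hz) as [l Hl]. exists l.
      apply (diff_ext _ (fun z => val (f (psi n) z))); auto. intros y. now rewrite E.
  - intros e He. destruct (H3 e He) as [N1 HN]. exists (N1 + N0)%nat. intros n Hn z Hz.
    destruct (Hs n ltac:(lia)) as [E Hp]. rewrite E. apply HN; auto. lia.
Qed.

Lemma scv_subseq f f' g c r :
  (exists N psi, forall n, (N <= n)%nat -> (forall z, f' n z = f (psi n) z) /\ (n <= psi n)%nat) ->
  scv f g c r -> scv f' g c r.
Proof.
  intros Hs [H|H]; [left|right]; eapply ucv1_subseq; eauto.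
  destruct Hs as [N [psi Hs]]. exists N, psi. intros n Hn. destruct (Hs n Hn) as [E Hp].
  split; auto. intros z. now rewrite E.
Qed.

Lemma ucv1_ext_limit f g g' c r :
  (forall z, Cmod (z - c) < r -> g z = g' z) -> ucv1 f g c r -> ucv1 f g' c r.
Proof.
  intros E [H1 [H2 H3]]. split; [|split]; auto.
  - intros z Hz. rewrite <- E; auto.
  - intros e He. destruct (H3 e He) as [N HN]. exists N. intros n Hn z Hz. rewrite <- E; auto.
Qed.

Lemma scv_ext_limit f g g' c r :
  (forall z, Cmod (z - c) < r -> g z = g' z) -> scv f g c r -> scv f g' c r.
Proof.
  intros E [H|H]; [left|right]; eapply ucv1_ext_limit; eauto. intros z Hz. cbv beta. now rewrite E.
Qed.

Definition slim1 (p : nat -> sphere) (q : sphere) : Prop :=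
  (exists N, forall n, (N <= n)%nat -> p n <> Inf) /\ q <> Inf /\ ccv (fun n => val (p n)) (val q).

(** Pointwise limits in the sphere; their uniqueness is what glues the limits found on different
    discs. *)
Definition slim (p : nat -> sphere) (q : sphere) : Prop :=
  slim1 p q \/ slim1 (fun n => sinv (p n)) (sinv q).

Lemma slim1_unique p q q' : slim1 p q -> slim1 p q' -> q = q'.
Proof.
  intros [_ [H1 H2]] [_ [H3 H4]]. rewrite (Fin_val q), (Fin_val q') by auto. f_equal.
  eapply ccv_unique; eauto.
Qed.

Lemma ccv_mult u v l m : ccv u l -> ccv v m -> ccv (fun n => u n * v n)%C (l * m)%C.
Proof.
  intros Hu Hv e He.
  pose (A := Cmod l + Cmod m + 1).
  assert (HA : 1 <= A)
    by (unfold A; generalize (Cmod_ge_0 l) (Cmod_ge_0 m); lra).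
  set (e' := Rmin 1 (e / (2 * A))).
  assert (He' : 0 < e') by (apply Rmin_glb_lt; [lra|]; apply Rdiv_lt_0_compat; lra).
  assert (Hee : e' * (2 * A) <= e).
  { assert (Q : e / (2 * A) * (2 * A) = e) by (field; lra).
    eapply Rle_trans; [|right; apply Q].
    apply Rmult_le_compat_r; [lra|apply Rmin_r]. }
  assert (He1 : e' <= 1) by apply Rmin_l.
  destruct (Hu e' He') as [N1 H1]. destruct (Hv e' He') as [N2 H2].
  exists (N1 + N2)%nat. intros n Hn.
  specialize (H1 n ltac:(lia)). specialize (H2 n ltac:(lia)).
  replace (u n * v n - l * m)%C
    with ((u n - l) * (v n - m) + (u n - l) * m + l * (v n - m))%C by ring.
  eapply Rle_lt_trans; [apply Cmod_triangle|].
  eapply Rle_lt_trans; [apply Rplus_le_compat_r, Cmod_triangle|].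
  rewrite !Cmod_mult.
  assert (P1 := Cmod_ge_0 (u n - l)). assert (P2 := Cmod_ge_0 (v n - m)).
  assert (P3 := Cmod_ge_0 l). assert (P4 := Cmod_ge_0 m).
  unfold A in *. nra.
Qed.

(** For large [n] the values of [p n] in the two charts have product 1, and so do their limits. *)
Lemma slim1_mixed_unique p q q' : slim1 p q -> slim1 (fun n => sinv (p n)) (sinv q') -> q = q'.
Proof.
  intros [[N1 H1] [H2 H3]] [[N2 H4] [H5 H6]].
  assert (E : (val q * val (sinv q') = 1)%C).
  { apply (ccv_unique (fun n => val (p n) * val (sinv (p n)))%C); [now apply ccv_mult|].
    intros e He. exists (N1 + N2)%nat. intros n Hn.
    specialize (H1 n ltac:(lia)). specialize (H4 n ltac:(lia)).
    assert (V := val_neq0 _ H1 H4). destruct (sinv_val _ H1 V) as [_ ->].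
    replace (val (p n) * / val (p n) - 1)%C with (RtoC 0) by (field; auto).
    rewrite Cmod_0. auto. }
  assert (V : val q <> 0).
  { intros E0. rewrite E0 in E. replace (0 * val (sinv q'))%C with (RtoC 0) in E by ring.
    apply RtoC_inj in E. lra. }
  assert (E' : val (sinv q') = (/ val q)%C).
  { replace (val (sinv q')) with (val q * val (sinv q') * / val q)%C by (field; auto).
    rewrite E. field. auto. }
  rewrite <- (sinv_invol q'), (Fin_val (sinv q')) by auto. rewrite E'.
  rewrite sinv_Fin, Cinv_inv by auto using Cinv_neq0. now apply Fin_val.
Qed.

Lemma sinv_inj p q : sinv p = sinv q -> p = q.
Proof. intros E. rewrite <- (sinv_invol p), E. apply sinv_invol. Qed.

Lemma slim_unique p q q' : slim p q -> slim p q' -> q = q'.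
Proof.
  intros [H|H] [H'|H'].
  - eapply slim1_unique; eauto.
  - eapply slim1_mixed_unique; eauto.
  - symmetry. eapply slim1_mixed_unique; eauto.
  - apply sinv_inj. eapply slim1_unique; eauto.
Qed.

Lemma ucv1_slim f g c r y : 0 < r -> ucv1 f g c r -> ccv y c -> slim1 (fun n => f n (y n)) (g c).
Proof.
  intros Hr [[N H1] [H2 H3]] Hy.
  destruct (Hy r Hr) as [N1 HN1]. split; [|split].
  - exists (N + N1)%nat. intros n Hn. apply H1; [lia|]. apply HN1; lia.
  - apply H2. rewrite Cmod_sub_diag; auto.
  - intros e He. destruct (H3 (e/2)) as [N2 HN2]; [lra|].
    assert (Cg : cont idC (fun z => val (g z)) c).
    { eapply ucv_cont; [apply H3| |rewrite Cmod_sub_diag; auto].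
      exists N. intros n Hn. apply H1; auto. }
    destruct (Cg (e/2)) as [d [Hd D]]; [lra|]. destruct (Hy d Hd) as [N3 HN3].
    exists (N1 + N2 + N3)%nat. intros n Hn.
    specialize (HN2 n ltac:(lia) (y n) (HN1 n ltac:(lia))).
    specialize (D (y n) (HN3 n ltac:(lia))).
    generalize (Cmod_sub_triangle (val (f n (y n))) (val (g (y n))) (val (g c))). lra.
Qed.

Lemma scv_slim f g c r y : 0 < r -> scv f g c r -> ccv y c -> slim (fun n => f n (y n)) (g c).
Proof.
  intros Hr [H|H] Hy; [left|right].
  - eapply ucv1_slim; eauto.
  - apply (ucv1_slim _ _ c r y Hr H Hy).
Qed.

Lemma slim_bound p q a : 0 < a -> slim p q -> q <> Inf -> Cmod (val q) < a ->
  exists N, forall n, (N <= n)%nat -> p n <> Inf /\ Cmod (val (p n)) < a.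
Proof.
  intros Ha [[[N1 H1] [H2 H3]]|[[N1 H1] [H2 H3]]] Hq Hb.
  - destruct (H3 (a - Cmod (val q))) as [N HN]; [lra|]. exists (N + N1)%nat. intros n Hn.
    split; [apply H1; lia|]. specialize (HN n ltac:(lia)).
    generalize (Cmod_le_add (val (p n)) (val q)). lra.
  - assert (V := val_neq0 _ Hq H2). destruct (sinv_val _ Hq V) as [_ E]. rewrite E in H3.
    assert (Hv : 0 < Cmod (val q)) by now apply Cmod_gt_0.
    assert (Hi : / a < / Cmod (val q)) by (apply Rinv_lt_contravar; nra).
    assert (Ha' : 0 < / a) by now apply Rinv_0_lt_compat.
    destruct (H3 (/ Cmod (val q) - / a)) as [N HN]; [lra|]. exists (N + N1)%nat. intros n Hn.
    specialize (H1 n ltac:(lia)). specialize (HN n ltac:(lia)).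
    assert (K : / a < Cmod (val (sinv (p n)))).
    { generalize (Cmod_le_add (/ val q)%C (val (sinv (p n)))).
      rewrite Cmod_inv, Cmod_minus_sym by auto. lra. }
    assert (V2 : val (sinv (p n)) <> 0) by (apply Cmod_gt_0; lra).
    destruct (sinv_val _ H1 V2) as [E1 E2]. rewrite sinv_invol in E1, E2. split; auto.
    rewrite E2, Cmod_inv by auto. rewrite <- (Rinv_inv a). apply Rinv_lt_contravar; auto.
    apply Rmult_lt_0_compat; lra.
Qed.

(** Every disc of an open set is, after shrinking, one of these countably many. *)
Definition grid_center (k : nat) : C :=
  let (m, k1) := Cantor.of_nat k in
  let (a, k2) := Cantor.of_nat k1 in let (b, k3) := Cantor.of_nat k2 in
  let (c, d) := Cantor.of_nat k3 in
  ((INR a - INR b) / (INR m + 1), (INR c - INR d) / (INR m + 1)).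

Definition grid_radius (k : nat) : R := 8 / (INR (fst (Cantor.of_nat k)) + 1).

Lemma grid_approx (x : R) (h : R) : 0 < h ->
  exists a b, Rabs (x - (INR a - INR b) / h) <= / h.
Proof.
  intros Hh. destruct (archimed (x * h)) as [H1 H2].
  exists (Z.to_nat (up (x * h))), (Z.to_nat (- up (x * h))).
  assert (E : INR (Z.to_nat (up (x * h))) - INR (Z.to_nat (- up (x * h))) = IZR (up (x * h))).
  { rewrite !INR_IZR_INZ, <- minus_IZR. f_equal. lia. }
  rewrite E. replace (x - IZR (up (x * h)) / h) with ((x * h - IZR (up (x * h))) / h) by (field; lra).
  unfold Rdiv. rewrite Rabs_mult, (Rabs_pos_eq (/ h)) by (left; now apply Rinv_0_lt_compat).
  rewrite <- (Rmult_1_l (/ h)) at 2. apply Rmult_le_compat_r.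
  - left; now apply Rinv_0_lt_compat.
  - apply Rabs_le. lra.
Qed.

(** Some grid point of mesh [1 / h] is within [2 / h] of [z]. The radius [8 / h] is four times this,
    so [z] lies in the quarter disc on which convergence is obtained, and [10 / h < r] keeps the
    whole disc near [z]. *)
Lemma grid_cover z r : 0 < r -> exists k, 0 < grid_radius k /\
  Cmod (z - grid_center k) < grid_radius k / 4 /\
  Cmod (z - grid_center k) + grid_radius k < r.
Proof.
  intros Hr. destruct (archimed_cor1 (r / 10)) as [m [Hm1 Hm2]]; [lra|].
  set (h := INR m + 1). assert (Hh : 0 < h) by (unfold h; generalize (pos_INR m); lra).
  assert (Hi : / h < r / 10).
  { eapply Rle_lt_trans; [|apply Hm1]. apply Rinv_le_contravar; [apply lt_0_INR; lia|].
    unfold h; lra. }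
  assert (Hi0 : 0 < / h) by now apply Rinv_0_lt_compat.
  destruct (grid_approx (fst z) h Hh) as [a [b Hab]].
  destruct (grid_approx (snd z) h Hh) as [c [d Hcd]].
  exists (Cantor.to_nat (m, Cantor.to_nat (a, Cantor.to_nat (b, Cantor.to_nat (c, d))))).
  unfold grid_center, grid_radius. rewrite !Cantor.cancel_of_to. cbn [fst]. fold h.
  assert (E : Cmod (z - ((INR a - INR b) / h, (INR c - INR d) / h)) < 2 * / h).
  { assert (G : Cmod (z - ((INR a - INR b) / h, (INR c - INR d) / h)) <= sqrt 2 * / h).
    { eapply Rle_trans; [apply Cmod_2Rmax|]. apply Rmult_le_compat_l; [apply sqrt_pos|].
      apply Rmax_lub; auto. }
    assert (sqrt 2 < 2).
    { rewrite <- (sqrt_Rsqr 2) at 2 by lra. apply sqrt_lt_1_alt. unfold Rsqr. lra. }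
    nra. }
  unfold Rdiv at 1 3 6. repeat split; lra.
Qed.

Lemma tame1_limit f c r phi : 0 < r ->
  (forall n z, Cmod (z - c) < r -> smero (f n) z) -> sincr phi ->
  (forall n, tame1 (f (phi n)) c r) ->
  exists psi g, sincr psi /\ ucv1 (fun n => f (phi (psi n))) g c (r/4).
Proof.
  intros Hr Hm Hphi Ht.
  assert (Hh : forall n, holB (fun z => val (f (phi n) z)) c r).
  { intros n. apply smero_finite_holB. intros z Hz. split; auto. apply (Ht n z Hz). }
  destruct (montel (fun n z => val (f (phi n) z)) c r 2) as [psi [v [H1 H2]]]; auto.
  { intros n z Hz. apply (Ht n z Hz). }
  exists psi, (fun z => Fin (v z)). split; auto. split; [|split].
  - exists O. intros n _. split.
    + intros z Hz. apply (Ht (psi n) z). lra.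
    + eapply holB_sub; [apply Hh|]. rewrite Cmod_sub_diag. lra.
  - discriminate.
  - exact H2.
Qed.

(** Either infinitely many terms are tame in the finite chart, or all late terms are tame in the
    other one; Montel's theorem applies in that chart. *)
Lemma tame_limit f c r phi : 0 < r -> sincr phi ->
  (exists N, forall n, (N <= n)%nat -> (forall z, Cmod (z - c) < r -> smero (f n) z) /\ tame (f n) c r) ->
  exists psi g, sincr psi /\ scv (fun n => f (phi (psi n))) g c (r/4).
Proof.
  intros Hr Hphi [N0 H0].
  assert (K : forall f : nat -> C -> sphere,
    (forall n, (N0 <= n)%nat -> forall z, Cmod (z - c) < r -> smero (f n) z) ->
    (forall N, exists p, (N <= p)%nat /\ tame1 (f (phi p)) c r) ->
    exists psi g, sincr psi /\ ucv1 (fun n => f (phi (psi n))) g c (r/4)).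
  { intros f0 Hm Hinf.
    destruct (extract (fun _ p => (N0 <= p)%nat /\ tame1 (f0 (phi p)) c r)) as [chi [C1 C2]].
    { intros _ N. destruct (Hinf (N + N0)%nat) as [p [Hp1 Hp2]]. exists p. split; [lia|]. split; [lia|auto]. }
    destruct (tame1_limit (fun n => f0 (phi (chi n))) c r (fun n => n)) as [psi [g [P1 P2]]]; auto.
    - intros n z Hz. apply Hm; auto. destruct (C2 n). assert (G := sincr_ge phi (chi n) Hphi). lia.
    - intros n; lia.
    - intros n. apply C2.
    - exists (fun n => chi (psi n)), g. split; auto. now apply sincr_comp. }
  destruct (classic (forall N, exists p, (N <= p)%nat /\ tame1 (f (phi p)) c r)) as [H|H].
  - destruct (K f) as [psi [g [H1 H2]]]; auto.
    { intros n Hn. apply H0; auto. }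
    exists psi, g. split; auto. left; auto.
  - assert (H' : exists N, forall p, (N <= p)%nat -> ~ tame1 (f (phi p)) c r).
    { destruct (classic (exists N, forall p, (N <= p)%nat -> ~ tame1 (f (phi p)) c r))
        as [E|E]; auto. exfalso. apply H. intros N.
      destruct (classic (exists p, (N <= p)%nat /\ tame1 (f (phi p)) c r)) as [F|F]; auto.
      exfalso. apply E. exists N. intros p Hp Ht. eauto. }
    destruct H' as [N1 H1].
    destruct (K (fun n z => sinv (f n z))) as [psi [g [P1 P2]]].
    + intros n Hn z Hz. apply smero_sinv. apply H0; auto.
    + intros N. exists (N + N0 + N1)%nat. split; [lia|].
      assert (G := sincr_ge phi (N + N0 + N1)%nat Hphi).
      destruct (H0 (phi (N + N0 + N1)%nat)) as [_ [T|T]]; [lia| |auto].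
      exfalso. apply (H1 (N + N0 + N1)%nat); auto. lia.
    + exists psi, (fun z => sinv (g z)). split; auto. right.
      apply (ucv1_ext_limit _ g); auto. intros z _. now rewrite sinv_invol.
Qed.

Lemma scv_point f g c r z : scv f g c r -> Cmod (z - c) < r -> slim (fun n => f n z) (g z).
Proof.
  intros H Hz. apply (scv_slim f g z (r - Cmod (z - c)) (fun _ => z)); [lra| |].
  - apply (scv_sub f g c r); auto. lra.
  - intros e He. exists O. intros n _. rewrite Cmod_sub_diag. auto.
Qed.

(** The diagonal sequence converges on the quarter of every grid disc on which the functions are
    eventually tame. The limit [g] is chosen pointwise by [epsilon]; uniqueness of pointwise limits
    identifies it with each local limit, and elsewhere its value is arbitrary. *)
Lemma normal_limit (D : C -> Prop) (f : nat -> C -> sphere) :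
  (forall z, D z -> exists r N, 0 < r /\ forall n, (N <= n)%nat ->
     (forall y, Cmod (y - z) < r -> smero (f n) y) /\ tame (f n) z r) ->
  exists phi g, sincr phi /\ forall z, D z -> exists r, 0 < r /\ scv (fun n => f (phi n)) g z r.
Proof.
  intros H.
  set (good := fun k => exists N, forall n, (N <= n)%nat ->
     (forall y, Cmod (y - grid_center k) < grid_radius k -> smero (f n) y) /\
     tame (f n) (grid_center k) (grid_radius k)).
  destruct (diagonal (fun k phi => 0 < grid_radius k -> good k -> exists g,
     scv (fun n => f (phi n)) g (grid_center k) (grid_radius k / 4))) as [phi [Hphi HQ]].
  - intros k phi Hphi.
    destruct (classic (0 < grid_radius k /\ good k)) as [[H1 H2]|H1].
    + destruct (tame_limit f (grid_center k) (grid_radius k) phi H1 Hphi H2) as [psi [g [P1 P2]]].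
      exists psi. split; auto. intros _ _. eauto.
    + exists (fun n => n). split; [intros n; lia|]. tauto.
  - intros k phi phi' [N [psi Hs]] HQ H1 H2. destruct (HQ H1 H2) as [g Hg]. exists g.
    revert Hg. apply scv_subseq. exists N, psi. intros n Hn. destruct (Hs n Hn) as [-> ?]. auto.
  - set (g := fun z => epsilon (inhabits Inf) (fun p => slim (fun n => f (phi n) z) p)).
    exists phi, g. split; auto. intros z Hz. destruct (H z Hz) as [r [N [Hr HN]]].
    destruct (grid_cover z r Hr) as [k [K1 [K2 K3]]].
    destruct (HQ k K1) as [gk Hgk].
    { exists N. intros n Hn. destruct (HN n Hn) as [A1 A2]. split.
      - intros y Hy. apply A1. generalize (Cmod_sub_triangle y (grid_center k) z).
        rewrite (Cmod_minus_sym (grid_center k) z). lra.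
      - apply (tame_sub (f n) z r); auto. rewrite Cmod_minus_sym. lra. }
    exists (grid_radius k / 4 - Cmod (z - grid_center k)). split; [lra|].
    apply (scv_sub _ _ (grid_center k) (grid_radius k / 4)); [|lra].
    apply (scv_ext_limit _ gk); auto.
    intros y Hy. assert (S := scv_point _ _ _ _ _ Hgk Hy).
    apply (slim_unique (fun n => f (phi n) y)); auto.
    unfold g. apply epsilon_spec. eauto.
Qed.

(** * Rescaling and Picard's theorem *)

(** Connectedness through calculus: along the segment from [z0] to [z] the indicator function of [A]
    has derivative 0, so its values at the two ends agree. *)
Lemma clopen_plane (A : C -> Prop) z0 :
  (forall z, exists r, 0 < r /\ ((forall y, Cmod (y - z) < r -> A y) \/
                                 (forall y, Cmod (y - z) < r -> ~ A y))) ->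
  A z0 -> forall z, A z.
Proof.
  intros H H0 z.
  set (F := fun t : R => if excluded_middle_informative (A (z0 + t * (z - z0))%C)
                         then RtoC 1 else RtoC 0).
  assert (E := CI_derive F (fun _ => RtoC 0) 0 1 ltac:(lra)).
  rewrite CI_const in E by lra.
  destruct (excluded_middle_informative (A z)) as [Hz|Hz]; auto. exfalso.
  assert (E1 : F 1 = RtoC 0).
  { unfold F. replace (z0 + 1 * (z - z0))%C with z by ring.
    destruct (excluded_middle_informative (A z)); tauto. }
  assert (E0 : F 0 = RtoC 1).
  { unfold F. replace (z0 + 0 * (z - z0))%C with z0 by ring.
    destruct (excluded_middle_informative (A z0)); tauto. }
  rewrite E1, E0 in E.
  assert (K : (0 * (1 - 0)%R = 0 - 1)%C).
  { apply E; [|apply conton_const]. intros t _.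
    destruct (H (z0 + t * (z - z0))%C) as [r [Hr HA]].
    assert (Hd : 0 < Cmod (z - z0) + 1) by (generalize (Cmod_ge_0 (z - z0)); lra).
    apply (diff_ext_loc RtoC (fun _ => F t) F t 0 (r / (Cmod (z - z0) + 1))).
    - now apply Rdiv_lt_0_compat.
    - intros y Hy. unfold F.
      assert (B : Cmod (z0 + y * (z - z0) - (z0 + t * (z - z0))) < r).
      { replace (z0 + y * (z - z0) - (z0 + t * (z - z0)))%C with ((y - t) * (z - z0))%C by ring.
        rewrite Cmod_mult.
        apply Rle_lt_trans with (Cmod (y - t) * (Cmod (z - z0) + 1)).
        - apply Rmult_le_compat_l; [apply Cmod_ge_0|lra].
        - apply Rmult_lt_reg_r with (/ (Cmod (z - z0) + 1)); [now apply Rinv_0_lt_compat|].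
          rewrite Rmult_assoc, Rinv_r, Rmult_1_r by lra. apply Hy. }
      assert (B0 : Cmod (z0 + t * (z - z0) - (z0 + t * (z - z0))) < r)
        by (rewrite Cmod_sub_diag; auto).
      destruct HA as [HA|HA]; assert (A1 := HA _ B); assert (A2 := HA _ B0);
      destruct (excluded_middle_informative (A (z0 + y * (z - z0))%C));
      destruct (excluded_middle_informative (A (z0 + t * (z - z0))%C)); tauto.
    - apply diff_const. }
  replace (0 * (1 - 0)%R)%C with (RtoC 0) in K by ring.
  rewrite <- RtoC_minus in K.
  apply RtoC_inj in K. lra.
Qed.

(** Doubling argument: as long as the conclusion fails, pass to a disc of half the
    radius; the centres would converge to a point near which [f] is not tame. *)
Lemma hofer f x0 r0 K : 0 < r0 -> 0 <= K -> ~ tame f x0 r0 ->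
  (forall y, Cmod (y - x0) <= 2 * K * r0 -> exists s, 0 < s /\ tame f y s) ->
  exists x r, 0 < r <= r0 /\ Cmod (x - x0) <= 2 * K * r0 /\ ~ tame f x r /\
    forall y, Cmod (y - x) <= K * r -> tame f y (r/2).
Proof.
  intros Hr0 HK Hnt Hloc.
  (* Radii halve and a step moves the centre by at most [K] times the old radius, so down to radius
     [r] the displacements sum to at most [2 * K * (r0 - r)]. *)
  set (Inv := fun p : C * R => 0 < snd p <= r0 /\
     Cmod (fst p - x0) <= 2 * K * (r0 - snd p) /\ ~ tame f (fst p) (snd p)).
  destruct (classic (exists p, Inv p /\
    forall y, Cmod (y - fst p) <= K * snd p -> tame f y (snd p / 2))) as [[[x r] [[H1 [H2 H3]] H4]]|H].
  { simpl in *. exists x, r. repeat split; auto; try lra. nra. }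
  exfalso.
  assert (Hstep : forall p, exists q, Inv p ->
     Inv q /\ snd q = snd p / 2 /\ Cmod (fst q - fst p) <= K * snd p).
  { intros p. destruct (classic (Inv p)) as [Hp|Hp]; [|exists p; tauto].
    destruct (classic (exists y, Cmod (y - fst p) <= K * snd p /\
      ~ tame f y (snd p / 2))) as [[y [Hy1 Hy2]]|Hy].
    - exists (y, snd p / 2). intros _. destruct Hp as [H1 [H2 H3]].
      unfold Inv; simpl. repeat split; auto; try lra.
      generalize (Cmod_sub_triangle y (fst p) x0). lra.
    - exfalso. apply H. exists p. split; auto. intros y Hy1.
      destruct (classic (tame f y (snd p / 2))); auto.
      exfalso; eauto. }
  destruct (choice _ Hstep) as [S HS].
  set (q := fix q n := match n with O => (x0, r0) | Datatypes.S n => S (q n) end).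
  assert (HI : forall n, Inv (q n)).
  { induction n; simpl.
    - unfold Inv; simpl. rewrite Cmod_sub_diag. repeat split; auto; lra.
    - apply HS; auto. }
  assert (Hsz : forall n, snd (q n) = r0 * (/2)^n).
  { induction n; simpl; [ring|]. destruct (HS (q n) (HI n)) as [_ [-> _]]. rewrite IHn. field. }
  assert (Hdist : forall n m, Cmod (fst (q (m + n)%nat) - fst (q n)) <=
     2 * K * (snd (q n) - snd (q (m + n)%nat))).
  { intros n m. induction m; simpl.
    - rewrite Cmod_sub_diag. lra.
    - destruct (HS (q (m + n)%nat) (HI _)) as [_ [-> Hd]].
      generalize (Cmod_sub_triangle (fst (S (q (m + n)%nat))) (fst (q (m + n)%nat)) (fst (q n))).
      lra. }
  assert (Hpos : forall n, 0 < snd (q n)) by (intros n; apply (HI n)).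
  (* The disc of index [n] lies within [2 * K + 1] times its radius of the limit centre, hence
     eventually inside the tame disc found there. *)
  assert (Hsmall : forall e, 0 < e -> exists N, forall n, (N <= n)%nat -> (2 * K + 1) * snd (q n) < e).
  { intros e He. destruct (pow_lt_1_zero (/2)) with (y := e / ((2 * K + 1) * r0)) as [N HN].
    { rewrite Rabs_pos_eq; lra. }
    { apply Rdiv_lt_0_compat; nra. }
    exists N. intros n Hn. specialize (HN n Hn). rewrite Rabs_pos_eq in HN by (apply pow_le; lra).
    rewrite Hsz. replace e with ((2 * K + 1) * r0 * (e / ((2 * K + 1) * r0))) by (field; split; lra).
    rewrite <- Rmult_assoc. apply Rmult_lt_compat_l; nra. }
  destruct (ccauchy_ccv (fun n => fst (q n))) as [x Hx].
  { intros e He. destruct (Hsmall (e/2)) as [N HN]; [lra|]. exists N. intros n m Hn Hm.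
    assert (A : forall n, (N <= n)%nat -> Cmod (fst (q n) - fst (q N)) < e/2).
    { intros k Hk. replace k with ((k - N) + N)%nat by lia.
      eapply Rle_lt_trans; [apply Hdist|]. specialize (HN N (le_n _)).
      assert (P1 := Hpos (k - N + N)%nat). assert (P2 := Hpos N). nra. }
    generalize (Cmod_sub_triangle (fst (q n)) (fst (q N)) (fst (q m))).
    rewrite (Cmod_minus_sym (fst (q N)) (fst (q m))). assert (A1 := A n Hn). assert (A2 := A m Hm). lra. }
  assert (Hlim : forall n, Cmod (x - fst (q n)) <= 2 * K * snd (q n)).
  { intros n. apply le_epsilon. intros e He. destruct (Hx e He) as [N HN].
    specialize (HN (N + n)%nat ltac:(lia)). specialize (Hdist n N).
    generalize (Cmod_sub_triangle x (fst (q (N + n)%nat)) (fst (q n))).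
    rewrite (Cmod_minus_sym x (fst (q (N + n)%nat))). assert (P := Hpos (N + n)%nat). nra. }
  destruct (Hloc x) as [s [Hs Ht]]; [apply (Hlim O)|].
  destruct (Hsmall s Hs) as [N HN]. specialize (HN N (le_n _)).
  apply (proj2 (proj2 (HI N))). apply (tame_sub f x s); auto.
  specialize (Hlim N). rewrite Cmod_minus_sym. lra.
Qed.

Lemma affine_sub x (r : R) (y z : C) : 0 <= r -> Cmod (x + r * y - (x + r * z)) = r * Cmod (y - z).
Proof.
  intros Hr. replace (x + r * y - (x + r * z))%C with (r * (y - z))%C by ring.
  rewrite Cmod_mult, Cmod_Rpos; auto.
Qed.

Lemma tame_affine f x r y s : 0 < r -> tame f (x + r * y)%C (r * s) ->
  tame (fun z => f (x + r * z)%C) y s.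
Proof.
  intros Hr [H|H]; [left|right]; intros z Hz; apply H; rewrite affine_sub by lra; nra.
Qed.

Lemma tame_affine_inv f x r : 0 < r -> tame (fun z => f (x + r * z)%C) 0 1 -> tame f x r.
Proof.
  intros Hr H.
  assert (Hr0 : RtoC r <> 0) by (intros E; apply RtoC_inj in E; lra).
  assert (K : forall z, Cmod (z - x) < r ->
    Cmod ((z - x) / r - 0) < 1 /\ z = (x + r * ((z - x) / r))%C).
  { intros z Hz. split; [|field; auto].
    replace ((z - x) / r - 0)%C with ((z - x) / r)%C by ring.
    rewrite Cmod_div, Cmod_Rpos by (auto; lra).
    apply Rmult_lt_reg_r with r; auto. unfold Rdiv. rewrite Rmult_assoc, Rinv_l; lra. }
  destruct H as [H|H]; [left|right]; intros z Hz; destruct (K z Hz) as [K1 K2];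
  specialize (H _ K1); simpl in H; rewrite <- K2 in H; auto.
Qed.

Lemma schart_affine f x r y : 0 < r -> schart f (x + r * y)%C -> schart (fun z => f (x + r * z)%C) y.
Proof.
  intros Hr [s [Hs [u [Hu Hf]]]].
  assert (K : forall z, Cmod (z - y) < s / r -> Cmod (x + r * z - (x + r * y)) < s).
  { intros z Hz. rewrite affine_sub by lra.
    replace s with (r * (s / r)) by (field; lra). apply Rmult_lt_compat_l; auto. }
  exists (s / r). split; [now apply Rdiv_lt_0_compat|].
  exists (fun z => u (x + r * z)%C). split; auto.
  intros z Hz. destruct (Hu _ (K z Hz)) as [l Hl]. eexists. apply diff_affine; eauto.
Qed.

Lemma smero_affine f x r y : 0 < r -> smero f (x + r * y)%C -> smero (fun z => f (x + r * z)%C) y.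
Proof.
  intros Hr [H|H]; [left|right].
  - now apply schart_affine.
  - apply (schart_affine (fun z => sinv (f z))); auto.
Qed.

(** Tameness at the fixed scale [1/2] about every point gives a limit on the plane. Failure on the
    unit disc gives, for each chart, points [w n] of that disc where the bound 2 fails. At a point
    of accumulation the strict bound fails for [h], since it would persist nearby. The two points
    [w] together show that [h] is not constant. *)
Lemma zalcman_limit (g : nat -> C -> sphere) :
  (forall n y, Cmod y < INR n + 1 -> smero (g n) y) ->
  (forall n, ~ tame (g n) 0 1) ->
  (forall n y, Cmod y <= INR n -> tame (g n) y (1/2)) ->
  exists phi h, sincr phi /\ (forall z, exists r, 0 < r /\ scv (fun n => g (phi n)) h z r) /\
    (exists w, ~ (h w <> Inf /\ Cmod (val (h w)) < 2)) /\
    (exists w, ~ (sinv (h w) <> Inf /\ Cmod (val (sinv (h w))) < 2)).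
Proof.
  intros Hm Hnt Ht.
  destruct (normal_limit (fun _ => True) g) as [phi [h [Hphi Hh]]].
  { intros z _. destruct (INR_unbounded (Cmod z)) as [N HN]. exists (1/2), N.
    split; [lra|]. intros n Hn. apply le_INR in Hn. split.
    - intros y Hy. apply Hm. generalize (Cmod_le_add y z). lra.
    - apply Ht. lra. }
  exists phi, h. split; auto. split; [intros z; now apply Hh|].
  assert (K : forall (G : nat -> C -> sphere) (k : C -> sphere),
    (forall z, exists r, 0 < r /\ scv (fun n => G (phi n)) k z r) ->
    (forall n, ~ tame1 (G n) 0 1) -> exists w, ~ (k w <> Inf /\ Cmod (val (k w)) < 2)).
  { intros G k HG HnG.
    assert (Hw : forall n, exists w, Cmod w < 1 /\ ~ sbound 2 (G (phi n) w)).
    { intros n. destruct (classic (exists w, Cmod w < 1 /\ ~ sbound 2 (G (phi n) w))) as [E|E]; auto.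
      exfalso. apply (HnG (phi n)). intros z Hz. replace (z - 0)%C with z in Hz by ring.
      destruct (classic (sbound 2 (G (phi n) z))); auto.
      exfalso; eauto. }
    destruct (choice _ Hw) as [w Hw'].
    destruct (bolzano_weierstrass w 1) as [psi [l [Hpsi Hl]]].
    { intros n. left. apply Hw'. }
    exists l. intros [H1 H2]. destruct (HG l) as [r [Hr Hs]].
    assert (S : slim (fun n => G (phi (psi n)) (w (psi n))) (k l)).
    { apply (scv_slim (fun n => G (phi (psi n))) k l r (fun n => w (psi n))); auto.
      revert Hs. apply scv_subseq. exists O, psi. intros n _. split; auto. now apply sincr_ge. }
    destruct (slim_bound _ _ 2 ltac:(lra) S H1 H2) as [N HN].
    destruct (HN N (le_n _)) as [A1 A2].
    apply (proj2 (Hw' (psi N))). split; auto. lra. }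
  split.
  - apply (K g); auto. intros n H. apply (Hnt n). now left.
  - apply (K (fun n z => sinv (g n z)) (fun z => sinv (h z))).
    + intros z. destruct (Hh z I) as [r [Hr [S|S]]]; exists r; split; auto; [right|left]; auto.
      apply (ucv1_ext_limit _ h); [intros; now rewrite sinv_invol|].
      revert S. apply ucv1_subseq. exists O, (fun n => n). intros n _. split; auto.
      intros y. now rewrite sinv_invol.
    + intros n H. apply (Hnt n). now right.
Qed.

Lemma scv_smero f g c r : 0 < r -> scv f g c r -> smero g c.
Proof.
  assert (K : forall f g, 0 < r -> ucv1 f g c r -> schart g c).
  { intros f0 g0 Hr [[N H1] [H2 H3]]. exists r. split; auto.
    exists (fun z => val (g0 z)). split.
    - eapply weierstrass; [apply H3|]. exists N. intros n Hn. apply H1; auto.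
    - intros y Hy. apply Fin_val. auto. }
  intros Hr [H|H]; [left|right]; eapply K; eauto.
Qed.

(** The identity theorem: the points near which [g] is identically [p] form a clopen set, because in
    a chart the zeros of [u - val p] are isolated or fill a disc. *)
Lemma sconst_spread g p z0 r : (forall z, smero g z) -> 0 < r ->
  (forall z, Cmod (z - z0) < r -> g z = p) -> forall z, g z = p.
Proof.
  intros Hg Hr H0 z.
  assert (K : forall g p w, schart g w -> exists r, 0 < r /\
     ((forall y, Cmod (y - w) < r -> exists s, 0 < s /\ forall x, Cmod (x - y) < s -> g x = p) \/
      (forall y, Cmod (y - w) < r -> ~ exists s, 0 < s /\ forall x, Cmod (x - y) < s -> g x = p))).
  { clear. intros g p w [r [Hr [u [Hu Hg]]]].
    destruct (isolated_zeros (fun y => u y - val p)%C w r Hr) as [H|[s [Hs H]]].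
    - intros y Hy. destruct (Hu y Hy) as [l Hl]. eexists. apply diff_minus; [eauto|apply diff_const].
    - destruct p as [c|].
      + exists (r/4). split; [lra|]. left. intros y Hy. exists (r/4 - Cmod (y - w)). split; [lra|].
        intros x Hx. assert (Hxw : Cmod (x - w) < r/4) by (generalize (Cmod_sub_triangle x y w); lra).
        rewrite Hg by lra. f_equal. apply Cmod_sub_eq_0. specialize (H x Hxw). simpl in H.
        rewrite H. apply Cmod_0.
      (* In the finite chart [Inf] is never taken; here [val p] was only the default 0. *)
      + exists r. split; auto. right. intros y Hy [s [Hs E]].
        specialize (E y ltac:(rewrite Cmod_sub_diag; auto)). rewrite Hg in E by auto. discriminate.
    - exists (Rmin r s). split; [now apply Rmin_glb_lt|]. right.
      intros y Hy [s' [Hs' E]]. apply Rmin_case_lt in Hy as [Hy1 Hy2].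
      (* A point close to [y] but different from [w], where the value [p] is excluded. *)
      set (x := if excluded_middle_informative (y = w)
                then (w + (Rmin s' (Rmin r s) / 2)%R)%C else y).
      assert (Hm : 0 < Rmin s' (Rmin r s)) by (repeat apply Rmin_glb_lt; auto).
      assert (Hm1 := Rmin_l s' (Rmin r s)). assert (Hm2 := Rmin_r s' (Rmin r s)).
      assert (Hm3 := Rmin_l r s). assert (Hm4 := Rmin_r r s).
      assert (X : 0 < Cmod (x - w) < s /\ Cmod (x - w) < r /\ Cmod (x - y) < s').
      { unfold x. destruct (excluded_middle_informative (y = w)) as [->|Hne].
        - replace (w + (Rmin s' (Rmin r s) / 2)%R - w)%C with (RtoC (Rmin s' (Rmin r s) / 2)) by ring.
          rewrite Cmod_Rpos by lra. lra.
        - rewrite Cmod_sub_diag. repeat split; auto. apply Cmod_gt_0. now apply Csub_neq_0. }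
      destruct X as [X1 [X2 X3]]. specialize (H x X1). specialize (E x X3).
      rewrite Hg in E by auto. apply H. destruct p as [c|]; [|discriminate].
      inversion E. simpl. ring. }
  destruct (clopen_plane (fun y => exists s, 0 < s /\ forall x, Cmod (x - y) < s -> g x = p) z0)
    with (z := z) as [s [Hs E]].
  - intros w. destruct (Hg w) as [H|H].
    + apply K; auto.
    + destruct (K _ (sinv p) w H) as [s [Hs [H1|H1]]]; exists s; split; auto; [left|right]; intros y Hy.
      * destruct (H1 y Hy) as [t [Ht E]]. exists t. split; auto.
        intros x Hx. apply sinv_inj. auto.
      * intros [t [Ht E]]. apply (H1 y Hy). exists t. split; auto.
        intros x Hx. now rewrite E.
  - eauto.
  - apply E. rewrite Cmod_sub_diag; auto.
Qed.

Lemma isolated_value g u c r a : (forall z, smero g z) -> ~ (forall z w, g z = g w) ->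
  0 < r -> holB u c r -> (forall z, Cmod (z - c) < r -> g z = Fin (u z)) ->
  exists s, 0 < s /\ forall z, 0 < Cmod (z - c) < s -> (u z - a)%C <> 0.
Proof.
  intros Hg Hnc Hr Hu E.
  destruct (isolated_zeros (fun z => u z - a)%C c r Hr) as [H|H]; auto.
  - intros y Hy. destruct (Hu y Hy) as [l Hl]. eexists. apply diff_minus; [eauto|apply diff_const].
  - exfalso. apply Hnc.
    assert (K : forall z, g z = Fin a).
    { apply (sconst_spread g (Fin a) c (r/4)); auto; [lra|].
      intros z Hz. rewrite E by lra. f_equal. apply Cmod_sub_eq_0. rewrite H by auto. apply Cmod_0. }
    intros z w. now rewrite !K.
Qed.

(** If the convergence is in the chart [1 / w], finiteness of [g c] means that [v = 1 / g] is
    nonzero at [c]. Near [c] then [|v| > m] and, for large [n], [|1 / f n| > m / 2], so inverting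
    preserves uniform convergence. *)
Lemma scv_finite f g c r : 0 < r -> scv f g c r -> g c <> Inf -> exists s, 0 < s /\ ucv1 f g c s.
Proof.
  intros Hr [H|H] Hc; [exists r; auto|].
  destruct H as [[N H1] [H2 H3]].
  set (v := fun z => val (sinv (g z))) in *.
  assert (Hc0 : Cmod (c - c) < r) by (rewrite Cmod_sub_diag; auto).
  assert (Cv : cont idC v c).
  { eapply ucv_cont; [apply H3| |auto]. exists N. intros n Hn. apply H1; auto. }
  assert (Hv : v c <> 0).
  { apply val_neq0; auto. now rewrite sinv_invol. }
  destruct (cont_neq0 _ _ _ Cv Hv) as [d [Hd Dv]]. unfold idC in Dv.
  set (m := Cmod (v c) / 2). assert (Hm : 0 < m) by (unfold m; apply Cmod_gt_0 in Hv; lra).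
  set (s := Rmin r d). assert (Hs : 0 < s) by now apply Rmin_glb_lt.
  assert (Ls : forall z, Cmod (z - c) < s -> Cmod (z - c) < r /\ m < Cmod (v z)).
  { intros z Hz. apply Rmin_case_lt in Hz as [Hz1 Hz2].
    split; [exact Hz1|]. apply Dv. exact Hz2. }
  destruct (H3 (m/2)) as [N1 HN1]; [lra|].
  assert (Lf : forall n, (N + N1 <= n)%nat -> forall z, Cmod (z - c) < s ->
     m / 2 < Cmod (val (sinv (f n z))) /\ f n z <> Inf /\ (val (f n z) = / val (sinv (f n z)))%C).
  { intros n Hn z Hz. destruct (Ls z Hz) as [Hz1 Hz2].
    specialize (HN1 n ltac:(lia) z Hz1). simpl in HN1. fold (v z) in HN1.
    assert (B : m / 2 < Cmod (val (sinv (f n z)))).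
    { generalize (Cmod_le_add (v z) (val (sinv (f n z)))). rewrite (Cmod_minus_sym (v z)). lra. }
    split; auto. destruct (H1 n ltac:(lia)) as [F1 _].
    destruct (sinv_val (sinv (f n z))) as [A1 A2]; auto.
    { apply Cmod_gt_0. lra. }
    rewrite sinv_invol in A1, A2. auto. }
  assert (Lg : forall z, Cmod (z - c) < s -> g z <> Inf /\ (val (g z) = / v z)%C).
  { intros z Hz. destruct (Ls z Hz) as [Hz1 Hz2].
    destruct (sinv_val (sinv (g z))) as [A1 A2]; auto.
    { apply Cmod_gt_0. fold (v z). lra. }
    rewrite sinv_invol in A1, A2. auto. }
  exists s. split; auto. split; [|split].
  - exists (N + N1)%nat. intros n Hn. split.
    + intros z Hz. apply (Lf n Hn z Hz).
    + intros z Hz. destruct (H1 n ltac:(lia)) as [_ Hh].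
      destruct (Hh z (proj1 (Ls z Hz))) as [l Hl]. eexists.
      apply (diff_ext_loc idC (fun z => / val (sinv (f n z)))%C _ _ _ (s - Cmod (z - c))).
      * lra.
      * intros y Hy. symmetry. apply Lf; auto. unfold idC in Hy.
        generalize (Cmod_sub_triangle y z c). lra.
      * apply diff_inv; [apply Hl|]. apply Cmod_gt_0. destruct (Lf n Hn z Hz). lra.
  - intros z Hz. now apply Lg.
  - intros e He. destruct (H3 (e * (m * m) / 4)) as [N2 HN2].
    { apply Rdiv_lt_0_compat; [|lra]. apply Rmult_lt_0_compat; nra. }
    exists (N + N1 + N2)%nat. intros n Hn z Hz.
    destruct (Ls z Hz) as [Hz1 Hz2]. destruct (Lf n ltac:(lia) z Hz) as [B1 [_ B2]].
    destruct (Lg z Hz) as [_ B3]. rewrite B2, B3.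
    specialize (HN2 n ltac:(lia) z Hz1). simpl in HN2. fold (v z) in HN2.
    assert (P1 : val (sinv (f n z)) <> 0) by (apply Cmod_gt_0; lra).
    assert (P2 : v z <> 0) by (apply Cmod_gt_0; lra).
    replace (/ val (sinv (f n z)) - / v z)%C
      with ((v z - val (sinv (f n z))) / (val (sinv (f n z)) * v z))%C by (field; auto).
    apply Rle_lt_trans with (e * (m * m) / 4 / (m / 2 * m)).
    + apply Cmod_div_le; [rewrite Cmod_minus_sym; lra|nra|]. apply Cmod_mult_ge; lra.
    + replace (e * (m * m) / 4 / (m / 2 * m)) with (e / 2) by (field; lra). lra.
Qed.

(** * Roots of unity and entire functions omitting two values *)

Lemma Cexp_INR n z : Cexp (INR n * z)%C = (Cexp z ^ n)%C.
Proof.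
  induction n.
  - simpl. replace (0 * z)%C with (RtoC 0) by ring. apply Cexp_0.
  - rewrite S_INR, RtoC_plus. replace ((INR n + 1) * z)%C with (z + INR n * z)%C by ring.
    rewrite Cexp_plus, IHn. reflexivity.
Qed.

Lemma cis_pow n t : (cis t ^ n)%C = cis (INR n * t).
Proof.
  induction n.
  - simpl. rewrite Rmult_0_l. now rewrite cis_0.
  - rewrite S_INR. replace ((INR n + 1) * t) with (t + INR n * t) by ring.
    rewrite cis_plus, <- IHn. reflexivity.
Qed.

Lemma cis_2PI_Z k : cis (IZR k * (2 * PI)) = RtoC 1.
Proof.
  assert (K : forall n, cis (INR n * (2 * PI)) = RtoC 1).
  { intros n. rewrite <- cis_pow, cis_2PI. induction n; simpl; auto. rewrite IHn. ring. }
  destruct (Z_le_gt_dec 0 k) as [H|H].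
  - rewrite <- (Z2Nat.id k H), <- INR_IZR_INZ. apply K.
  - assert (E : (cis (IZR k * (2 * PI))%R * cis (INR (Z.to_nat (- k)) * (2 * PI))%R = 1)%C).
    { rewrite <- cis_plus, INR_IZR_INZ, Z2Nat.id, opp_IZR by lia.
      replace (IZR k * (2 * PI) + - IZR k * (2 * PI)) with 0 by ring. apply cis_0. }
    rewrite K in E. rewrite <- E. ring.
Qed.

Lemma roots_of_unity_dense n t : exists s, (cis s ^ (S n))%C = RtoC 1 /\ Rabs (t - s) <= 2 * PI / INR (S n).
Proof.
  assert (HPI := PI_RGT_0).
  assert (Hn : 0 < INR (S n)) by (apply lt_0_INR; lia).
  set (k := up (t * INR (S n) / (2 * PI))).
  destruct (archimed (t * INR (S n) / (2 * PI))) as [H1 H2]. fold k in H1, H2.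
  exists (IZR k * (2 * PI) / INR (S n)). split.
  - rewrite cis_pow.
    replace (INR (S n) * (IZR k * (2 * PI) / INR (S n))) with (IZR k * (2 * PI)) by (field; lra).
    apply cis_2PI_Z.
  - set (x := t * INR (S n) / (2 * PI)) in *.
    replace (t - IZR k * (2 * PI) / INR (S n)) with ((x - IZR k) * (2 * PI / INR (S n)))
      by (unfold x; field; lra).
    rewrite Rabs_mult.
    assert (Hq : 0 < 2 * PI / INR (S n)) by (apply Rdiv_lt_0_compat; lra).
    rewrite (Rabs_pos_eq (2 * PI / INR (S n))) by lra.
    rewrite <- (Rmult_1_l (2 * PI / INR (S n))) at 2.
    apply Rmult_le_compat_r; [lra|]. apply Rabs_le. lra.
Qed.

Lemma sphere_charts_cover p :
  (p <> Inf /\ Cmod (val p) < 2) \/ (sinv p <> Inf /\ Cmod (val (sinv p)) < 2).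
Proof.
  destruct p as [c|].
  - destruct (Rlt_dec (Cmod c) 2) as [H|H]; [left; split; [discriminate|auto]|right].
    assert (Hc0 : c <> 0) by (apply Cmod_gt_0; lra).
    rewrite sinv_Fin by auto. split; [discriminate|]. simpl.
    rewrite Cmod_inv by auto. apply Rle_lt_trans with (/ 2); [apply Rinv_le_contravar; lra|lra].
  - right. simpl. split; [discriminate|]. rewrite Cmod_0. lra.
Qed.

Lemma entire_schart h z : entire h -> schart (fun z => Fin (h z)) z.
Proof.
  intros H. exists 1. split; [lra|]. exists h. split; auto. now apply entire_holB.
Qed.

(** If every disc about 0 were tame, a chart failing on one disc would fail on all larger ones, so a
    single chart would serve all discs. Then [h] or [1 / h] is bounded by 2 on the plane, and
    Liouville's theorem applies. *)
Lemma entire_not_tame h : entire h -> (forall z, h z <> 0) -> ~ (forall z w, h z = h w) ->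
  exists r, 0 < r /\ ~ tame (fun z => Fin (h z)) 0 r.
Proof.
  intros Hh H0 Hnc.
  destruct (classic (exists r, 0 < r /\ ~ tame (fun z => Fin (h z)) 0 r))
    as [E|E]; auto.
  exfalso.
  assert (T : forall r, 0 < r -> tame (fun z => Fin (h z)) 0 r).
  { intros r Hr. destruct (classic (tame (fun z => Fin (h z)) 0 r)); auto.
    exfalso; eauto. }
  assert (B : forall z, Cmod (z - 0) < Cmod z + 1)
    by (intros z; replace (z - 0)%C with z by ring; lra).
  assert (P : forall z, 0 < Cmod z + 1) by (intros z; generalize (Cmod_ge_0 z); lra).
  destruct (classic (exists r, 0 < r /\ ~ tame1 (fun z => Fin (h z)) 0 r))
    as [[r0 [Hr0 T1]]|T1].
  - assert (T2 : forall r, 0 < r -> tame1 (fun z => sinv (Fin (h z))) 0 r).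
    { intros r Hr. assert (M1 := Rmax_l r r0). assert (M2 := Rmax_r r r0).
      destruct (T (Rmax r r0)) as [T2|T2]; [lra| |].
      - exfalso. apply T1. apply (tame1_sub _ _ _ _ _ T2). rewrite Cmod_sub_diag. lra.
      - apply (tame1_sub _ _ _ _ _ T2). rewrite Cmod_sub_diag. lra. }
    assert (Hc : forall z w, (/ h z = / h w)%C).
    { apply (liouville (fun z => / h z)%C 2).
      - intros z. destruct (Hh z) as [l Hl]. eexists. apply diff_inv; eauto.
      - intros z. assert (S := T2 (Cmod z + 1) (P z) z (B z)). cbv beta in S.
        rewrite sinv_Fin in S by auto. apply S. }
    apply Hnc. intros z w. rewrite <- (Cinv_inv (h z)), <- (Cinv_inv (h w)) by auto.
    now rewrite (Hc z w).
  - apply Hnc. apply (liouville h 2); auto. intros z.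
    destruct (Rle_dec (Cmod (h z)) 2) as [H|H]; auto. exfalso. apply T1.
    exists (Cmod z + 1). split; auto. intros S. apply H. apply (S z (B z)).
Qed.

Lemma picard_entire G : entire G -> (forall z, G z <> 0) -> (forall z, G z <> RtoC 1) ->
  forall z w, G z = G w.
Proof.
  intros HG HG0 HG1.
  destruct (classic (forall z w, G z = G w)) as [E|Hnc]; auto. exfalso.
  destruct (entire_log G HG HG0) as [p [Hp Ep]].
  set (h := fun n z => Cexp (/ (INR (S n))%R * p z)%C).
  assert (Sn : forall n, RtoC (INR (S n)) <> 0).
  { intros n E. apply RtoC_inj in E. assert (0 < INR (S n)) by (apply lt_0_INR; lia). lra. }
  assert (Hpow : forall n z, (h n z ^ S n)%C = G z).
  { intros n z. unfold h. rewrite <- Cexp_INR, Ep. f_equal. field. apply Sn. }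
  assert (Hh : forall n, entire (h n)).
  { intros n z. destruct (Hp z) as [l Hl]. eexists.
    apply (diff_comp idC (fun z => / (INR (S n))%R * p z)%C Cexp); [apply diff_scal, Hl|apply Cexp_diff]. }
  assert (Hh0 : forall n z, h n z <> 0) by (intros n z; apply Cexp_neq0).
  assert (Hhnc : forall n, ~ (forall z w, h n z = h n w)).
  { intros n E. apply Hnc. intros z w. rewrite <- (Hpow n z), <- (Hpow n w), (E z w). auto. }
  assert (Hx : forall n, exists xr : C * R, 0 < snd xr /\
     ~ tame (fun z => Fin (h n z)) (fst xr) (snd xr) /\
     forall y, Cmod (y - fst xr) <= INR n * snd xr -> tame (fun z => Fin (h n z)) y (snd xr / 2)).
  { intros n. destruct (entire_not_tame (h n)) as [r0 [Hr0 Ht]]; auto.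
    destruct (hofer (fun z => Fin (h n z)) 0 r0 (INR n)) as [x [r [H1 [H2 [H3 H4]]]]]; auto.
    - apply pos_INR.
    - intros y _. apply smero_tame. left. now apply entire_schart.
    - exists (x, r). simpl. repeat split; auto. lra. }
  destruct (choice _ Hx) as [xr Hxr].
  set (g0 := fun n z => h n (fst (xr n) + snd (xr n) * z)%C).
  set (g := fun n z => Fin (g0 n z)).
  assert (Hg0 : forall n, entire (g0 n)).
  { intros n z. destruct (Hh n (fst (xr n) + snd (xr n) * z)%C) as [l Hl].
    eexists. apply diff_affine; eauto. }
  destruct (zalcman_limit g) as [phi [k [Hphi [Hk [[w1 Hw1] [w2 Hw2]]]]]].
  { intros n y _. left. apply entire_schart, Hg0. }
  { intros n Ht. destruct (Hxr n) as [H1 [H2 _]]. apply H2.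
    apply (tame_affine_inv (fun z => Fin (h n z))); auto. }
  { intros n y Hy. destruct (Hxr n) as [H1 [_ H2]].
    apply (tame_affine (fun z => Fin (h n z))); auto.
    replace (snd (xr n) * (1/2)) with (snd (xr n) / 2) by field. apply H2.
    replace (fst (xr n) + snd (xr n) * y - fst (xr n))%C with (snd (xr n) * y)%C by ring.
    rewrite Cmod_mult, Cmod_Rpos by lra. rewrite Rmult_comm. apply Rmult_le_compat_r; lra. }
  assert (Sk : forall z, smero k z).
  { intros z. destruct (Hk z) as [r [Hr H]]. eapply scv_smero; eauto. }
  assert (Knc : ~ (forall z w, k z = k w)).
  { intros E. rewrite (E w1 w2) in Hw1. destruct (sphere_charts_cover (k w2)); tauto. }
  (* A pole of [k] is an isolated zero of its inverse, and Hurwitz's theorem would produce zeros of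
     the inverses [1 / g0]. *)
  assert (Kfin : forall z, k z <> Inf).
  { intros z Ez. destruct (Hk z) as [r [Hr [H|H]]].
    - destruct H as [_ [H _]]. apply (H z); auto. rewrite Cmod_sub_diag; auto.
    - destruct H as [[N H1] [H2 H3]].
      assert (Hv := weierstrass _ _ _ _ H3
        (ex_intro _ N (fun n Hn => proj2 (H1 n Hn)))).
      destruct (isolated_value (fun z => sinv (k z)) (fun z => val (sinv (k z))) z r 0) as [s [Hs Hiso]]; auto.
      { intros y. now apply smero_sinv. }
      { intros E. apply Knc. intros y y'. apply sinv_inj. apply E. }
      { intros y Hy. apply Fin_val. auto. }
      destruct (hurwitz _ _ _ _ Hr H3 (ex_intro _ N (fun n Hn => proj2 (H1 n Hn)))) with (s := 1)
        as [N1 HN1].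
      + rewrite Ez. reflexivity.
      + exists s. split; auto. intros y Hy E. apply (Hiso y Hy). rewrite E. ring.
      + lra.
      + destruct (HN1 N1 (le_n _)) as [y [_ [_ Ey]]]. unfold g in Ey.
        rewrite sinv_Fin in Ey by (unfold g0; apply Hh0). simpl in Ey.
        apply (Cinv_neq0 (g0 (phi N1) y)); auto. apply Hh0. }
  (* If [k z = cis t], take roots of unity [cis (s n)] of order [S n] tending to [cis t]. Hurwitz's
     theorem for the rescaled functions minus these roots gives a point where some [h n] equals such
     a root, and there [G] is 1. *)
  assert (K1 : forall z, Cmod (val (k z)) <> 1).
  { intros z Ez. destruct (unit_cis _ Ez) as [t Et].
    destruct (Hk z) as [r0 [Hr0 H0]].
    destruct (scv_finite _ _ _ _ Hr0 H0 (Kfin z)) as [r [Hr [[N H1] [H2 H3]]]].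
    assert (Hv := weierstrass _ _ _ _ H3 (ex_intro _ N (fun n Hn => proj2 (H1 n Hn)))).
    destruct (choice _ (fun n => roots_of_unity_dense n t)) as [s Hs].
    destruct (isolated_value k (fun z => val (k z)) z r (cis t)) as [s0 [Hs0 Hiso]]; auto.
    { intros y Hy. apply Fin_val. auto. }
    destruct (hurwitz (fun n y => val (g (phi n) y) - cis (s (phi n)))%C (fun y => val (k y) - cis t)%C z r Hr)
      with (s := 1) as [N1 HN1].
    - intros e He. destruct (H3 (e/2)) as [N2 HN2]; [lra|].
      assert (HPI := PI_RGT_0).
      destruct (archimed_cor1 (e / (16 * PI))) as [N3 [HN3 HN3']]; [apply Rdiv_lt_0_compat; lra|].
      exists (N2 + N3)%nat. intros n Hn y Hy.
      replace (val (g (phi n) y) - cis (s (phi n)) - (val (k y) - cis t))%C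
        with ((val (g (phi n) y) - val (k y)) + (cis t - cis (s (phi n))))%C by ring.
      eapply Rle_lt_trans; [apply Cmod_triangle|].
      specialize (HN2 n ltac:(lia) y Hy).
      destruct (Hs (phi n)) as [_ Hd]. assert (L := cis_lip t (s (phi n))).
      assert (Hge := sincr_ge phi n Hphi).
      assert (Hi : / INR (S (phi n)) < e / (16 * PI)).
      { eapply Rle_lt_trans; [|apply HN3]. apply Rinv_le_contravar; [apply lt_0_INR; lia|].
        apply le_INR. lia. }
      assert (2 * PI / INR (S (phi n)) < e / 8).
      { replace (e / 8) with (2 * PI * (e / (16 * PI))) by (field; lra).
        apply Rmult_lt_compat_l; lra. }
      lra.
    - exists N. intros n Hn y Hy. destruct (proj2 (H1 n Hn) y Hy) as [l Hl].
      eexists. apply diff_minus; [apply Hl|apply diff_const].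
    - rewrite Et. ring.
    - eauto.
    - lra.
    - destruct (HN1 N1 (le_n _)) as [y [_ [_ Ey]]]. simpl in Ey.
      apply (HG1 (fst (xr (phi N1)) + snd (xr (phi N1)) * y)%C).
      rewrite <- (Hpow (phi N1)).
      replace (h (phi N1) (fst (xr (phi N1)) + snd (xr (phi N1)) * y)%C) with (cis (s (phi N1))).
      + apply Hs.
      + symmetry. apply Cmod_sub_eq_0. fold (g0 (phi N1) y). rewrite Ey. apply Cmod_0. }
  assert (Kh : holB (fun z => val (k z)) 0 (Cmod w1 + Cmod w2 + 1)).
  { apply smero_finite_holB. auto. }
  assert (Kc : forall z, cont idC (fun z => val (k z)) z).
  { intros z. apply (holB_cont _ z 1); [|rewrite Cmod_sub_diag; lra].
    apply smero_finite_holB. auto. }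
  assert (A1 : 2 <= Cmod (val (k w1))).
  { destruct (Rle_dec 2 (Cmod (val (k w1)))); auto. exfalso. apply Hw1. split; auto. lra. }
  assert (A2 : Cmod (val (k w2)) < 1).
  { destruct (Rlt_dec (Cmod (val (k w2))) 1) as [H|H]; auto. exfalso. apply Hw2.
    assert (V : val (k w2) <> 0) by (apply Cmod_gt_0; lra).
    destruct (sinv_val _ (Kfin w2) V) as [S1 S2]. split; auto. rewrite S2, Cmod_inv by auto.
    apply Rle_lt_trans with (/ 1); [apply Rinv_le_contravar; lra|lra]. }
  (* As [|k|] is never 1, the set where [|k| < 1] is clopen; it contains [w2], hence also [w1],
     against [A1]. *)
  assert (A3 : Cmod (val (k w1)) < 1).
  { apply (clopen_plane (fun z => Cmod (val (k z)) < 1) w2); auto.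
    intros z. specialize (K1 z).
    destruct (Kc z (Rabs (Cmod (val (k z)) - 1))) as [d [Hd D]].
    { apply Rabs_pos_lt. lra. }
    exists d. split; auto. unfold idC in D.
    destruct (Rlt_dec (Cmod (val (k z))) 1) as [H|H]; [left|right]; intros y Hy; specialize (D y Hy).
    - rewrite Rabs_left in D by lra. generalize (Cmod_le_add (val (k y)) (val (k z))). lra.
    - rewrite Rabs_pos_eq in D by lra. generalize (Cmod_le_add (val (k z)) (val (k y))).
      rewrite Cmod_minus_sym. lra. }
  lra.
Qed.

(** * Functions sharing three values with their derivative *)

Lemma locally_disc (P : C -> Prop) (z : C) :
  locally z P <-> exists d, 0 < d /\ forall y, Cmod (y - z) < d -> P y.
Proof.
  split.
  - intros H. apply locally_C in H. destruct H as [d H]. exists d. split; [apply cond_pos|].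
    intros y Hy. apply H. exact Hy.
  - intros [d [Hd H]]. apply locally_C. exists (mkposreal d Hd). intros y Hy. apply H. exact Hy.
Qed.

Lemma is_derive_diff (f : C -> C) (z l : C) : is_derive f z l <-> diff idC f z l.
Proof.
  split.
  - intros [_ H] e He.
    destruct (H z (fun P HP => HP) (mkposreal e He)) as [d Hd].
    exists d. split; [apply cond_pos|]. intros y Hy. specialize (Hd y Hy).
    change (Cmod (minus (minus (f y) (f z)) (scal (minus y z) l)) <= e * Cmod (y - z)) in Hd.
    unfold idC.
    replace (f y - f z - l * (y - z))%C with (minus (minus (f y) (f z)) (scal (minus y z) l)).
    + exact Hd.
    + unfold minus, plus, opp, scal; simpl. unfold mult; simpl. ring.
  - intros H. split; [apply is_linear_scal_l|].
    intros x Hx e.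
    assert (E : z = x).
    { apply (is_filter_lim_locally_unique (V := AbsRing_NormedModule C_AbsRing) z x Hx). }
    subst x. destruct (H e (cond_pos e)) as [d [Hd D]].
    exists (mkposreal d Hd). intros y Hy. specialize (D y Hy). unfold idC in D.
    change (Cmod (minus (minus (f y) (f z)) (scal (minus y z) l)) <= e * Cmod (y - z)).
    replace (minus (minus (f y) (f z)) (scal (minus y z) l)) with (f y - f z - l * (y - z))%C.
    + exact D.
    + unfold minus, plus, opp, scal; simpl. unfold mult; simpl. ring.
Qed.

Lemma ex_derive_diff (f : C -> C) (z : C) : ex_derive f z <-> exists l, diff idC f z l.
Proof.
  split; intros [l H]; exists l; now apply is_derive_diff.
Qed.

Lemma holomorphic_at_schart f z : holomorphic_at f z <-> schart f z.
Proof.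
  split.
  - intros [g H]. apply locally_disc in H. destruct H as [r [Hr H]].
    exists r. split; auto. exists g. split.
    + intros y Hy. apply ex_derive_diff, H, Hy.
    + intros y Hy. apply H, Hy.
  - intros [r [Hr [u [Hu Hf]]]]. exists u. apply locally_disc. exists r. split; auto.
    intros y Hy. split; auto. apply ex_derive_diff, Hu, Hy.
Qed.

Lemma locally'_disc (P : C -> Prop) (z : C) :
  locally' z P <-> exists d, 0 < d /\ forall y, 0 < Cmod (y - z) < d -> P y.
Proof.
  unfold locally', within. rewrite locally_disc. split; intros [d [Hd H]]; exists d; split; auto.
  - intros y [Hy1 Hy2]. apply H; auto. intros ->. rewrite Cmod_sub_diag in Hy1. lra.
  - intros y Hy Hne. apply H. split; auto. apply Cmod_gt_0. now apply Csub_neq_0.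
Qed.

(** Extended by 0 at the pole, [1 / g] is continuous there and holomorphic around it, so [removable]
    makes it a chart of the inverse. *)
Lemma pole_at_schart f z : pole_at f z -> schart (fun y => sinv (f y)) z.
Proof.
  intros [Hz [g [H1 H2]]]. apply locally'_disc in H1. destruct H1 as [r1 [Hr1 H1]].
  assert (Hlim : forall M, exists d, 0 < d /\ forall y, 0 < Cmod (y - z) < d -> M < Cmod (g y)).
  { intros M. apply locally'_disc. apply (H2 (fun x => M < x)). exists M. auto. }
  destruct (Hlim 0) as [r2 [Hr2 H0]].
  set (r := Rmin r1 r2). assert (Hr : 0 < r) by now apply Rmin_glb_lt.
  assert (L1 : r <= r1) by apply Rmin_l. assert (L2 : r <= r2) by apply Rmin_r.
  assert (Hg0 : forall y, 0 < Cmod (y - z) < r -> g y <> 0).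
  { intros y Hy. apply Cmod_gt_0. apply H0. lra. }
  set (u := fun y => if excluded_middle_informative (y = z) then RtoC 0 else (/ g y)%C).
  assert (Uz : u z = 0) by (unfold u; destruct (excluded_middle_informative (z = z)); tauto).
  assert (Uy : forall y, 0 < Cmod (y - z) -> u y = (/ g y)%C).
  { intros y Hy. unfold u. destruct (excluded_middle_informative (y = z)) as [->|]; auto.
    rewrite Cmod_sub_diag in Hy. lra. }
  assert (Du : forall y, 0 < Cmod (y - z) < r -> exists l, diff idC u y l).
  { intros y Hy. destruct (H1 y) as [_ Hd]; [lra|]. apply ex_derive_diff in Hd.
    destruct Hd as [l Hl]. eexists.
    apply (diff_ext_loc idC (fun y => / g y)%C _ _ _ (Cmod (y - z))).
    - lra.
    - intros x Hx. symmetry. apply Uy. unfold idC in Hx.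
      generalize (Cmod_sub_triangle y x z). rewrite Cmod_minus_sym in Hx. lra.
    - apply diff_inv; eauto. }
  assert (Cu : cont idC u z).
  { intros e He. destruct (Hlim (/ e)) as [d [Hd D]]. exists d. split; auto. unfold idC.
    intros y Hy. rewrite Uz. replace (u y - 0)%C with (u y) by ring.
    destruct (Req_dec (Cmod (y - z)) 0) as [E|E].
    - apply Cmod_sub_eq_0 in E. subst y. rewrite Uz, Cmod_0. auto.
    - assert (Hp : 0 < Cmod (y - z)) by (generalize (Cmod_ge_0 (y - z)); lra).
      specialize (D y (conj Hp Hy)). assert (0 < / e) by now apply Rinv_0_lt_compat.
      rewrite Uy by auto. rewrite Cmod_inv by (apply Cmod_gt_0; lra).
      rewrite <- (Rinv_inv e). apply Rinv_lt_contravar; auto. apply Rmult_lt_0_compat; lra. }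
  exists r. split; auto. exists u. split.
  - intros y Hy. destruct (Req_dec (Cmod (y - z)) 0) as [E|E].
    + apply Cmod_sub_eq_0 in E. subst y. apply (removable u z r); auto.
    + apply Du. generalize (Cmod_ge_0 (y - z)). lra.
  - intros y Hy. destruct (Req_dec (Cmod (y - z)) 0) as [E|E].
    + apply Cmod_sub_eq_0 in E. subst y. rewrite Hz, Uz. reflexivity.
    + assert (Hp : 0 < Cmod (y - z) < r) by (generalize (Cmod_ge_0 (y - z)); lra).
      destruct (H1 y) as [-> _]; [lra|]. rewrite sinv_Fin by auto. now rewrite Uy.
Qed.

Lemma meromorphic_smero D f z : meromorphic_on D f -> D z -> smero f z.
Proof.
  intros H Hz. destruct (H z Hz) as [H1|H1]; [left; now apply holomorphic_at_schart|right; now apply pole_at_schart].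
Qed.

Lemma has_derivative_of_diff f z l : schart f z -> diff idC (fun y => val (f y)) z l ->
  has_derivative f z l.
Proof.
  intros [r [Hr [u [Hu Hf]]]] H. exists (fun y => val (f y)). split.
  - apply locally_disc. exists r. split; auto. intros y Hy. rewrite Hf; auto.
  - now apply is_derive_diff.
Qed.

(** The Moebius map sending [A1], [A3], [A2] to [0], [Inf], [1]. *)
Definition moebius (A1 A2 A3 : C) (p : sphere) : C :=
  match p with
  | Fin z => ((z - A1) * (A2 - A3) / ((z - A3) * (A2 - A1)))%C
  | Inf => ((A2 - A3) / (A2 - A1))%C
  end.

(** Composition with the Moebius map sends the omitted [A3] to infinity, so [G] is entire, and it
    omits 0 and 1 because [h] omits [A1] and [A2]. Constancy returns to [h] by injectivity of the
    map. *)
Lemma picard_three_values (h : C -> sphere) (A1 A2 A3 : C) :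
  (forall z, smero h z) -> A1 <> A2 -> A1 <> A3 -> A2 <> A3 ->
  (forall z, h z <> Fin A1 /\ h z <> Fin A2 /\ h z <> Fin A3) -> forall z w, h z = h w.
Proof.
  intros Hh N12 N13 N23 Hom.
  assert (M12 := Csub_neq_0 _ _ N12). assert (M13 := Csub_neq_0 _ _ N13).
  assert (M23 := Csub_neq_0 _ _ N23).
  assert (M21 := Csub_neq_0 _ _ (not_eq_sym N12)).
  assert (Hom' : forall z x, h z = Fin x -> (x - A1)%C <> 0 /\ (x - A2)%C <> 0 /\ (x - A3)%C <> 0).
  { intros z x E. destruct (Hom z) as [H1 [H2 H3]]. rewrite E in *.
    repeat split; apply Csub_neq_0; congruence. }
  set (G := fun z => moebius A1 A2 A3 (h z)).
  assert (HG : entire G).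
  { intros z. destruct (classic (h z = Inf)) as [Ez|Ez].
    - destruct (Hh z) as [[r [Hr [u [Hu Hf]]]]|[r [Hr [u [Hu Hf]]]]].
      { rewrite Hf in Ez by (rewrite Cmod_sub_diag; auto). discriminate. }
      assert (Uz : u z = 0).
      { specialize (Hf z ltac:(rewrite Cmod_sub_diag; auto)). rewrite Ez in Hf. simpl in Hf. congruence. }
      destruct (holB_center u z r Hr Hu) as [l Hl].
      (* At a pole of [h], numerator and denominator of the Moebius map are multiplied by
         [u = 1 / h]; the denominator is then nonzero since [u z = 0]. *)
      assert (D1 : diff idC (fun y => (1 - A1 * u y) * (A2 - A3))%C z
                     ((1 - A1 * u z) * 0 + (0 - A1 * l) * (A2 - A3))%C).
      { apply (diff_mult idC (fun y => 1 - A1 * u y)%C (fun _ => (A2 - A3)%C)); [|apply diff_const].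
        apply diff_minus; [apply diff_const|now apply diff_scal]. }
      assert (D2 : diff idC (fun y => (1 - A3 * u y) * (A2 - A1))%C z
                     ((1 - A3 * u z) * 0 + (0 - A3 * l) * (A2 - A1))%C).
      { apply (diff_mult idC (fun y => 1 - A3 * u y)%C (fun _ => (A2 - A1)%C)); [|apply diff_const].
        apply diff_minus; [apply diff_const|now apply diff_scal]. }
      assert (N1 : (1 - A3 * u z)%C <> 0).
      { rewrite Uz. intros E. replace (1 - A3 * 0)%C with (RtoC 1) in E by ring.
        apply RtoC_inj in E. lra. }
      eexists. eapply (diff_ext_loc idC _ G _ _ r Hr);
        [|apply (diff_div _ _ _ _ _ _ D1 D2); now apply Cmult_neq_0].
      intros y Hy. cbv beta. unfold G. specialize (Hf y Hy).
      destruct (h y) as [x|] eqn:Ey.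
      + assert (Hx : x <> 0) by (intros ->; rewrite sinv_0 in Hf; discriminate).
        rewrite sinv_Fin in Hf by auto. inversion Hf as [Hxu]. simpl.
        destruct (Hom' y x Ey) as [_ [_ N3]]. field. repeat split; auto.
      + simpl in Hf. inversion Hf as [Hxu]. simpl. field. auto.
    - destruct (smero_finite_chart h z (Hh z) Ez) as [r [Hr [u [Hu Hf]]]].
      destruct (holB_center u z r Hr Hu) as [l Hl].
      assert (Ez' := Hf z ltac:(rewrite Cmod_sub_diag; auto)).
      destruct (Hom' z (u z) Ez') as [_ [_ N3]].
      assert (D0 : forall c, diff idC (fun y => u y - c)%C z (l - 0)%C)
        by (intros c; apply diff_minus; [auto|apply diff_const]).
      assert (D1 := diff_mult _ _ _ _ _ _ (D0 A1) (diff_const idC (A2 - A3)%C z)).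
      assert (D2 := diff_mult _ _ _ _ _ _ (D0 A3) (diff_const idC (A2 - A1)%C z)).
      eexists. eapply (diff_ext_loc idC _ G _ _ r Hr);
        [|apply (diff_div _ _ _ _ _ _ D1 D2); now apply Cmult_neq_0].
      intros y Hy. unfold G. rewrite Hf by auto. reflexivity. }
  assert (Q : forall x y : C, y <> 0 -> (x / y)%C = 0 -> x = 0).
  { intros x y Hy E. replace x with (x / y * y)%C by (field; auto). rewrite E. ring. }
  assert (HG0 : forall z, G z <> 0).
  { intros z. unfold G. destruct (h z) as [x|] eqn:Ez; simpl.
    - destruct (Hom' z x Ez) as [N1 [_ N3]]. intros E.
      apply Q in E; [|now apply Cmult_neq_0]. revert E. now apply Cmult_neq_0.
    - intros E. apply Q in E; auto. }
  assert (HG1 : forall z, G z <> RtoC 1).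
  { intros z. unfold G. destruct (h z) as [x|] eqn:Ez; simpl.
    - destruct (Hom' z x Ez) as [N1 [N2 N3]]. intros E.
      (* This product is the numerator of the Moebius map minus its denominator. *)
      assert (K : ((x - A2) * (A1 - A3) = 0)%C).
      { replace ((x - A2) * (A1 - A3))%C with
          (((x - A1) * (A2 - A3) / ((x - A3) * (A2 - A1)) - 1) * ((x - A3) * (A2 - A1)))%C
          by (field; auto).
        rewrite E. ring. }
      revert K. now apply Cmult_neq_0.
    - intros E. apply M13.
      replace (A1 - A3)%C with (((A2 - A3) / (A2 - A1) - 1) * (A2 - A1))%C by (field; auto).
      rewrite E. ring. }
  intros z w. assert (E := picard_entire G HG HG0 HG1 z w). unfold G in E.
  destruct (h z) as [x|] eqn:Ez; destruct (h w) as [y|] eqn:Ew; auto; simpl in E.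
  - destruct (Hom' z x Ez) as [N1 [N2 N3]]. destruct (Hom' w y Ew) as [N4 [N5 N6]].
    f_equal. apply Cmod_sub_eq_0.
    assert (K : ((x - y) * ((A1 - A3) * (A2 - A3)) = 0)%C).
    { replace ((x - y) * ((A1 - A3) * (A2 - A3)))%C with
        (((x - A1) * (A2 - A3) / ((x - A3) * (A2 - A1)) - (y - A1) * (A2 - A3) / ((y - A3) * (A2 - A1)))
         * ((x - A3) * (y - A3) * (A2 - A1)))%C by (field; auto).
      rewrite E. ring. }
    destruct (excluded_middle_informative ((x - y)%C = 0)) as [->|Hxy]; [apply Cmod_0|].
    exfalso. revert K. repeat apply Cmult_neq_0; auto.
  - exfalso. destruct (Hom' z x Ez) as [N1 [N2 N3]].
    assert (K : ((A1 - A3) * (A2 - A3) = 0)%C).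
    { replace ((A1 - A3) * (A2 - A3))%C with
        (((A2 - A3) / (A2 - A1) - (x - A1) * (A2 - A3) / ((x - A3) * (A2 - A1)))
         * ((x - A3) * (A2 - A1)))%C by (field; auto).
      rewrite E. ring. }
    revert K. now apply Cmult_neq_0.
  - exfalso. destruct (Hom' w y Ew) as [N1 [N2 N3]].
    assert (K : ((A1 - A3) * (A2 - A3) = 0)%C).
    { replace ((A1 - A3) * (A2 - A3))%C with
        (((A2 - A3) / (A2 - A1) - (y - A1) * (A2 - A3) / ((y - A3) * (A2 - A1)))
         * ((y - A3) * (A2 - A1)))%C by (field; auto).
      rewrite <- E. ring. }
    revert K. now apply Cmult_neq_0.
Qed.

(** * Hurwitz's theorem along sequences and the contradiction for the rescaled limit *)

Lemma ucv_minus u v u' v' c r : ucv u v c r -> ucv u' v' c r ->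
  ucv (fun n z => u n z - u' n z)%C (fun z => v z - v' z)%C c r.
Proof.
  intros H H' e He. destruct (H (e/2)) as [N HN]; [lra|]. destruct (H' (e/2)) as [N' HN']; [lra|].
  exists (N + N')%nat. intros n Hn z Hz.
  replace (u n z - u' n z - (v z - v' z))%C with ((u n z - v z) - (u' n z - v' z))%C by ring.
  eapply Rle_lt_trans; [apply Cmod_minus_le|].
  specialize (HN n ltac:(lia) z Hz). specialize (HN' n ltac:(lia) z Hz). lra.
Qed.

Lemma holB_minus f g c r : holB f c r -> holB g c r -> holB (fun z => f z - g z)%C c r.
Proof.
  intros Hf Hg z Hz. destruct (Hf z Hz). destruct (Hg z Hz). eexists. apply diff_minus; eauto.
Qed.

Lemma ucv_moving u v c r y : 0 < r -> ucv u v c r ->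
  (exists N, forall n, (N <= n)%nat -> holB (u n) c r) -> ccv y c -> ccv (fun n => u n (y n)) (v c).
Proof.
  intros Hr H Hu Hy e He.
  assert (Cv : cont idC v c) by (apply (ucv_cont u v c r); auto; rewrite Cmod_sub_diag; auto).
  destruct (H (e/2)) as [N1 HN1]; [lra|]. destruct (Cv (e/2)) as [d [Hd D]]; [lra|].
  destruct (Hy (Rmin r d)) as [N2 HN2]; [now apply Rmin_glb_lt|].
  exists (N1 + N2)%nat. intros n Hn. specialize (HN2 n ltac:(lia)). apply Rmin_case_lt in HN2 as [A1 A2]. specialize (HN1 n ltac:(lia) (y n) A1). specialize (D (y n) A2).
  generalize (Cmod_sub_triangle (u n (y n)) (v (y n)) (v c)). lra.
Qed.

Lemma hurwitz_sequence u v c r : 0 < r -> ucv u v c r ->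
  (exists N, forall n, (N <= n)%nat -> holB (u n) c r) -> v c = 0 ->
  (exists s, 0 < s /\ forall z, 0 < Cmod (z - c) < s -> v z <> 0) ->
  exists phi y, sincr phi /\ ccv y c /\ forall n, Cmod (y n - c) < r /\ u (phi n) (y n) = 0.
Proof.
  intros Hr H1 H2 H3 H4.
  destruct (extract (fun k n => exists z, Cmod (z - c) < / (INR k + 1) /\ Cmod (z - c) < r /\ u n z = 0))
    as [phi [Hphi Hz]].
  { intros k N. assert (Hk : 0 < / (INR k + 1)).
    { apply Rinv_0_lt_compat. generalize (pos_INR k). lra. }
    destruct (hurwitz u v c r Hr H1 H2 H3 H4 _ Hk) as [N' HN'].
    exists (N + N')%nat. split; [lia|]. apply HN'. lia. }
  destruct (choice _ Hz) as [y Hy]. exists phi, y. split; auto. split.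
  - intros e He. destruct (archimed_cor1 e He) as [N [HN1 HN2]]. exists N. intros n Hn.
    eapply Rlt_trans; [apply (proj1 (Hy n))|]. eapply Rle_lt_trans; [|apply HN1].
    apply Rinv_le_contravar; [apply lt_0_INR; lia|]. apply le_INR in Hn. lra.
  - intros n. split; apply Hy.
Qed.

(** The sharing conditions after rescaling: derivatives gain the factor [r n], so [f' = a_j] becomes
    [g' = r n * b n j]. They are required near each point for large [n] only, as the rescaled
    domains grow with [n], and [schart (g n) y] excludes poles, where [val] carries no
    information. *)
Lemma limit_contradiction (g : nat -> C -> sphere) (h : C -> sphere) (b : nat -> nat -> C -> C)
    (A : nat -> C) (r : nat -> R) (M : R) :
  (forall z, exists s, 0 < s /\ scv g h z s) ->
  ~ (forall z w, h z = h w) ->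
  (forall j, (1 <= j <= 3)%nat -> forall z, exists s, 0 < s /\ ucv (fun n => b n j) (fun _ => A j) z s /\
     exists N, forall n, (N <= n)%nat -> holB (b n j) z s) ->
  (forall j k, (1 <= j <= 3)%nat -> (1 <= k <= 3)%nat -> j <> k -> A j <> A k) ->
  0 < M -> (forall n, 0 < r n) -> ccv (fun n => RtoC (r n)) 0 ->
  (forall z, exists s N, 0 < s /\ forall n y j, (N <= n)%nat -> Cmod (y - z) < s -> (1 <= j <= 3)%nat ->
     schart (g n) y ->
     (diff idC (fun x => val (g n x)) y (r n * b n j y)%C -> g n y = Fin (b n j y)) /\
     (forall l, g n y = Fin (b n j y) -> diff idC (fun x => val (g n x)) y l -> Cmod l <= r n * M)) ->
  False.
Proof.
  intros Hg Hnc Hb HA HM Hr0 Hr Hshare.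
  assert (Hh : forall z, smero h z).
  { intros z. destruct (Hg z) as [s [Hs H]]. eapply scv_smero; eauto. }
  set (v := fun z => val (h z)).
  assert (Hchart : forall z, h z <> Inf -> forall j, (1 <= j <= 3)%nat -> exists s N, 0 < s /\ ucv1 g h z s /\
     ucv (fun n => b n j) (fun _ => A j) z s /\
     (forall n, (N <= n)%nat -> holB (b n j) z s) /\
     forall n y, (N <= n)%nat -> Cmod (y - z) < s -> schart (g n) y /\
     (diff idC (fun x => val (g n x)) y (r n * b n j y)%C -> g n y = Fin (b n j y)) /\
     (forall l, g n y = Fin (b n j y) -> diff idC (fun x => val (g n x)) y l -> Cmod l <= r n * M)).
  { intros z Hz j Hj. destruct (Hg z) as [s0 [Hs0 H0]].
    destruct (scv_finite _ _ _ _ Hs0 H0 Hz) as [s1 [Hs1 H1]].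
    destruct (Hb j Hj z) as [s2 [Hs2 [H2 [N2 H2']]]].
    destruct (Hshare z) as [s3 [N3 [Hs3 H3]]].
    destruct (proj1 H1) as [N1 H1'].
    set (s := Rmin s1 (Rmin s2 s3)).
    assert (Hs : 0 < s) by (repeat apply Rmin_glb_lt; auto).
    assert (L1 : s <= s1) by apply Rmin_l.
    assert (L2 : s <= s2) by (eapply Rle_trans; [apply Rmin_r|apply Rmin_l]).
    assert (L3 : s <= s3) by (eapply Rle_trans; [apply Rmin_r|apply Rmin_r]).
    exists s, (N1 + N2 + N3)%nat. split; auto. split; [|split; [|split]].
    - apply (ucv1_sub _ _ _ _ _ _ H1). rewrite Cmod_sub_diag. lra.
    - apply (ucv_sub _ _ _ _ _ _ H2). rewrite Cmod_sub_diag. lra.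
    - intros n Hn. apply (holB_sub _ _ _ _ _ (H2' n ltac:(lia))). rewrite Cmod_sub_diag. lra.
    - intros n y Hn Hy.
      assert (S : schart (g n) y).
      { destruct (H1' n ltac:(lia)) as [F1 F2].
        exists (s1 - Cmod (y - z)). split; [lra|]. exists (fun x => val (g n x)). split.
        - apply (holB_sub _ _ _ _ _ F2). lra.
        - intros x Hx. apply Fin_val, F1. generalize (Cmod_sub_triangle x y z). lra. }
      split; auto. apply H3; auto; try lia. lra. }
  assert (Hv : forall z, h z <> Inf -> exists s, 0 < s /\ holB v z s /\ forall y, Cmod (y - z) < s -> h y = Fin (v y)).
  { intros z Hz. destruct (smero_finite_chart h z (Hh z) Hz) as [s [Hs [u [Hu Hf]]]].
    exists s. split; auto. assert (E : forall y, Cmod (y - z) < s -> h y = Fin (v y)).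
    { intros y Hy. apply Fin_val. rewrite Hf by auto. discriminate. }
    split; auto. apply smero_finite_holB. intros y Hy. split; auto. rewrite Hf by auto. discriminate. }
  assert (Hder : forall z, h z <> Inf -> der v z <> 0).
  { intros z Hz D0.
    assert (K : forall j, (1 <= j <= 3)%nat -> v z = A j).
    { intros j Hj. destruct (Hchart z Hz j Hj) as [s [N [Hs [[[N1 U1] [U2 U3]] [B1 [B2 Sh]]]]]].
      assert (EU : exists N, forall n, (N <= n)%nat -> holB (fun x => val (g n x)) z s).
      { exists N1. intros n Hn. apply U1; auto. }
      assert (Vs : holB v z s) by (apply (weierstrass _ _ _ _ U3 EU)).
      assert (UD := ucv_der _ _ _ _ Hs U3 EU). fold v in UD.
      destruct (holB_center (der v) z s Hs (der_hol _ _ _ Vs)) as [l' Hl'].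
      destruct (hurwitz_sequence (fun n x => der (fun y => val (g n y)) x - r n * b n j x)%C
        (fun x => der v x - 0)%C z (s/4)) as [phi [y [Hphi [Hy Hzero]]]].
      - lra.
      - apply ucv_minus; [exact UD|].
        (* For large [n] the function [b n j] is bounded by [Cmod (A j) + 1], so [r n * b n j] tends
           to 0 uniformly and the functions given to Hurwitz's theorem tend to [der v]. *)
        intros e He. destruct (Hr (e / (Cmod (A j) + 1))) as [N2 HN2].
        { apply Rdiv_lt_0_compat; auto. generalize (Cmod_ge_0 (A j)). lra. }
        destruct (B1 1 ltac:(lra)) as [N3 HN3]. exists (N2 + N3)%nat. intros n Hn x Hx.
        specialize (HN2 n ltac:(lia)). specialize (HN3 n ltac:(lia) x ltac:(lra)).
        replace (r n - 0)%C with (RtoC (r n)) in HN2 by ring.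
        replace (r n * b n j x - 0)%C with (r n * b n j x)%C by ring.
        rewrite Cmod_mult. assert (Pr := Hr0 n). rewrite Cmod_Rpos in * by lra.
        assert (Cmod (b n j x) < Cmod (A j) + 1).
        { generalize (Cmod_le_add (b n j x) (A j)). lra. }
        assert (PA := Cmod_ge_0 (A j)).
        apply Rlt_le_trans with (r n * (Cmod (A j) + 1)).
        + apply Rmult_lt_compat_l; auto.
        + replace e with (e / (Cmod (A j) + 1) * (Cmod (A j) + 1)) by (field; lra).
          apply Rmult_le_compat_r; lra.
      - exists (N + N1)%nat. intros n Hn. apply holB_minus.
        + apply (holB_sub _ z s); [apply der_hol, U1; lia|rewrite Cmod_sub_diag; lra].
        + intros x Hx. destruct (B2 n ltac:(lia) x) as [l Hl]; [lra|].
          eexists. apply diff_scal, Hl.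
      - rewrite D0. ring.
      (* If [der v] vanished on a disc, [h] would be constant there and hence on the plane. *)
      - destruct (isolated_zeros (der v) z s Hs (der_hol _ _ _ Vs)) as [I|[t [Ht I]]].
        + exfalso. apply Hnc.
          assert (Kc : forall x, h x = h z).
          { apply (sconst_spread h (h z) z (s/4) Hh); [lra|]. intros w Hw.
            rewrite (Fin_val (h w)), (Fin_val (h z)) by (auto || (apply U2; lra)).
            f_equal. apply (zero_derivative_ball v z (s/4)); auto.
            intros q Hq. rewrite <- (I q Hq). apply der_spec, Vs. lra. }
          intros x x'. now rewrite (Kc x), (Kc x').
        + exists t. split; auto. intros w Hw E. apply (I w Hw). rewrite <- E. ring.
      - assert (Ey : forall n, (N + N1 <= n)%nat -> val (g (phi n) (y n)) = b (phi n) j (y n)).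
        { intros n Hn. assert (G := sincr_ge phi n Hphi). destruct (Hzero n) as [Z1 Z2].
          destruct (Sh (phi n) (y n) ltac:(lia) ltac:(lra)) as [S1 [S2 _]].
          rewrite S2; auto.
          apply (diff_eq _ _ _ (der (fun x => val (g (phi n) x)) (y n))).
          - apply Cmod_sub_eq_0. rewrite Z2. apply Cmod_0.
          - apply der_spec. apply U1; [lia|lra]. }
        apply (ccv_unique (fun n => val (g (phi n) (y n)))).
        + apply (ucv_moving (fun n x => val (g (phi n) x)) v z s y Hs); auto.
          * intros e He. destruct (U3 e He) as [N2 HN2]. exists N2. intros n Hn. apply HN2.
            assert (G := sincr_ge phi n Hphi). lia.
          * exists N1. intros n Hn. apply U1. assert (G := sincr_ge phi n Hphi). lia.
        + assert (L : ccv (fun n => b (phi n) j (y n)) (A j)).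
          { apply (ucv_moving (fun n => b (phi n) j) (fun _ => A j) z s y Hs); auto.
            * intros e He. destruct (B1 e He) as [N2 HN2]. exists N2. intros n Hn. apply HN2.
              assert (G := sincr_ge phi n Hphi). lia.
            * exists N. intros n Hn. apply B2. assert (G := sincr_ge phi n Hphi). lia. }
          intros e He. destruct (L e He) as [N2 HN2]. exists (N + N1 + N2)%nat. intros n Hn.
          rewrite Ey by lia. apply HN2. lia. }
    apply (HA 1%nat 2%nat); try lia. rewrite <- (K 1%nat), <- (K 2%nat) by lia. auto. }
  assert (Hom : forall z j, (1 <= j <= 3)%nat -> h z <> Fin (A j)).
  { intros z j Hj Ez. assert (Hz : h z <> Inf) by (rewrite Ez; discriminate).
    destruct (Hchart z Hz j Hj) as [s [N [Hs [[[N1 U1] [U2 U3]] [B1 [B2 Sh]]]]]].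
    assert (EU : exists N, forall n, (N <= n)%nat -> holB (fun x => val (g n x)) z s).
    { exists N1. intros n Hn. apply U1; auto. }
    assert (Vs : holB v z s) by (apply (weierstrass _ _ _ _ U3 EU)).
    assert (UD := ucv_der _ _ _ _ Hs U3 EU). fold v in UD.
    destruct (hurwitz_sequence (fun n x => val (g n x) - b n j x)%C
        (fun x => v x - A j)%C z s) as [phi [y [Hphi [Hy Hzero]]]]; auto.
    - apply ucv_minus; auto.
    - exists (N + N1)%nat. intros n Hn. apply holB_minus; [apply U1; lia|apply B2; lia].
    - unfold v. rewrite Ez. simpl. ring.
    - apply (isolated_value h v z s (A j)); auto. intros x Hx. apply Fin_val; auto.
    - apply (Hder z Hz).
      apply (ccv_unique (fun n => der (fun x => val (g (phi n) x)) (y n))).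
      + apply (ucv_moving (fun n => der (fun x => val (g (phi n) x))) (der v) z (s/4)); auto; [lra| |].
        * intros e He. destruct (UD e He) as [N2 HN2]. exists N2. intros n Hn. apply HN2.
          assert (G := sincr_ge phi n Hphi). lia.
        * exists N1. intros n Hn. assert (G := sincr_ge phi n Hphi).
          apply (holB_sub _ z s); [apply der_hol, U1; lia|rewrite Cmod_sub_diag; lra].
      + intros e He. destruct (Hr (e / M)) as [N2 HN2]; [now apply Rdiv_lt_0_compat|].
        exists (N + N1 + N2)%nat. intros n Hn. assert (G := sincr_ge phi n Hphi).
        destruct (Hzero n) as [Z1 Z2].
        destruct (Sh (phi n) (y n) ltac:(lia) Z1) as [S1 [_ S2]].
        destruct (U1 (phi n) ltac:(lia)) as [F1 F2].
        replace (der (fun x => val (g (phi n) x)) (y n) - 0)%C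
          with (der (fun x => val (g (phi n) x)) (y n)) by ring.
        apply Rle_lt_trans with (r (phi n) * M).
        * apply S2.
          -- rewrite (Fin_val (g (phi n) (y n))) by auto. f_equal.
             apply Cmod_sub_eq_0. rewrite Z2. apply Cmod_0.
          -- apply der_spec, F2, Z1.
        * specialize (HN2 (phi n) ltac:(lia)).
          replace (r (phi n) - 0)%C with (RtoC (r (phi n))) in HN2 by ring.
          rewrite Cmod_Rpos in HN2 by (left; apply Hr0).
          replace e with (e / M * M) by (field; lra). apply Rmult_lt_compat_r; auto. }
  apply Hnc. apply (picard_three_values h (A 1%nat) (A 2%nat) (A 3%nat)); auto; try (apply HA; lia).
  intros z. repeat split; apply Hom; lia.
Qed.

(** * The spherical metric and the passage from tameness to normality *)

Lemma chordal_sym p q : chordal_dist p q = chordal_dist q p.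
Proof.
  destruct p as [z|]; destruct q as [w|]; simpl; auto.
  rewrite Cmod_minus_sym, Rmult_comm. f_equal. apply Rmult_comm.
Qed.

Lemma one_plus_sq_pos (z : C) : 0 < 1 + Cmod z ^ 2.
Proof. generalize (Cmod_ge_0 z). nra. Qed.

Lemma sqrt_one_plus_inv (z : C) : z <> 0 ->
  sqrt (1 + Cmod (/ z) ^ 2) = sqrt (1 + Cmod z ^ 2) / Cmod z.
Proof.
  intros Hz. assert (Hp : 0 < Cmod z) by now apply Cmod_gt_0.
  rewrite Cmod_inv by auto.
  replace (1 + (/ Cmod z) ^ 2) with ((1 + Cmod z ^ 2) / (Cmod z * Cmod z)) by (field; lra).
  rewrite sqrt_div_alt by nra. f_equal. apply sqrt_square. lra.
Qed.

(** Inversion is a rotation of the sphere by a half turn, so convergence in the chart [1 / w] is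
    measured as in the finite chart. The computation rests on [sqrt (1 + |1/z|^2) = sqrt (1 + |z|^2)
    / |z|]. *)
Lemma chordal_sinv p q : chordal_dist (sinv p) (sinv q) = chordal_dist p q.
Proof.
  assert (K1 : forall z, chordal_dist (sinv (Fin z)) (sinv Inf) = chordal_dist (Fin z) Inf).
  { intros z. destruct (excluded_middle_informative (z = 0)) as [->|Hz].
    - rewrite sinv_0. simpl. reflexivity.
    - assert (Hp : 0 < Cmod z) by now apply Cmod_gt_0.
      assert (S := sqrt_lt_R0 _ (one_plus_sq_pos z)).
      rewrite sinv_Fin by auto. unfold sinv, chordal_dist.
      rewrite sqrt_one_plus_inv by auto.
      replace (/ z - 0)%C with (/ z)%C by ring. rewrite Cmod_inv, Cmod_0 by auto.
      replace (1 + 0 ^ 2) with 1 by ring. rewrite sqrt_1. field. lra. }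
  assert (K2 : forall z w : C, z <> 0 ->
    chordal_dist (sinv (Fin z)) (sinv (Fin w)) = chordal_dist (Fin z) (Fin w)).
  { intros z w Hz. assert (Hp : 0 < Cmod z) by now apply Cmod_gt_0.
    assert (S := sqrt_lt_R0 _ (one_plus_sq_pos z)). rewrite sinv_Fin by auto.
    destruct (excluded_middle_informative (w = 0)) as [->|Hw].
    - rewrite sinv_0. unfold chordal_dist. rewrite sqrt_one_plus_inv by auto.
      replace (z - 0)%C with z by ring. rewrite Cmod_0.
      replace (1 + 0 ^ 2) with 1 by ring. rewrite sqrt_1. field. lra.
    - assert (Hq : 0 < Cmod w) by now apply Cmod_gt_0.
      assert (S' := sqrt_lt_R0 _ (one_plus_sq_pos w)). rewrite sinv_Fin by auto.
      unfold chordal_dist. rewrite !sqrt_one_plus_inv by auto.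
      replace (/ z - / w)%C with ((w - z) / (z * w))%C by (field; auto).
      rewrite Cmod_div, Cmod_mult, Cmod_minus_sym by now apply Cmult_neq_0.
      field. lra. }
  destruct p as [z|]; destruct q as [w|].
  - destruct (excluded_middle_informative (z = 0)) as [->|Hz]; auto.
    destruct (excluded_middle_informative (w = 0)) as [->|Hw].
    + rewrite sinv_0. unfold chordal_dist.
      replace (0 - 0)%C with (RtoC 0) by ring. rewrite Cmod_0. unfold Rdiv. ring.
    + rewrite chordal_sym, (chordal_sym (Fin 0)). now apply K2.
  - apply K1.
  - rewrite chordal_sym, (chordal_sym Inf). apply K1.
  - simpl. replace (0 - 0)%C with (RtoC 0) by ring. rewrite Cmod_0. unfold Rdiv. ring.
Qed.

Lemma chordal_le (p q : sphere) : p <> Inf -> q <> Inf ->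
  0 <= chordal_dist p q <= 2 * Cmod (val p - val q).
Proof.
  destruct p as [z|]; [|tauto]. destruct q as [w|]; [|tauto]. intros _ _. simpl.
  assert (K : forall z : C, 1 <= sqrt (1 + Cmod z * (Cmod z * 1))).
  { intros y. rewrite <- sqrt_1 at 1. apply sqrt_le_1_alt. generalize (Cmod_ge_0 y). nra. }
  assert (K1 := K z). assert (K2 := K w). assert (P := Cmod_ge_0 (z - w)).
  set (s := sqrt (1 + Cmod z * (Cmod z * 1)) * sqrt (1 + Cmod w * (Cmod w * 1))).
  assert (Hs : 1 <= s) by (unfold s; nra).
  split.
  - apply Rmult_le_pos; [lra|]. left. apply Rinv_0_lt_compat. lra.
  - apply Rmult_le_reg_r with s; [lra|]. unfold Rdiv. rewrite Rmult_assoc, Rinv_l by lra. nra.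
Qed.

Lemma asin_small e : 0 < e -> exists d, 0 < d /\ forall x, 0 <= x < d -> asin x < e.
Proof.
  intros He. assert (HPI := PI_RGT_0).
  set (t := Rmin e (PI / 4)). assert (Ht : 0 < t) by (apply Rmin_glb_lt; lra).
  assert (Ht1 : t <= e) by apply Rmin_l. assert (Ht2 : t <= PI / 4) by apply Rmin_r.
  assert (Hs : 0 < sin t) by (apply sin_gt_0; lra).
  exists (sin t). split; auto. intros x [Hx0 Hx].
  destruct (Rlt_dec (asin x) t) as [H|H]; [lra|]. exfalso.
  destruct (asin_bound x) as [B1 B2].
  assert (Hx1 : -1 <= x <= 1) by (generalize (SIN_bound t); lra).
  assert (sin t <= sin (asin x)) by (apply sin_incr_1; lra).
  rewrite sin_asin in H0 by auto. lra.
Qed.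

Lemma scv_spherical f g c r : scv f g c r -> forall e, 0 < e -> exists N, forall n, (N <= n)%nat ->
  forall w, Cmod (w - c) < r -> spherical_dist (f n w) (g w) < e.
Proof.
  assert (K : forall f g, ucv1 f g c r -> forall e, 0 < e -> exists N, forall n, (N <= n)%nat ->
    forall w, Cmod (w - c) < r -> 0 <= chordal_dist (f n w) (g w) < e).
  { clear. intros f g [[N1 H1] [H2 H3]] e He. destruct (H3 (e / 2)) as [N2 HN2]; [lra|].
    exists (N1 + N2)%nat. intros n Hn w Hw.
    destruct (chordal_le (f n w) (g w)) as [A1 A2]; [apply H1; auto; lia|auto|].
    specialize (HN2 n ltac:(lia) w Hw). lra. }
  intros H e He. destruct (asin_small (e/2)) as [d [Hd D]]; [lra|].
  destruct H as [H|H]; destruct (K _ _ H (2 * d)) as [N HN]; try lra; exists N; intros n Hn w Hw;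
    specialize (HN n Hn w Hw); try rewrite chordal_sinv in HN; unfold spherical_dist;
    assert (asin (chordal_dist (f n w) (g w) / 2) < e / 2) by (apply D; lra); lra.
Qed.

(** Where [g z] is [Inf], the zero in the chart [1 / w] is either isolated, which gives a pole, or
    fills a disc. *)
Lemma smero_dichotomy g z : smero g z ->
  (holomorphic_at g z \/ pole_at g z) \/ exists r, 0 < r /\ forall y, Cmod (y - z) < r -> g y = Inf.
Proof.
  intros Hg. destruct (classic (g z = Inf)) as [Ez|Ez].
  2:{ left; left. apply holomorphic_at_schart. now apply smero_finite_chart. }
  destruct Hg as [[r [Hr [u [Hu Hf]]]]|[r [Hr [u [Hu Hf]]]]].
  { rewrite Hf in Ez by (rewrite Cmod_sub_diag; auto). discriminate. }
  destruct (isolated_zeros u z r Hr Hu) as [H|[s [Hs H]]].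
  - right. exists (r/4). split; [lra|]. intros y Hy.
    apply sinv_inj. rewrite Hf, H by lra. reflexivity.
  - left; right. split; auto. exists (fun y => / u y)%C.
    assert (Hm : 0 < Rmin r s) by now apply Rmin_glb_lt.
    split.
    + apply locally'_disc. exists (Rmin r s). split; auto. intros y [Hy0 Hy].
      apply Rmin_case_lt in Hy as [Hy1 Hy2].
      assert (Hn : u y <> 0) by (apply H; lra). split.
      * rewrite <- (sinv_invol (g y)), Hf, sinv_Fin; auto.
      * apply ex_derive_diff. destruct (Hu y Hy1) as [l Hl]. eexists. apply diff_inv; eauto.
    + intros P [M HM]. apply locally'_disc.
      assert (Cu : cont idC u z) by (apply (holB_cont u z r); auto; rewrite Cmod_sub_diag; auto).
      assert (Uz : u z = 0).
      { specialize (Hf z ltac:(rewrite Cmod_sub_diag; auto)). rewrite Ez in Hf.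
        simpl in Hf. congruence. }
      assert (HMp : 0 < / (Rabs M + 1)) by (apply Rinv_0_lt_compat; generalize (Rabs_pos M); lra).
      destruct (Cu _ HMp) as [d [Hd D]]. unfold idC in D.
      exists (Rmin d (Rmin r s)). split; [now apply Rmin_glb_lt|].
      intros y [Hy0 Hy]. apply Rmin_case_lt in Hy as [Hy1 Hy].
      apply Rmin_case_lt in Hy as [Hy2 Hy3].
      assert (Hn : u y <> 0) by (apply H; lra).
      specialize (D y Hy1). rewrite Uz in D. replace (u y - 0)%C with (u y) in D by ring.
      apply HM. rewrite Cmod_inv by auto.
      apply Rle_lt_trans with (Rabs M); [apply Rle_abs|].
      apply Rlt_trans with (Rabs M + 1); [lra|].
      rewrite <- (Rinv_inv (Rabs M + 1)). apply Rinv_lt_contravar; auto.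
      apply Rmult_lt_0_compat; auto. now apply Cmod_gt_0.
Qed.

(** The two alternatives of [smero_dichotomy] define open sets that cover [D] and are disjoint on
    it, so connectedness leaves only one of them. *)
Lemma smero_domain D g : is_domain D -> (forall z, D z -> smero g z) ->
  meromorphic_on D g \/ (forall z, D z -> g z = Inf).
Proof.
  intros [_ [_ Hcon]] Hg.
  set (U := fun z => holomorphic_at g z \/ pole_at g z).
  set (V := fun z => exists r, 0 < r /\ forall y, Cmod (y - z) < r -> g y = Inf).
  destruct (Hcon U V) as [H|H].
  - intros z [H|H].
    + apply holomorphic_at_schart in H. destruct H as [r [Hr [u [Hu Hf]]]].
      apply locally_disc. exists r. split; auto. intros y Hy. left. apply holomorphic_at_schart.
      exists (r - Cmod (y - z)). split; [lra|]. exists u. split.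
      * apply (holB_sub u z r); auto. lra.
      * intros x Hx. apply Hf. generalize (Cmod_sub_triangle x y z). lra.
    + apply locally_disc. assert (Hz := H). destruct H as [_ [k [H _]]].
      apply locally'_disc in H. destruct H as [r [Hr H]]. exists r. split; auto. intros y Hy.
      destruct (Req_dec (Cmod (y - z)) 0) as [E|E].
      * apply Cmod_sub_eq_0 in E. subst y. now right.
      * assert (Hp : 0 < Cmod (y - z)) by (generalize (Cmod_ge_0 (y - z)); lra).
        left. exists k. apply locally_disc. exists (Rmin (r - Cmod (y - z)) (Cmod (y - z))).
        split; [apply Rmin_glb_lt; lra|]. intros x Hx. apply Rmin_case_lt in Hx. apply H.
        generalize (Cmod_sub_triangle x y z) (Cmod_sub_triangle y x z).
        rewrite (Cmod_minus_sym y x). lra.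
  - intros z [r [Hr H]]. apply locally_disc. exists r. split; auto. intros y Hy.
    exists (r - Cmod (y - z)). split; [lra|]. intros x Hx. apply H.
    generalize (Cmod_sub_triangle x y z). lra.
  - intros z Hz. exact (smero_dichotomy g z (Hg z Hz)).
  - intros z Hz [[HU|HU] [r [Hr HV]]].
    + apply holomorphic_at_schart in HU. destruct HU as [s [Hs [u [Hu Hf]]]].
      assert (E1 := Hf z ltac:(rewrite Cmod_sub_diag; auto)).
      assert (E2 := HV z ltac:(rewrite Cmod_sub_diag; auto)). congruence.
    + destruct HU as [_ [k [H _]]]. apply locally'_disc in H. destruct H as [s [Hs H]].
      assert (Hm : 0 < Rmin r s) by now apply Rmin_glb_lt.
      assert (M1 := Rmin_l r s). assert (M2 := Rmin_r r s).
      assert (E : Cmod (z + (Rmin r s / 2)%R - z) = Rmin r s / 2).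
      { replace (z + (Rmin r s / 2)%R - z)%C with (RtoC (Rmin r s / 2)) by ring.
        apply Cmod_Rpos. lra. }
      destruct (H (z + (Rmin r s / 2)%R)%C) as [E1 _]; [lra|].
      rewrite HV in E1 by lra. discriminate.
  - left. exact H.
  - right. intros z Hz. destruct (H z Hz) as [r [Hr E]]. apply E. rewrite Cmod_sub_diag; auto.
Qed.

Lemma tame_family_normal D F : is_domain D -> (forall f, F f -> meromorphic_on D f) ->
  (forall z, D z -> exists r, 0 < r /\ forall f, F f -> tame f z r) -> normal_family D F.
Proof.
  intros HD HF Ht f Hf. assert (HDo := proj1 (proj2 HD)).
  destruct (normal_limit D f) as [phi [g [Hphi Hg]]].
  { intros z Hz. destruct (Ht z Hz) as [r [Hr H]].
    specialize (HDo z Hz). apply locally_disc in HDo. destruct HDo as [s [Hs Hsub]].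
    exists (Rmin r s), O. split; [now apply Rmin_glb_lt|]. intros n _. split.
    - intros y Hy. apply Rmin_case_lt in Hy. apply (meromorphic_smero D); auto. now apply Hsub.
    - apply (tame_sub (f n) z r); auto. rewrite Cmod_sub_diag. generalize (Rmin_l r s). lra. }
  exists phi, g. split; [exact Hphi|]. split.
  - apply smero_domain; auto. intros z Hz. destruct (Hg z Hz) as [r [Hr H]]. eapply scv_smero; eauto.
  - intros z Hz. destruct (Hg z Hz) as [r [Hr H]].
    exists (fun y => Cmod (y - z) < r). split; [apply locally_disc; exists r; auto|].
    intros e He. destruct (scv_spherical _ _ _ _ H e He) as [N HN]. exists N.
    intros n Hn w Hw _. apply HN; auto.
Qed.

(** * Rescaling the family at a point where it is not uniformly tame *)

Lemma share_family_tame (D : C -> Prop) (F : (C -> sphere) -> Prop) (eps M : R) (z0 : C) :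
  0 < eps -> 0 < M -> (forall f, F f -> meromorphic_on D f) ->
  (forall f, F f ->
    exists a : nat -> C -> C,
      (forall j : nat, (1 <= j <= 3)%nat -> holomorphic_on D (a j)) /\
      (forall z : C, D z -> forall j : nat, (1 <= j <= 3)%nat -> Cmod (a j z) <= M) /\
      (forall z : C, D z ->
        forall j k : nat, (1 <= j <= 3)%nat -> (1 <= k <= 3)%nat -> j <> k ->
        eps <= Cmod (a j z - a k z)%C) /\
      (forall z : C, D z -> forall j : nat, (1 <= j <= 3)%nat ->
        has_derivative f z (a j z) -> f z = Fin (a j z)) /\
      (forall z : C, D z -> forall j : nat, (1 <= j <= 3)%nat -> f z = Fin (a j z) ->
        forall l : C, has_derivative f z l -> Cmod l <= M)) ->
  locally z0 D -> exists r, 0 < r /\ forall f, F f -> tame f z0 r.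
Proof.
  intros Heps HM HF Ha HD. apply locally_disc in HD. destruct HD as [R0 [HR0 HD]].
  destruct (classic (exists r, 0 < r /\ forall f, F f -> tame f z0 r)) as [E|Hbad]; auto.
  exfalso.
  (* The doubling argument shifts the centre by at most [2 n * rho n], and the rescaled disc of
     radius [n + 1] adds at most [(n + 1) * rho n]. Quadratic decay keeps the total
     [(3 n + 1) * rho n] below [R0 / 4], where the Lipschitz bound for the [a_j] holds, and makes
     the scales tend to 0. *)
  set (rho := fun n => R0 / (8 * (INR n + 2) * (INR n + 2))).
  assert (Hrho : forall n, 0 < rho n /\ (4 * INR n + 4) * rho n < R0 * (3/4) /\ (3 * INR n + 1) * rho n < R0 / 4
            /\ rho n <= R0 * / (INR n + 1)).
  { intros n. assert (Hn := pos_INR n). set (m := INR n) in *.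
    assert (P : 0 < 8 * (m + 2) * (m + 2)) by nra.
    assert (Pr : 0 < rho n) by (apply Rdiv_lt_0_compat; auto).
    assert (Q : rho n * (8 * (m + 2) * (m + 2)) = R0) by (unfold rho; fold m; field; lra).
    assert (P1 : 0 <= rho n * m) by (apply Rmult_le_pos; lra).
    assert (P2 : 0 <= rho n * m * m) by (apply Rmult_le_pos; lra).
    repeat split; auto.
    - nra.
    - nra.
    - apply Rmult_le_reg_r with (m + 1); [lra|]. rewrite Rmult_assoc, Rinv_l by lra. nra. }
  assert (Hf : forall n, exists f, F f /\ ~ tame f z0 (rho n)).
  { intros n. destruct (classic (exists f, F f /\ ~ tame f z0 (rho n))) as [E|E]; auto.
    exfalso. apply Hbad. exists (rho n). split; [apply Hrho|]. intros f Ff.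
    destruct (classic (tame f z0 (rho n))); auto. exfalso; eauto. }
  destruct (choice _ Hf) as [f Hf'].
  assert (Hsm : forall n y, Cmod (y - z0) < R0 -> smero (f n) y).
  { intros n y Hy. apply (meromorphic_smero D); auto. apply HF, Hf'. }
  assert (Hx : forall n, exists p : C * R, 0 < snd p <= rho n /\ Cmod (fst p - z0) <= 2 * INR n * rho n /\
     ~ tame (f n) (fst p) (snd p) /\
     forall y, Cmod (y - fst p) <= INR n * snd p -> tame (f n) y (snd p / 2)).
  { intros n. destruct (Hrho n) as [R1 [R2 _]]. assert (Pn := pos_INR n).
    destruct (hofer (f n) z0 (rho n) (INR n)) as [x [r H]]; auto.
    - apply Hf'.
    - intros y Hy. apply smero_tame, Hsm. nra.
    - exists (x, r). exact H. }
  destruct (choice _ Hx) as [p Hp].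
  set (x := fun n => fst (p n)). set (r := fun n => snd (p n)).
  assert (Hr0 : forall n, 0 < r n) by (intros n; apply Hp).
  assert (Hin : forall n y, Cmod y < INR n + 1 -> Cmod (x n + r n * y - z0) < R0 / 4).
  { intros n y Hy. destruct (Hp n) as [[P1 P2] [P3 _]]. fold (x n) in P3. fold (r n) in P1, P2.
    destruct (Hrho n) as [R1 [_ [R2 _]]]. assert (Pn := pos_INR n).
    replace (x n + r n * y - z0)%C with ((x n - z0) + r n * y)%C by ring.
    eapply Rle_lt_trans; [apply Cmod_triangle|]. rewrite Cmod_mult, Cmod_Rpos by lra.
    assert (r n * Cmod y <= rho n * (INR n + 1))
      by (apply Rmult_le_compat; auto; try lra; apply Cmod_ge_0).
    nra. }
  assert (HinD : forall n y, Cmod y < INR n + 1 -> D (x n + r n * y)%C).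
  { intros n y Hy. apply HD. specialize (Hin n y Hy). lra. }
  set (g := fun n y => f n (x n + r n * y)%C).
  destruct (zalcman_limit g) as [phi [h [Hphi [Hh [[w1 Hw1] [w2 Hw2]]]]]].
  { intros n y Hy. apply (smero_affine (f n)); auto. apply Hsm. specialize (Hin n y Hy). lra. }
  { intros n Ht. destruct (Hp n) as [_ [_ [P _]]]. apply P.
    exact (tame_affine_inv (f n) (x n) (r n) (Hr0 n) Ht). }
  { intros n y Hy. apply (tame_affine (f n)); auto. destruct (Hp n) as [_ [_ [_ P]]].
    replace (r n * (1/2)) with (snd (p n) / 2) by (unfold r; field). apply P.
    fold (x n) (r n). replace (x n + r n * y - x n)%C with (r n * y)%C by ring.
    rewrite Cmod_mult, Cmod_Rpos by (left; apply Hr0).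
    rewrite Rmult_comm. apply Rmult_le_compat_r; auto. left; apply Hr0. }
  destruct (choice _ (fun n => Ha (f n) (proj1 (Hf' n)))) as [a Ha'].
  assert (Hahol : forall n j, (1 <= j <= 3)%nat -> holB (a n j) z0 R0).
  { intros n j Hj z Hz. apply ex_derive_diff. apply (proj1 (Ha' n)); auto. }
  assert (HaM : forall n j, (1 <= j <= 3)%nat -> forall z, Cmod (z - z0) < R0 -> Cmod (a n j z) <= M).
  { intros n j Hj z Hz. destruct (Ha' n) as [_ [H _]]. auto. }
  set (b := fun n j y => a n j (x n + r n * y)%C).
  assert (Hb0 : forall n j, (1 <= j <= 3)%nat -> Cmod (b n j 0) <= M).
  { intros n j Hj. apply HaM; auto. specialize (Hin n 0). rewrite Cmod_0 in Hin.
    generalize (pos_INR n). intros. specialize (Hin ltac:(lra)). lra. }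
  (* Convergence at the single point 0 suffices, because the oscillation of the [b n j] on bounded
     sets tends to 0. *)
  destruct (bolzano_weierstrass (fun n => b (phi n) 1%nat 0) M) as [c1 [A1 [Hc1 HA1]]].
  { intros n. apply Hb0. lia. }
  destruct (bolzano_weierstrass (fun n => b (phi (c1 n)) 2%nat 0) M) as [c2 [A2 [Hc2 HA2]]].
  { intros n. apply Hb0. lia. }
  destruct (bolzano_weierstrass (fun n => b (phi (c1 (c2 n))) 3%nat 0) M) as [c3 [A3 [Hc3 HA3]]].
  { intros n. apply Hb0. lia. }
  set (chi := fun n => phi (c1 (c2 (c3 n)))).
  assert (Hc : sincr (fun n => c1 (c2 (c3 n)))) by exact (sincr_comp c1 _ Hc1 (sincr_comp c2 c3 Hc2 Hc3)).
  assert (Hchi : sincr chi) by exact (sincr_comp phi _ Hphi Hc).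
  set (A := fun j => match j with 1%nat => A1 | 2%nat => A2 | _ => A3 end).
  assert (HA : forall j, (1 <= j <= 3)%nat -> ccv (fun n => b (chi n) j 0) (A j)).
  { intros j Hj. destruct j as [|[|[|[|j]]]]; try lia; simpl.
    - apply (ccv_subseq (fun n => b (phi (c1 n)) 1%nat 0) A1 (fun n => c2 (c3 n))); auto.
      intros n. generalize (sincr_ge c3 n Hc3) (sincr_ge c2 (c3 n) Hc2). lia.
    - apply (ccv_subseq (fun n => b (phi (c1 (c2 n))) 2%nat 0) A2 c3); auto.
      intros n. now apply sincr_ge.
    - exact HA3. }
  assert (Hrsmall : ccv (fun n => RtoC (r (chi n))) 0).
  { intros e He. destruct (archimed_cor1 (e / R0)) as [N [HN1 HN2]]; [now apply Rdiv_lt_0_compat|].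
    exists N. intros n Hn. replace (r (chi n) - 0)%C with (RtoC (r (chi n))) by ring.
    rewrite Cmod_Rpos by (left; auto).
    destruct (Hp (chi n)) as [[_ P] _]. fold (r (chi n)) in P.
    destruct (Hrho (chi n)) as [_ [_ [_ Q]]]. assert (G := sincr_ge chi n Hchi).
    assert (K : / (INR (chi n) + 1) < e / R0).
    { eapply Rle_lt_trans; [|apply HN1]. apply Rinv_le_contravar; [apply lt_0_INR; lia|].
      assert (INR N <= INR (chi n)) by (apply le_INR; lia). lra. }
    assert (R0 * / (INR (chi n) + 1) < R0 * (e / R0)) by (apply Rmult_lt_compat_l; auto).
    replace (R0 * (e / R0)) with e in H by (field; lra). lra. }
  assert (Hbig : forall z : C, exists N, forall n, (N <= n)%nat -> forall y, Cmod (y - z) < 1 -> Cmod y < INR (chi n) + 1).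
  { intros z. destruct (INR_unbounded (Cmod z)) as [N HN]. exists N. intros n Hn y Hy.
    assert (G := sincr_ge chi n Hchi). assert (INR N <= INR (chi n)) by (apply le_INR; lia).
    generalize (Cmod_le_add y z). lra. }
  apply (limit_contradiction (fun n => g (chi n)) h (fun n => b (chi n)) A (fun n => r (chi n)) M); auto.
  - intros z. destruct (Hh z) as [s [Hs H]]. exists s. split; auto. revert H.
    apply scv_subseq. exists O, (fun n => c1 (c2 (c3 n))). intros n _. split; auto.
    now apply (sincr_ge (fun n => c1 (c2 (c3 n)))).
  - intros E. rewrite (E w1 w2) in Hw1. destruct (sphere_charts_cover (h w2)); tauto.
  - intros j Hj z. exists 1. split; [lra|]. destruct (Hbig z) as [N HN]. split.
    + intros e He. destruct (HA j Hj (e/2)) as [N1 HN1]; [lra|].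
      set (K := 48 * M / R0 * (Cmod z + 1) + 1).
      assert (HK : 0 < K).
      { assert (0 <= 48 * M / R0 * (Cmod z + 1)).
        { apply Rmult_le_pos; [|generalize (Cmod_ge_0 z); lra].
          apply Rmult_le_pos; [lra|]. left. now apply Rinv_0_lt_compat. } unfold K. lra. }
      destruct (Hrsmall (e / 2 / K)) as [N2 HN2].
      { apply Rdiv_lt_0_compat; lra. }
      exists (N + N1 + N2)%nat. intros n Hn y Hy.
      specialize (HN n ltac:(lia) y Hy). specialize (HN1 n ltac:(lia)). specialize (HN2 n ltac:(lia)).
      replace (r (chi n) - 0)%C with (RtoC (r (chi n))) in HN2 by ring.
      rewrite Cmod_Rpos in HN2 by (left; auto).
      assert (H0 : Cmod 0 < INR (chi n) + 1) by (rewrite Cmod_0; generalize (pos_INR (chi n)); lra).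
      (* In the original variable the two points are [r (chi n) * Cmod y] apart, so the bound [M] on
         [a_j] forces the limit to be constant. *)
      assert (L : Cmod (b (chi n) j y - b (chi n) j 0) <= 48 * M / R0 * (r (chi n) * Cmod y)).
      { unfold b. eapply Rle_trans; [apply (lip_bound _ z0 R0 M)|]; auto.
        rewrite affine_sub by (left; auto). replace (y - 0)%C with y by ring. lra. }
      assert (Hy2 : Cmod y <= Cmod z + 1) by (generalize (Cmod_le_add y z); lra).
      assert (L2 : 48 * M / R0 * (r (chi n) * Cmod y) < e / 2).
      { apply Rle_lt_trans with (K * r (chi n)).
        - assert (Hq : 0 <= 48 * M / R0) by (apply Rmult_le_pos; [lra|left; now apply Rinv_0_lt_compat]).
          assert (48 * M / R0 * (r (chi n) * Cmod y) <= 48 * M / R0 * (r (chi n) * (Cmod z + 1))).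
          { apply Rmult_le_compat_l; auto. apply Rmult_le_compat_l; auto. left; auto. }
          specialize (Hr0 (chi n)). unfold K. nra.
        - replace (e / 2) with (K * (e / 2 / K)) by (field; lra).
          apply Rmult_lt_compat_l; auto. }
      generalize (Cmod_sub_triangle (b (chi n) j y) (b (chi n) j 0) (A j)). lra.
    + exists N. intros n Hn y Hy. specialize (HN n Hn y Hy). specialize (Hin (chi n) y HN).
      destruct (Hahol (chi n) j Hj (x (chi n) + r (chi n) * y)%C) as [l Hl]; [lra|].
      eexists. apply diff_affine; eauto.
  - intros j k Hj Hk Hjk E.
    destruct (HA j Hj (eps/2)) as [N1 HN1]; [lra|]. destruct (HA k Hk (eps/2)) as [N2 HN2]; [lra|].
    set (n := (N1 + N2)%nat). specialize (HN1 n ltac:(lia)). specialize (HN2 n ltac:(lia)).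
    (* The uniform separation by [eps] is what survives in the limit. *)
    assert (K : eps <= Cmod (b (chi n) j 0 - b (chi n) k 0)).
    { destruct (Ha' (chi n)) as [_ [_ [H _]]]. apply H; auto. apply HinD.
      rewrite Cmod_0. generalize (pos_INR (chi n)). lra. }
    rewrite <- E in HN2.
    generalize (Cmod_sub_triangle (b (chi n) j 0) (A j) (b (chi n) k 0)).
    rewrite (Cmod_minus_sym (A j) (b (chi n) k 0)). lra.
  - intros z. destruct (Hbig z) as [N HN]. exists 1, N. split; [lra|].
    intros n y j Hn Hy Hj Sg. specialize (HN n Hn y Hy).
    set (m := chi n) in *. set (q := (x m + r m * y)%C).
    assert (Hrm : RtoC (r m) <> 0) by (intros E; apply RtoC_inj in E; specialize (Hr0 m); lra).
    assert (Dq : D q) by now apply HinD.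
    assert (Sf : schart (f m) q).
    { apply smero_finite_chart.
      - apply Hsm. specialize (Hin m y HN). fold q in Hin. lra.
      - destruct Sg as [s [Hs [u [Hu Hg]]]]. change (f m q) with (g m y).
        rewrite Hg by (rewrite Cmod_sub_diag; auto). discriminate. }
    destruct (Ha' m) as [_ [_ [_ [S1 S2]]]]. split.
    (* By the chain rule the derivative of [g m] at [y] is [r m] times that of [f m] at [q];
       dividing by [r m] restores the hypothesis of sharing. *)
    + intros Hd. apply (S1 q Dq j Hj). apply has_derivative_of_diff; auto.
      apply (diff_eq _ _ _ (r m * b m j y / r m)%C); [unfold b; fold q; field; auto|].
      apply (diff_affine_inv (fun y => val (f m y)) (x m) (r m) y); auto.
    + intros l Hgy Hd.
      assert (B : Cmod (l / r m) <= M).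
      { apply (S2 q Dq j Hj); auto. apply has_derivative_of_diff; auto.
        apply (diff_affine_inv (fun y => val (f m y)) (x m) (r m) y); auto. }
      specialize (Hr0 m). rewrite Cmod_div, Cmod_Rpos in B by (auto; lra).
      replace (Cmod l) with (r m * (Cmod l / r m)) by (field; lra).
      apply Rmult_le_compat_l; lra.
Qed.

Theorem theorem2p2 (D : C -> Prop) (F : (C -> sphere) -> Prop) (eps M : R)
  (hD : is_domain D)
  (heps : 0 < eps)
  (hM : 0 < M)
  (hF : forall f : C -> sphere, F f -> meromorphic_on D f)
  (ha : forall f : C -> sphere, F f ->
    exists a : nat -> C -> C,
      (forall j : nat, (1 <= j <= 3)%nat -> holomorphic_on D (a j)) /\
      (forall z : C, D z ->
        forall j : nat, (1 <= j <= 3)%nat -> Cmod (a j z) <= M) /\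
      (forall z : C, D z ->
        forall j k : nat, (1 <= j <= 3)%nat -> (1 <= k <= 3)%nat -> j <> k ->
        eps <= Cmod (a j z - a k z)%C) /\
      (forall z : C, D z ->
        forall j : nat, (1 <= j <= 3)%nat ->
        has_derivative f z (a j z) -> f z = Fin (a j z)) /\
      (forall z : C, D z ->
        forall j : nat, (1 <= j <= 3)%nat ->
        f z = Fin (a j z) ->
        forall l : C, has_derivative f z l -> Cmod l <= M)) :
  normal_family D F.
Proof.
  apply tame_family_normal; auto.
  intros z Hz. apply (share_family_tame D F eps M z); auto.
  apply (proj1 (proj2 hD)), Hz.
Qed.
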